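(* Let $D\in W^{2,\infty}(U)$ be an (periodic) interaction potential, $\beta>0$, $\kappa>0$, let $(\Omega,\mathcal A,\mu)$ be a probability space, $A\in B_{2,2}(\Omega)$ an arbitrary graphop with numerical radius $n(A)$, and let $g\ge0$ be an arbitrary frequency density on $\mathbb R$ with $\|g\|_{L^1(\mathbb R)}=1$. Consider the Sakaguchi--Kuramoto mean-field equation $$\partial_t\rho=\partial_x\big(-\omega\rho+\kappa\rho\,V[A,g](\rho)\big)+\beta^{-1}\partial_{xx}\rho,\quad t\ge0,\qquad \rho(0)=\rho_0,$$ for $\rho=\rho(t,x,\xi,\omega)$, with admissible initial datum $\rho_0$ satisfying $\hat H_{g\times\mu}(\rho_0|\rho_\infty)<\infty$. If $$\kappa<\frac{2\pi^2}{L^2\,\beta\,\|\partial_{xx}D\|_{L^\infty(U)}\,n(A)},$$ then the classical solution $\rho$ satisfies $$\hat H_{g\times\mu}(\rho(t)|\rho_\infty)\le e^{-\hat\alpha t}\,\hat H_{g\times\mu}(\rho_0|\rho_\infty),\qquad t\ge0,$$ with $$\hat\alpha:=\frac{4\pi^2}{L^2\beta}-2\kappa\,\|\partial_{xx}D\|_{L^\infty(U)}\,n(A)>0 .$$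
   Context: Setting. $L>0$ and $U=[-\frac L2,\frac L2]$ is the one-dimensional flat torus of length $L$ (the usual case is $L=2\pi$); all functions of $x\in U$ are periodic and Sobolev spaces on $U$ are those of the torus. $(\Omega,\mathcal A,\mu)$ is a Borel probability space with $\operatorname{supp}\mu=\Omega$; $L^p(\Omega)=L^p(\Omega,\mu)$ is real-valued. $\omega\in\mathbb R$ is the frequency variable, with probability space $(\mathbb R,\mathcal B(\mathbb R),g\,d\omega)$; the support of $g$ need not be all of $\mathbb R$ (statements in $\omega$ are relevant only $g\,d\omega$-almost everywhere). $\mathcal P_{\rm ac}(U)$ denotes probability densities on $U$ with respect to $dx$. Graphops. A $P$-operator is a linear operator $A:L^\infty(\Omega)\to L^1(\Omega)$ with $\sup_{v\in L^\infty(\Omega)}\|Av\|_{L^1(\Omega)}/\|v\|_{L^\infty(\Omega)}<\infty$. It is self-adjoint if $\int_\Omega gAf\,d\mu=\int_\Omega fAg\,d\mu$ for all $f,g\in L^\infty(\Omega)$, and positivity preserving if $f\ge0$ implies $Af\ge0$. A graphop is a positivity preserving, self-adjoint $P$-operator. $B_{2,2}(\Omega)$ is the set of $P$-operators with $\|A\|_{2\to2}:=\sup_{v\in L^\infty(\Omega)}\|Av\|_{L^2(\Omega)}/\|v\|_{L^2(\Omega)}<\infty$, identified with their bounded extension to $L^2(\Omega)$. The numerical radius is $n(A):=\sup\{(Af,f)_{L^2(\Omega)}:f\in L^2(\Omega),\ \|f\|_{L^2(\Omega)}=1\}$. Interaction term. $$V[A,g](\rho)(t,x,\xi):=\int_{\mathbb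 R}\int_U \partial_xD(x-\tilde x)\,(A\rho)(t,\tilde x,\xi,\omega)\,d\tilde x\;g(\omega)\,d\omega,$$ where $A$ acts only on the variable $\xi$. A classical solution is one such that for a.e. $(\xi,\omega)$ (with respect to $\mu\times g\,d\omega$), $\rho(\cdot,\cdot,\xi,\omega)\in C^1(0,\infty;C^2(U))$ solves the equation. The datum $\rho_0$ is admissible if for a.e. $(\xi,\omega)$ one has $\rho_0(\cdot,\xi,\omega)\in H^{4}(U)\cap\mathcal P_{\rm ac}(U)$ and, for each $x\in U$, $\rho_0(x,\cdot,\cdot)\in L^\infty(\Omega\times\mathbb R,\mu\times g\,d\omega)$. Entropy. $\rho_\infty:=\frac1L$ and $$\hat H_{g\times\mu}(\rho|\rho_\infty):=\int_{\mathbb R}\int_\Omega\int_U\rho\log\big(\tfrac{\rho}{\rho_\infty}\big)\,dx\,d\mu(\xi)\,g(\omega)\,d\omega .$$ Convention: the upper bound on $\kappa$ is read as $+\infty$ if its denominator vanishes. *)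

(* Defs.v *)
(* MathComp-Analysis.

   Functions on the torus U = [-L/2, L/2] are represented by L-periodic
   functions R -> R, and elements of L^p spaces by representatives, equality
   in L^p being equality almost everywhere. *)
From HB Require Import structures.
From mathcomp Require Import all_boot all_order all_algebra.
From mathcomp Require Import all_classical all_reals all_analysis.

Set Implicit Arguments.
Unset Strict Implicit.
Unset Printing Implicit Defensive.

Import Order.TTheory GRing.Theory Num.Theory.
Import numFieldNormedType.Exports.

Local Open Scope classical_set_scope.
Local Open Scope ring_scope.

Section torus_measure.
Context {R : realType}.

Definition torus_itv (L : R) : set R := `[- (L / 2), L / 2].

Lemma measurable_torus_itv (L : R) :
  measurable (torus_itv L : set (measurableTypeR R)).
Proof. exact: measurable_itv. Qed.

Lemma torus_itv_lty (L : R) : (lebesgue_measure (torus_itv L) < +oo)%E.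
Proof.
by rewrite /torus_itv lebesgue_measure_itv/=; case: ifP => _; rewrite ?ltry.
Qed.

(* The measure dx on U, as a measure on R concentrated on [-L/2, L/2]. *)
Definition torus (L : R) : set (measurableTypeR R) -> \bar R :=
  mfrestr (measurable_torus_itv L) (torus_itv_lty L).

HB.instance Definition _ (L : R) := FiniteMeasure.on (torus L).

End torus_measure.

Section frequency_law.
Context {R : realType}.
Variable g : measurableTypeR R -> R.
Hypothesis mg : measurable_fun [set: measurableTypeR R] g.
Hypothesis g_ge0 : forall w, 0 <= g w.
Hypothesis g_norm1 : ('N[lebesgue_measure]_1 [EFin \o g] = 1)%E.

(* The probability measure g(w)dw; the hypotheses on g are arguments so that
   the canonical probability structure below can be inferred. *)
Definition freq_law of measurable_fun [set: measurableTypeR R] g &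
    (forall w, 0 <= g w) & ('N[lebesgue_measure]_1 [EFin \o g] = 1)%E :
    set (measurableTypeR R) -> \bar R :=
  fun E => (\int[lebesgue_measure]_(w in E) (g w)%:E)%E.

Local Notation law := (freq_law mg g_ge0 g_norm1).

Let law0 : law set0 = 0%E.
Proof. by rewrite /freq_law integral_set0. Qed.

Let law_ge0 E : (0 <= law E)%E.
Proof. by apply: integral_ge0 => w _; rewrite lee_fin. Qed.

Let law_sigma_additive : semi_sigma_additive law.
Proof.
apply: semi_sigma_additive_nng_induced => //.
exact/measurable_realfun.measurable_EFinP.
Qed.

HB.instance Definition _ :=
  isMeasure.Build _ _ _ law law0 law_ge0 law_sigma_additive.

Let law_setT : law [set: _] = 1%E.
Proof.
rewrite -[RHS]g_norm1 Lnorm1; apply: eq_integral => w _ /=.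
by rewrite ger0_norm.
Qed.

HB.instance Definition _ := Measure_isProbability.Build _ _ _ law law_setT.

End frequency_law.

Section torus_spaces.
Context {R : realType}.
Implicit Types (L : R) (f : R -> R).

Definition smooth_on_torus L f :=
  periodic f L /\ forall n x, derivable (derive1n n f) x 1.

Definition weak_derivative L f f' :=
  forall phi, smooth_on_torus L phi ->
    \int[torus L]_x (f x * derive1 phi x) = - \int[torus L]_x (f' x * phi x).

(* f lies in W^{k,p}(U), and F 0 = f, F 1, ..., F k are (representatives of)
   its weak derivatives. *)
Definition sobolev_derivs L (k : nat) (p : \bar R) f (F : nat -> R -> R) :=
  [/\ F 0%N = f,
      forall i, (i <= k)%N -> periodic (F i) L /\ F i \in Lfun (torus L) p &
      forall i, (i < k)%N -> weak_derivative L (F i) (F i.+1)].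

Definition in_sobolev L k p f := exists F, sobolev_derivs L k p f F.

Definition prob_density L f :=
  [/\ periodic f L, f \in Lfun (torus L) 1%E,
      \forall x \ae torus L, 0 <= f x & \int[torus L]_x f x = 1].

(* f is in C^k(U), with the norm |f|_oo + ... + |f^(k)|_oo. *)
Definition in_Ck L (k : nat) f :=
  [/\ periodic f L,
      forall i, (i < k)%N -> forall x, derivable (derive1n i f) x 1 &
      continuous (derive1n k f)].

Definition Ck_norm (k : nat) f : \bar R :=
  (\sum_(i < k.+1) ereal_sup (range (fun x => `|derive1n i f x|%:E)))%E.

(* u is in C^1(0, oo; C^2(U)), the time derivative being taken in the norm
   of C^2(U). *)
Definition C1_C2 L (u : R -> R -> R) :=
  exists du : R -> R -> R, forall t, 0 < t ->
    [/\ in_Ck L 2 (u t), in_Ck L 2 (du t),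
        Ck_norm 2 (fun x => h^-1 * (u (t + h) x - u t x) - du t x)
          @[h --> 0^'] --> 0%E &
        Ck_norm 2 (fun x => du s x - du t x) @[s --> t] --> 0%E].

End torus_spaces.

Definition borel (T : ptopologicalType) := g_sigma_algebraType (@open T).

Section graphops.
Context {R : realType} {T : ptopologicalType}.
Variable mu : probability (borel T) R.
Implicit Type A : (borel T -> R) -> (borel T -> R).

Definition full_support := forall O : set T, open O -> O !=set0 -> (0 < mu O)%E.

(* A is a linear map from L^p to L^q. *)
Definition linear_Lp_Lq (p q : \bar R) A :=
  [/\ forall f, f \in Lfun mu p -> A f \in Lfun mu q,
      forall f g, f \in Lfun mu p -> g \in Lfun mu p ->
        f = g %[ae mu] -> A f = A g %[ae mu] &
      forall (a : R) f g, f \in Lfun mu p -> g \in Lfun mu p ->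
        A (fun x => a * f x + g x) = (fun x => a * A f x + A g x) %[ae mu]].

(* sup over L^oo \ {0} of |A v|_q / |v|_p. *)
Definition op_norm (p q : \bar R) A : \bar R :=
  ereal_sup [set ('N[mu]_q [EFin \o A v] / 'N[mu]_p [EFin \o v])%E |
             v in [set v | v \in Lfun mu +oo%E
                           /\ ('N[mu]_p [EFin \o v] != 0)%E]].

Definition P_operator A :=
  linear_Lp_Lq +oo%E 1%E A /\ (op_norm +oo%E 1%E A < +oo)%E.

Definition self_adjoint A :=
  forall f g, f \in Lfun mu +oo%E -> g \in Lfun mu +oo%E ->
    \int[mu]_x (g x * A f x) = \int[mu]_x (f x * A g x).

Definition positivity_preserving A :=
  forall f, f \in Lfun mu +oo%E -> (\forall x \ae mu, 0 <= f x) ->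
    \forall x \ae mu, 0 <= A f x.

Definition graphop A :=
  [/\ P_operator A, self_adjoint A & positivity_preserving A].

(* An element of B_{2,2} is identified with its unique bounded extension to
   L^2, i.e. A f denotes the value of that extension when f is in L^2. *)
Definition in_B22 A :=
  [/\ P_operator A, (op_norm 2%:E 2%:E A < +oo)%E, linear_Lp_Lq 2%:E 2%:E A &
      exists C : R, forall f, f \in Lfun mu 2%:E ->
        ('N[mu]_2%:E [EFin \o A f] <= C%:E * 'N[mu]_2%:E [EFin \o f])%E].

Definition numerical_radius A : \bar R :=
  ereal_sup [set (\int[mu]_x (A f x * f x))%:E |
             f in [set f | f \in Lfun mu 2%:E
                           /\ ('N[mu]_2%:E [EFin \o f] = 1)%E]].

End graphops.

Section equation.
Context {R : realType} {T : ptopologicalType}.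
Variables (L : R) (mu : probability (borel T) R)
  (nu : probability (measurableTypeR R) R).
Implicit Types (A : (borel T -> R) -> (borel T -> R))
  (r Ar : R -> borel T -> R -> R).

Definition jointly_measurable r :=
  measurable_fun [set: measurableTypeR R * (borel T * measurableTypeR R)]
    (fun z => r z.1 z.2.1 z.2.2).

(* Ar is a jointly measurable version of the function A r, where A acts on the
   variable xi only; A determines xi |-> (A r)(x, xi, w) up to null sets. *)
Definition acts_on_xi A r Ar :=
  jointly_measurable Ar /\
  {ae (torus L \x nu)%E, forall z, (fun xi => r z.1 xi z.2) \in Lfun mu 2%:E
     /\ (fun xi => Ar z.1 xi z.2) = A (fun xi => r z.1 xi z.2) %[ae mu]}.

(* V[A,g](r)(x, xi), with dD = D' and Ar = A r. *)
Definition interaction (dD : R -> R) Ar (x : R) (xi : borel T) : R :=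
  \int[nu]_w \int[torus L]_y (dD (x - y) * Ar y xi w).

Definition interaction_well_defined (dD : R -> R) Ar (xi : borel T) :=
  forall x, (torus L \x nu)%E.-integrable setT
    (fun z => (dD (x - z.1) * Ar z.1 xi z.2)%:E).

Definition solves_SK (kappa beta : R) (dD : R -> R)
    (rho Arho : R -> R -> borel T -> R -> R) (xi : borel T) (w : R) :=
  forall t, 0 < t -> interaction_well_defined dD (Arho t) xi /\
    forall x,
      derive1 (fun s => rho s x xi w) t =
      derive1 (fun y => - w * rho t y xi w
         + kappa * rho t y xi w * interaction dD (Arho t) y xi) x
      + beta^-1 * derive1n 2 (fun y => rho t y xi w) x.

Definition admissible_datum (rho0 : R -> borel T -> R -> R) :=
  [/\ jointly_measurable rho0,
      {ae (mu \x nu)%E, forall z,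
         in_sobolev L 4 2%:E (fun x => rho0 x z.1 z.2)
         /\ prob_density L (fun x => rho0 x z.1 z.2)} &
      forall x, (fun z => rho0 x z.1 z.2) \in Lfun (mu \x nu)%E +oo%E].

(* The datum is attained in C(U); the equation is required on t > 0. *)
Definition classical_solution (kappa beta : R) (dD : R -> R) A
    (rho0 : R -> borel T -> R -> R) (rho : R -> R -> borel T -> R -> R) :=
  (forall t, 0 <= t -> jointly_measurable (rho t)) /\
  exists Arho : R -> R -> borel T -> R -> R,
    (forall t, 0 < t -> acts_on_xi A (rho t) (Arho t)) /\
    {ae (mu \x nu)%E, forall z,
       [/\ C1_C2 L (fun t x => rho t x z.1 z.2),
           forall x, rho 0 x z.1 z.2 = rho0 x z.1 z.2,
           Ck_norm 0 (fun x => rho t x z.1 z.2 - rho 0 x z.1 z.2)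
             @[t --> 0^'+] --> 0%E &
           solves_SK kappa beta dD rho Arho z.1 z.2]}.

(* ln 0 = 0, hence 0 * ln 0 = 0. *)
Definition entropy (r : R -> borel T -> R -> R) : \bar R :=
  (\int[nu]_w \int[mu]_xi \int[torus L]_x
     (r x xi w * ln (r x xi w / L^-1))%:E)%E.

End equation.

Definition kappa_bound {R : realType} (L beta M n : R) : \bar R :=
  if L ^+ 2 * beta * M * n == 0 then +oo%E
  else (2 * pi ^+ 2 / (L ^+ 2 * beta * M * n))%:E.

(* Main.v *)
(* For fixed (xi, w) the relative entropy of the positive density
   p = (1 - eps) rho + eps / L decreases at rate at least
   a H - kappa |V'|_oo |p - 1/L|_1, with a = 4 pi^2 / (L^2 beta), by the
   logarithmic Sobolev inequality on the circle.  As D' has mean zero, V is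
   unchanged when A rho is replaced by A rho - A1 / L, so that
   |V'|_oo <= |D''|_oo F(xi) where F integrates |A (rho - 1/L)|.  Positivity and
   self-adjointness of A give int F f dmu <= int (A f) f dmu <= n(A) |f|_2^2 for
   f(xi) the L^1 distance of rho to 1/L, which Pinsker's inequality bounds by
   the entropy.  Integrating in (xi, w), the mean entropy has upper left Dini
   derivative at most -(a - 2 kappa |D''|_oo n(A) / (1 - eps)) times itself;
   one concludes by a Gronwall argument and eps -> 0. *)
Require Import Defs.
From HB Require Import structures.
From mathcomp Require Import all_boot all_order all_algebra.
From mathcomp Require Import all_classical all_reals all_analysis.
From mathcomp Require Import measurable_realfun ess_sup_inf.
From mathcomp Require Import ring lra.

Import Order.TTheory GRing.Theory Num.Theory.
Import numFieldNormedType.Exports.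

Local Open Scope classical_set_scope.
Local Open Scope ring_scope.

(* Lack of regularity shapes the argument. The density may vanish, so its logarithm is unbounded;
   mixing cures this, but the mixture [p] no longer solves the equation, as the drift carries only
   [p - eps / L]. The resulting term is still an exact derivative, that of
   [p - eps / L * ln (L * p)], whose deviation from its value at the uniform density never exceeds
   [|p - 1 / L|]; hence only a factor [1 / (1 - eps)] is lost.

   As [D''] is merely bounded, [V'] exists at every point but need not be continuous, so
   integrations by parts against [V] are done by mean value comparisons.

   The bounds on [A rho] hold at each time off a null set that depends on the time. A dominating
   function independent of time, a multiple of [|A 1|], is what allows difference quotients to be
   integrated.

   The constant [L^2 / (4 pi^2)] in the logarithmic Sobolev inequality is twice the optimal one.
   This slack permits an elementary proof from Wirtinger's inequality on two half circles and a few
   numerical bounds. *)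
#[local] Hint Extern 0 (measurable (torus_itv _)) => exact: measurable_torus_itv : core.

(** * Calculus on intervals *)

Section interval_calculus.
Set Implicit Arguments.
Unset Strict Implicit.
Context {R : realType}.
Implicit Types (f g F : R -> R) (a b c x : R).
Notation leb := (@lebesgue_measure R).

Lemma is_derive_continuous f x (d : R) : is_derive x 1 f d -> {for x, continuous f}.
Proof. by case=> df _; exact/differentiable_continuous/derivable1_diffP. Qed.

(** The mean value theorem applied to [G - F]. Being free of integrals, it also compares functions
    whose derivatives are only known pointwise. *)
Lemma derive_le_segment F (F' G' G : R -> R) a b : a <= b ->
  (forall x, a <= x <= b -> is_derive x 1 F (F' x)) ->
  (forall x, a <= x <= b -> is_derive x 1 G (G' x)) ->
  (forall x, a <= x <= b -> F' x <= G' x) ->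
  F b - F a <= G b - G a.
Proof.
move=> ab dF dG FG.
have dGF x : a <= x <= b -> is_derive x 1 (G - F) (G' x - F' x).
  by move=> xab; have := dF _ xab; have := dG _ xab => ? ?; exact: is_deriveB.
rewrite -subr_ge0; have [c cab ->] : exists2 c, c \in `[a, b] & G b - G a - (F b - F a) = (G' c - F' c) * (b - a).
  have -> : G b - G a - (F b - F a) = (G - F) b - (G - F) a.
    by rewrite !fctE; lra.
  apply: (@MVT_segment R (G - F) (fun x => G' x - F' x)) => //.
    by move=> x; rewrite in_itv/= => /andP[ax xb]; apply: dGF; rewrite (ltW ax) ltW.
  apply: derivable_within_continuous => x; rewrite in_itv/= => /dGF.
  by case.
by rewrite mulr_ge0 ?subr_ge0// FG; move: cab; rewrite in_itv.
Qed.

Lemma derive_ge0_segment F (F' : R -> R) a b : a <= b ->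
  (forall x, a <= x <= b -> is_derive x 1 F (F' x)) ->
  (forall x, a <= x <= b -> 0 <= F' x) -> F a <= F b.
Proof.
move=> ab dF F0; have := derive_le_segment ab (fun x _ => is_derive_cst 0 x 1) dF F0.
by rewrite subrr subr_ge0.
Qed.

Lemma derive_le0_segment F (F' : R -> R) a b : a <= b ->
  (forall x, a <= x <= b -> is_derive x 1 F (F' x)) ->
  (forall x, a <= x <= b -> F' x <= 0) -> F b <= F a.
Proof.
move=> ab dF F0; have := derive_le_segment ab dF (fun x _ => is_derive_cst 0 x 1) F0.
by rewrite subrr subr_le0.
Qed.

Lemma continuous_itv_integrable f a b : continuous f ->
  leb.-integrable `[a, b] (EFin \o f).
Proof.
move=> cf; apply: continuous_compact_integrable; first exact: segment_compact.
exact: continuous_subspaceT.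
Qed.

Lemma int_derive F f a b : a <= b ->
  (forall x, is_derive x 1 F (f x)) -> continuous f ->
  \int[leb]_(x in `[a, b]) f x = F b - F a.
Proof.
rewrite le_eqVlt => /predU1P[->|ab] dF cf.
  by rewrite set_itv1 Rintegral_set1 subrr.
rewrite /Rintegral (@continuous_FTC2 _ f F)//.
- exact: continuous_subspaceT.
- by split=> [x _||]; [case: (dF x)|
    apply: cvg_at_right_filter; exact: is_derive_continuous (dF _)|
    apply: cvg_at_left_filter; exact: is_derive_continuous (dF _)].
- by move=> x _; rewrite derive1E; case: (dF x).
Qed.

Lemma int_itv_split f a b c : a <= b -> b <= c -> continuous f ->
  \int[leb]_(x in `[a, c]) f x =
  \int[leb]_(x in `[a, b]) f x + \int[leb]_(x in `[b, c]) f x.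
Proof.
move=> ab bc cf; have fac := continuous_itv_integrable a c cf.
have := @Rintegral_itvB _ f (BLeft a) (BRight c) b fac.
rewrite !bnd_simp => /(_ ab bc) e.
rewrite -(@Rintegral_itv_obnd_cbnd _ b (BRight c)) -?e; first by rewrite addrC subrK.
by apply: integrableS fac => //; apply: subset_itv; rewrite !bnd_simp.
Qed.

Lemma FTC_continuous f a : continuous f ->
  forall x, a < x -> is_derive x 1 (fun y => \int[leb]_(t in `[a, y]) f t) (f x).
Proof.
move=> cf x ax; have [] := @continuous_FTC1_closed _ f a x (x + 1) _ _ ax (cf x).
- by rewrite ltrDl.
- exact: continuous_itv_integrable.
- by move=> dF F'x; apply: DeriveDef; [exact: dF|rewrite -derive1E; exact: F'x].
Qed.

(* Integrating from [a - 1] makes the derivative two-sided at [a]. *)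
Lemma antiderivative f a b : a <= b -> continuous f ->
  exists F, (forall x, a <= x <= b -> is_derive x 1 F (f x)) /\
    forall x, a <= x <= b -> F x - F a = \int[leb]_(t in `[a, x]) f t.
Proof.
move=> ab cf; exists (fun y => \int[leb]_(t in `[a - 1, y]) f t); split.
  by move=> x /andP[ax _]; apply: FTC_continuous => //; lra.
move=> x /andP[ax _]; rewrite (@int_itv_split f (a - 1) a x)//; last by lra.
by rewrite addrAC subrr add0r.
Qed.

Lemma periodicMz (f : R -> R) (L : R) : periodic f L ->
  forall (n : int) x, f (x + n%:~R * L) = f x.
Proof.
move=> fL; have H (n : nat) x : f (x + n%:R * L) = f x.
  elim: n x => [|n IH] x; first by rewrite mul0r addr0.
  by rewrite -natr1 mulrDl mul1r addrA fL.
case=> [n|n] x; first exact: H.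
by rewrite NegzE -{2}(subrK (n.+1%:R * L) x) H mulrNz mulNr.
Qed.

(** On [[a, b]] the functions [F (y + L)] and [F y] have the same derivative, so the integral over a
    period does not change when its starting point moves. *)
Lemma int_periodic_shift f L a b : 0 < L -> periodic f L -> continuous f ->
  \int[leb]_(x in `[a, a + L]) f x = \int[leb]_(x in `[b, b + L]) f x.
Proof.
move=> L0 fL cf.
wlog ab : a b / a <= b.
  by move=> H; have /orP[] := le_total a b => /H.
pose c := a - 1.
pose F y := \int[leb]_(t in `[c, y]) f t.
have dF x : c < x -> is_derive x 1 F (f x) by exact: FTC_continuous.
have FE x y : c <= x -> x <= y -> \int[leb]_(t in `[x, y]) f t = F y - F x.
  by move=> cx xy; rewrite /F (@int_itv_split f c x y)// addrAC subrr add0r.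
have ac : c < a by rewrite /c; lra.
rewrite !FE; [|lra..].
have dG x : a <= x <= b -> is_derive x 1 (fun y => F (y + L)) (f (x + L)).
  move=> /andP[ax xb]; have /dF d1 : c < x + L by lra.
  have d2 : is_derive x 1 (fun y => y + L) (1 + 0) by exact: is_deriveD.
  have := @is_derive1_comp _ F (fun y => y + L) x _ _ d1 d2.
  by rewrite addr0 mulr1.
have dF2 x : a <= x <= b -> is_derive x 1 F (f x).
  by move=> /andP[ax xb]; apply: dF; lra.
have h1 : F (b + L) - F (a + L) <= F b - F a.
  by apply: (derive_le_segment ab dG dF2) => x _; rewrite fL.
have h2 : F b - F a <= F (b + L) - F (a + L).
  by apply: (derive_le_segment ab dF2 dG) => x _; rewrite fL.
lra.
Qed.

End interval_calculus.

(** * Derivation rules for explicit functions *)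

Section derivation_rules.
Set Implicit Arguments.
Unset Strict Implicit.
Context {R : realType}.
Implicit Types (f g : R -> R) (x c : R).

Lemma dC c x : is_derive x 1 (fun _ : R => c) 0.
Proof. exact: is_derive_cst. Qed.
Lemma dI x : is_derive x 1 (fun y : R => y) 1.
Proof. exact: is_derive_id. Qed.
Lemma dD f g x df dg : is_derive x 1 f df -> is_derive x 1 g dg ->
  is_derive x 1 (fun y => f y + g y) (df + dg).
Proof. by move=> ? ?; exact: is_deriveD. Qed.
Lemma dN f x df : is_derive x 1 f df -> is_derive x 1 (fun y => - f y) (- df).
Proof. by move=> ?; exact: is_deriveN. Qed.
Lemma dM f g x df dg : is_derive x 1 f df -> is_derive x 1 g dg ->
  is_derive x 1 (fun y => f y * g y) (df * g x + f x * dg).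
Proof.
move=> hf hg; have h : is_derive x 1 (fun y => f y * g y) _ := is_deriveM hf hg.
by apply: is_derive_eq h _; rewrite /GRing.scale/= addrC mulrC.
Qed.
Lemma dX f x df n : is_derive x 1 f df ->
  is_derive x 1 (fun y => f y ^+ n.+1) (n.+1%:R * f x ^+ n * df).
Proof.
move=> hf; elim: n => [|n IH]; first by rewrite expr0 mulr1 mul1r.
rewrite (_ : (fun y => f y ^+ n.+2) = (fun y => f y * f y ^+ n.+1)); last first.
  by apply/funext => y; rewrite exprS.
apply: is_derive_eq (dM hf IH) _.
by rewrite -[n.+2]addn1 natrD !exprS; ring.
Qed.
Lemma dV f x df : f x != 0 -> is_derive x 1 f df ->
  is_derive x 1 (fun y => (f y)^-1) (- df / f x ^+ 2).
Proof.
move=> f0 hf; apply: is_derive_eq (is_deriveV f0 hf) _.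
by rewrite /GRing.scale/= mulrC mulrN mulNr.
Qed.
Lemma dcomp f g x df dg : is_derive (g x) 1 f df -> is_derive x 1 g dg ->
  is_derive x 1 (fun y => f (g y)) (df * dg).
Proof. by move=> hf hg; exact: (is_derive1_comp hf hg). Qed.
Lemma dexp g x dg : is_derive x 1 g dg ->
  is_derive x 1 (fun y => expR (g y)) (expR (g x) * dg).
Proof. by move=> h; exact: (dcomp (is_derive_expR _) h). Qed.
Lemma dln g x dg : 0 < g x -> is_derive x 1 g dg ->
  is_derive x 1 (fun y => ln (g y)) ((g x)^-1 * dg).
Proof. by move=> g0 h; exact: (dcomp (is_derive1_ln g0) h). Qed.
Lemma dsin g x dg : is_derive x 1 g dg ->
  is_derive x 1 (fun y => sin (g y)) (cos (g x) * dg).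
Proof. by move=> h; exact: (dcomp (is_derive_sin _) h). Qed.
Lemma dcos g x dg : is_derive x 1 g dg ->
  is_derive x 1 (fun y => cos (g y)) (- sin (g x) * dg).
Proof. by move=> h; exact: (dcomp (is_derive_cos _) h). Qed.
Lemma dsqrt g x dg : 0 < g x -> is_derive x 1 g dg ->
  is_derive x 1 (fun y => Num.sqrt (g y)) ((2 * Num.sqrt (g x))^-1 * dg).
Proof. by move=> g0 h; exact: (dcomp (is_derive1_sqrt g0) h). Qed.

Lemma is_derive_ext_val f x df df' : is_derive x 1 f df' -> df' = df ->
  is_derive x 1 f df.
Proof. by move=> ? <-. Qed.

End derivation_rules.

(** The rules are restated for explicit abstractions so that unification computes the derivative,
    hypotheses of the context being tried first. [der] leaves the equation between the computed and
    the announced derivative. *)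
Ltac der1 := first
  [ eassumption | eapply dC | eapply dI | eapply dD | eapply dN
  | eapply dexp | eapply dln | eapply dsin | eapply dcos | eapply dsqrt
  | eapply dX | eapply dV | eapply dM ].
Ltac der := simple notypeclasses refine (is_derive_ext_val _ _);
  [shelve | repeat der1 | rewrite /=].

(** * Elementary inequalities for the logarithm and numerical bounds *)

Section scalar_inequalities.
Set Implicit Arguments.
Unset Strict Implicit.
Context {R : realType}.
Implicit Types (x y u c r L : R).

Lemma ln_le_sub1 x : 0 < x -> ln x <= x - 1.
Proof. by move=> x0; have := @le_ln1Dx R (x - 1); rewrite (_ : 1 + (x - 1) = x); [apply; lra|ring]. Qed.

Lemma expR_ge_pow x n : 0 <= x -> (1 + x) ^+ n <= expR (n%:R * x).
Proof.
by move=> x0; rewrite expRM_natl; apply: lerXn2r; rewrite ?nnegrE ?expR_ge0 ?expR_ge1Dx// addr_ge0.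
Qed.

(** [ln y <= y - 1] at [y = 2 x / 5], together with [5 / 2 <= e]. The best slope is [1 / e]; the
    rational [2 / 5] just above it is matched to the bound on [pi ^+ 2] below, as
    [2 / 5 * 45 / 4 = 9 / 2] is what [log_sobolev] can afford. *)
Lemma ln_le_2fifth x : 0 < x -> ln x <= 2 / 5 * x.
Proof.
move=> x0; have e : x = (2 / 5 * x) * (5 / 2) by field.
rewrite {1}e lnM ?posrE; [|lra..].
have h1 : ln (2 / 5 * x) <= 2 / 5 * x - 1 by apply: ln_le_sub1; lra.
suff : ln (5 / 2) <= 1 :> R by lra.
rewrite -[X in _ <= X]expRK ler_ln ?posrE ?expR_gt0//.
have h6 : 0 <= 1 / 6 :> R by lra.
have := expR_ge_pow 6 h6.
rewrite (_ : 6%:R * (1 / 6) = 1); last by field.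
move=> h; apply: le_trans h; rewrite (exprM _ 3 2) expr2.
have : (1 + 1 / 6) ^+ 3 >= (1587 / 1000 : R) by rewrite !exprS expr0; lra.
by move: (_ ^+ 3) => q hq; nra.
Qed.

(** The end point [1 / 4] in [lsi_pointwise] asks for [ln 4 <= 1.48125], so [37 / 25] leaves little
    room. The sixteenth power comes from [(1 + x) ^+ 16 <= expR (16 x)]. *)
Lemma ln4_le : ln 4 <= 37 / 25 :> R.
Proof.
rewrite -[X in _ <= X]expRK ler_ln ?posrE ?expR_gt0//.
have h37 : 0 <= 37 / 400 :> R by lra.
have := expR_ge_pow 16 h37.
rewrite (_ : 16%:R * (37 / 400) = 37 / 25); last by field.
move=> h; apply: le_trans h.
have h2 : (437 / 400) ^+ 2 >= (119 / 100 : R) by rewrite expr2; lra.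
have h4 : (437 / 400) ^+ 4 >= (1416 / 1000 : R) by rewrite (exprM _ 2 2) expr2; nra.
have h8 : (437 / 400) ^+ 8 >= (2 : R) by rewrite (exprM _ 4 2) expr2; nra.
have -> : 1 + 37 / 400 = 437 / 400 :> R by field.
have -> : (437 / 400) ^+ 16 = (437 / 400) ^+ 8 * (437 / 400) ^+ 8 :> R by rewrite -exprD.
nra.
Qed.

Lemma from_zero_le (F G F' G' : R -> R) x : 0 <= x -> F 0 = G 0 ->
  (forall y, is_derive y 1 F (F' y)) -> (forall y, is_derive y 1 G (G' y)) ->
  (forall y, 0 <= y -> F' y <= G' y) -> F x <= G x.
Proof.
move=> x0 e dF dG FG.
have := @derive_le_segment _ F F' G' G 0 x x0 (fun y _ => dF y) (fun y _ => dG y).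
by rewrite e lerD2r; apply => y /andP[y0 _]; exact: FG.
Qed.

(** Starts from [sin y <= y] and compares derivatives from zero three more times. *)
Lemma cos_le_quartic x : 0 <= x -> cos x <= 1 - x ^+ 2 / 2 + x ^+ 4 / 24.
Proof.
have h1 y : 0 <= y -> sin y <= y.
  move=> y0; apply: (@from_zero_le sin id cos (fun=> 1)); rewrite ?sin0//.
have h2 y : 0 <= y -> 1 - y ^+ 2 / 2 <= cos y.
  move=> y0; apply: (@from_zero_le (fun y => 1 - y ^+ 2 / 2) cos (fun y => - y) (fun y => - sin y)).
  - by [].
  - by rewrite cos0 expr0n/= mul0r subr0.
  - by move=> z; der; field.
  - by move=> z z0; rewrite lerN2 h1.
have h3 y : 0 <= y -> y - y ^+ 3 / 6 <= sin y.
  move=> y0; apply: (@from_zero_le (fun y => y - y ^+ 3 / 6) sin (fun y => 1 - y ^+ 2 / 2) cos).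
  - by [].
  - by rewrite sin0 expr0n/= mul0r subr0.
  - by move=> z; der; field.
  - by move=> z z0; exact: h2.
move=> x0; apply: (@from_zero_le cos (fun x => 1 - x ^+ 2 / 2 + x ^+ 4 / 24) (fun y => - sin y) (fun y => - (y - y ^+ 3 / 6))).
- by [].
- by rewrite cos0 !expr0n/= !mul0r subr0 addr0.
- by move=> z; der; field.
- by move=> z z0; rewrite lerN2 h3.
Qed.

(** Cosine is positive on [[0, pi / 2[], while its quartic majorant is already negative at [1.67];
    hence [pi <= 3.34]. *)
Lemma pi_sq_le : pi ^+ 2 <= 45 / 4 :> R.
Proof.
suff : pi <= 334 / 100 :> R by have := @pi_ge0 R; nra.
rewrite leNgt; apply/negP => h.
have : 0 < cos (167 / 100) :> R by apply: cos_gt0_pihalf; have := @pi_ge0 R; lra.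
have h167 : 0 <= 167 / 100 :> R by lra.
have := cos_le_quartic h167.
lra.
Qed.

(* The difference of the two sides has derivative (u - 1)^3 / (u (u + 2))^2. *)
Lemma pinsker_pointwise u : 0 < u -> 3 * (u - 1) ^+ 2 <= (2 * u + 4) * (u * ln u - u + 1).
Proof.
move=> u0.
pose F x : R := ln x - (x - 1) * (5 * x + 1) / (2 * (x * (x + 2))).
pose F' x : R := (x - 1) ^+ 3 / (x * (x + 2)) ^+ 2.
have dF x : 0 < x -> is_derive x 1 F (F' x).
  move=> x0; have n1 : 2 * (x * (x + 2)) != 0 by rewrite gt_eqF// !mulr_gt0//; lra.
  rewrite /F; der.
  rewrite /F'; field; move: n1; rewrite !mulf_eq0 !negb_or => /and3P[_ -> ->].
  by [].
have F1 : F 1 = 0 by rewrite /F ln1 subrr !mul0r subr0.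
have [ku|uk] := leP 1 u.
  have h : F 1 <= F u.
    apply: (@derive_ge0_segment _ F F') => // x /andP[x1 _].
      by apply: dF; lra.
    by rewrite /F' divr_ge0 ?exprn_ge0// ?mulr_ge0//; lra.
  move: h; rewrite F1 /F.
  have u2 : 0 < 2 * (u * (u + 2)) by rewrite !mulr_gt0//; lra.
  rewrite subr_ge0 ler_pdivrMr//; nra.
have h : F 1 <= F u.
  apply: (@derive_le0_segment _ F F') => //; first exact: ltW.
    by move=> x /andP[x1 _]; apply: dF; lra.
  move=> x /andP[ux x1]; rewrite /F' mulr_le0_ge0 ?invr_ge0 ?exprn_ge0// ?mulr_ge0//; [|lra..].
  by rewrite exprS mulr_le0_ge0 ?exprn_even_ge0//; lra.
move: h; rewrite F1 /F.
have u2 : 0 < 2 * (u * (u + 2)) by rewrite !mulr_gt0//; lra.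
rewrite subr_ge0 ler_pdivrMr//; nra.
Qed.

(** After division by [y ^+ 2], with [u = 1 / y], the claim is [0 <= F u] for [1 / 4 <= u]. The
    derivative vanishes only at [5 / 13] and [1], so the minimum is at [1 / 4] or at [1], where
    [F 1 = 0]. The constant [18 / 5] has to stay below [4] to be absorbed by Wirtinger's inequality
    in [log_sobolev]. *)
Lemma lsi_pointwise y : 0 < y <= 4 ->
  y ^+ 2 * ln (y ^+ 2) - y ^+ 2 + 1 <= 18 / 5 * (y - 1) ^+ 2.
Proof.
move=> /andP[y0 y4]; rewrite lnXn//.
pose F x : R := 2 * ln x + 1 - x ^+ 2 + 18 / 5 * (1 - x) ^+ 2.
pose F' x : R := 2 * (1 - x) * (1 - 13 / 5 * x) / x.
have dF x : 0 < x -> is_derive x 1 F (F' x).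
  move=> x0; rewrite /F; der.
  by rewrite /F'; field; rewrite gt_eqF.
have F1 : F 1 = 0 by rewrite /F ln1; ring.
have F4 : 0 <= F (1 / 4).
  by rewrite /F lnM ?posrE// ln1 lnV ?posrE//; have := ln4_le; lra.
suff FF u : 1 / 4 <= u -> 0 <= F u.
  have /FF : 1 / 4 <= y^-1 by rewrite mul1r lef_pV2 ?posrE.
  rewrite /F lnV ?posrE// => h.
  have : 0 <= y ^+ 2 * (2 * - ln y + 1 - y^-1 ^+ 2 + 18 / 5 * (1 - y^-1) ^+ 2).
    by rewrite mulr_ge0// exprn_ge0// ltW.
  have -> : y ^+ 2 * (2 * - ln y + 1 - y^-1 ^+ 2 + 18 / 5 * (1 - y^-1) ^+ 2) =
      - (2 * y ^+ 2 * ln y) + y ^+ 2 - 1 + 18 / 5 * (y - 1) ^+ 2.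
    by field; rewrite gt_eqF.
  by rewrite -mulr_natl; lra.
move=> u4; have [u1|u1] := leP 1 u.
  rewrite -F1.
    apply: (@derive_ge0_segment _ F F') => // x /andP[x1 _].
      by apply: dF; lra.
    by rewrite /F' divr_ge0//; [nra|lra].
have [uk|ku] := leP (5 / 13) u.
  rewrite -F1.
    apply: (@derive_le0_segment _ F F') => //; first exact: ltW.
      by move=> x /andP[x1 _]; apply: dF; lra.
    move=> x /andP[ux x1]; rewrite /F' mulr_le0_ge0 ?invr_ge0//; [nra|lra].
apply: le_trans F4 _; apply: (@derive_ge0_segment _ F F') => // x /andP[x1 xu].
    by apply: dF; lra.
  by rewrite /F' divr_ge0//; [nra|lra].
Qed.

End scalar_inequalities.

(** * Integration over the circle *)

Section torus_calculus.
Set Implicit Arguments.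
Unset Strict Implicit.
Context {R : realType}.
Variable L : R.
Hypothesis L0 : 0 < L.
Implicit Types (f g F G : R -> R) (x : R).
Notation leb := (@lebesgue_measure R).
Local Notation I f := (\int[leb]_(x in torus_itv L) f x).

Let LL : - (L / 2) <= L / 2. Proof. by move: L0; lra. Qed.

Lemma cint_integrable f : continuous f -> leb.-integrable (torus_itv L) (EFin \o f).
Proof. exact: continuous_itv_integrable. Qed.

Lemma cintD f g : continuous f -> continuous g -> I (fun x => f x + g x) = I f + I g.
Proof. by move=> cf cg; rewrite RintegralD//; exact: cint_integrable. Qed.

Lemma cintB f g : continuous f -> continuous g -> I (fun x => f x - g x) = I f - I g.
Proof. by move=> cf cg; rewrite RintegralB//; exact: cint_integrable. Qed.

Lemma cintZ c f : continuous f -> I (fun x => c * f x) = c * I f.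
Proof. by move=> cf; rewrite RintegralZl//; exact: cint_integrable. Qed.

Lemma cint_cst (c : R) : I (fun=> c) = c * L.
Proof.
rewrite Rintegral_cst//; congr (_ * _).
rewrite -[RHS]/(fine L%:E); congr fine; apply: etrans (lebesgue_measure_itv _) _.
by rewrite /= lte_fin ifT -?EFinD; [congr EFin; lra|move: L0; lra].
Qed.

Lemma cint_le f g : continuous f -> continuous g -> (forall x, f x <= g x) -> I f <= I g.
Proof. by move=> cf cg fg; apply: le_Rintegral => //; exact: cint_integrable. Qed.

Lemma cint_ge0 f : (forall x, 0 <= f x) -> 0 <= I f.
Proof. by move=> f0; apply: Rintegral_ge0. Qed.

Lemma continuous_abs f : continuous f -> continuous (fun x => `|f x|).
Proof. by move=> cf x; apply: cvg_norm; exact: cf. Qed.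

Lemma cint_abs f : continuous f -> `|I f| <= I (fun x => `|f x|).
Proof. by move=> cf; apply: le_normr_Rintegral => //; exact: cint_integrable. Qed.

Lemma cint_abs_le f c : continuous f -> (forall x, `|f x| <= c) -> `|I f| <= c * L.
Proof.
move=> cf fc; apply: (le_trans (cint_abs cf)); rewrite -cint_cst.
by apply: cint_le => //; [exact: continuous_abs|exact: cst_continuous].
Qed.

Lemma cint_derive F f : periodic F L -> (forall x, is_derive x 1 F (f x)) ->
  continuous f -> I f = 0.
Proof.
move=> pF dF cf; rewrite /torus_itv (int_derive LL dF cf).
by rewrite -{1}(_ : - (L / 2) + L = L / 2) ?pF ?subrr//; lra.
Qed.

Lemma deriv_continuous F f : (forall x, is_derive x 1 F (f x)) -> continuous F.
Proof. by move=> dF x; exact: is_derive_continuous (dF x). Qed.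

Lemma cint_by_parts F f G g : periodic F L -> periodic G L ->
  (forall x, is_derive x 1 F (f x)) -> (forall x, is_derive x 1 G (g x)) ->
  continuous f -> continuous g ->
  I (fun x => F x * g x) = - I (fun x => f x * G x).
Proof.
move=> pF pG dF dG cf cg.
have cF := deriv_continuous dF; have cG := deriv_continuous dG.
have c1 : continuous (fun x => f x * G x) by move=> x; apply: cvgM; [exact: cf|exact: cG].
have c2 : continuous (fun x => F x * g x) by move=> x; apply: cvgM; [exact: cF|exact: cg].
apply/eqP; rewrite -addr_eq0 addrC -cintD//.
apply/eqP; apply: (@cint_derive (fun x => F x * G x) (fun x => f x * G x + F x * g x)).
- by move=> x /=; rewrite pF pG.
- by move=> x; exact: dM.
- by move=> x; apply: cvgD; [exact: c1|exact: c2].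
Qed.

(* The coefficient V is only assumed differentiable, so that V' need not be
   integrable: compare the antiderivative of phi' V with phi V. *)
Lemma cint_derive_mul_le (phi phi' V V' : R -> R) (lam : R) :
  periodic phi L -> periodic V L ->
  (forall x, is_derive x 1 phi (phi' x)) -> continuous phi' ->
  (forall x, is_derive x 1 V (V' x)) -> (forall x, `|V' x| <= lam) ->
  I (fun x => phi' x * V x) <= lam * I (fun x => `|phi x|).
Proof.
move=> pphi pV dphi cphi' dV V'lam.
have cphi := deriv_continuous dphi; have cV := deriv_continuous dV.
have c1 : continuous (fun x => phi' x * V x) by move=> x; apply: cvgM; [exact: cphi'|exact: cV].
have c2 : continuous (fun x => lam * `|phi x|).
  by move=> x; apply: cvgM; [exact: cvg_cst|apply: cvg_norm; exact: cphi].
have [F1 [dF1 F1E]] := antiderivative LL c1.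
have [F2 [dF2 F2E]] := antiderivative LL c2.
have h : (F1 (L / 2) - F1 (- (L / 2))) <= (F2 (L / 2) + phi (L / 2) * V (L / 2)) - (F2 (- (L / 2)) + phi (- (L / 2)) * V (- (L / 2))).
  apply: (@derive_le_segment _ F1 (fun x => phi' x * V x)
     (fun x => lam * `|phi x| + (phi' x * V x + phi x * V' x))
     (fun x => F2 x + phi x * V x)) => //.
    by move=> x xab; apply: dD; [exact: dF2|exact: dM].
  move=> x _; have := ler_norm (- (phi x * V' x)); rewrite normrN normrM.
  have := ler_wpM2l (normr_ge0 (phi x)) (V'lam x).
  by rewrite [_ * lam]mulrC; lra.
rewrite -cintZ//; last exact: continuous_abs.
rewrite /torus_itv -F1E ?lexx ?LL// -F2E ?lexx ?LL//.
have p1 : phi (L / 2) = phi (- (L / 2)) by rewrite -(pphi (- (L / 2))); congr phi; lra.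
have p2 : V (L / 2) = V (- (L / 2)) by rewrite -(pV (- (L / 2))); congr V; lra.
by move: h; rewrite p1 p2; lra.
Qed.

(** The primitive over the period centred at [x] is nondecreasing with equal end values, hence zero
    there; so [x] is a maximum and the derivative [f x] vanishes. *)
Lemma cint_eq0 f : periodic f L -> continuous f -> (forall x, 0 <= f x) -> I f = 0 ->
  forall x, f x = 0.
Proof.
move=> pf cf f0 If x; have L0' := L0.
pose a := x - L / 2; pose F y := \int[leb]_(t in `[a, y]) f t.
have ax : a < x by rewrite /a; lra.
have xb : x < a + L by rewrite /a; lra.
have FE y z : a <= y -> y <= z -> F z = F y + \int[leb]_(t in `[y, z]) f t.
  by move=> ay yz; rewrite /F (@int_itv_split _ f a y z).
have Fge y z : 0 <= \int[leb]_(t in `[y, z]) f t by apply: Rintegral_ge0.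
have FL : F (a + L) = 0.
  rewrite -If /F (int_periodic_shift a (- (L / 2)) L0 pf cf) /torus_itv.
  by have -> : - (L / 2) + L = L / 2 by lra.
have F0 y : a <= y -> y <= a + L -> F y = 0.
  move=> ay yb; apply/eqP; rewrite eq_le Fge andbT.
  by have := FE _ _ ay yb; rewrite FL => /eqP; rewrite eq_sym addr_eq0 => /eqP ->; rewrite oppr_le0.
have d1 := FTC_continuous cf ax.
have d2 : is_derive x 1 F 0.
  apply: (@derive1_at_max _ F a (a + L) x); [lra| |by rewrite in_itv/= ax xb|].
    by move=> t; rewrite in_itv/= => /andP[at_ _]; case: (FTC_continuous cf at_).
  move=> t; rewrite in_itv/= => /andP[at_ tb].
  by rewrite (F0 t (ltW at_) (ltW tb)) (F0 x (ltW ax) (ltW xb)).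
by case: d1 => _ <-; case: d2.
Qed.

End torus_calculus.

Section torus_measure_integral.
Set Implicit Arguments.
Unset Strict Implicit.
Context {R : realType}.
Variable L : R.
Notation leb := (@lebesgue_measure R).

Lemma torus_setC : torus L (~` torus_itv L) = 0%E.
Proof. by rewrite /torus /mfrestr /mrestr setICl measure0. Qed.

Lemma torus_integralE (f : measurableTypeR R -> \bar R) : measurable_fun setT f ->
  (\int[torus L]_x f x = \int[leb]_(x in torus_itv L) f x)%E.
Proof.
move=> mf; have mU : measurable (torus_itv L) by exact: measurable_torus_itv.
rewrite -(setUv (torus_itv L)) integral_setU//=.
- rewrite [X in (_ + X)%E](_ : _ = 0%E) ?adde0.
    apply: (eq_measure_integral leb) => A mA AU.
    by rewrite /= /torus /mfrestr /mrestr setIidl.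
  apply: null_set_integral; [exact: measurableC|exact: measurable_funTS|exact: torus_setC].
- exact: measurableC.
- by rewrite setUv.
- by apply/disj_setPCl.
Qed.

Lemma torus_RintegralE (f : measurableTypeR R -> R) : measurable_fun setT f ->
  \int[torus L]_x f x = \int[leb]_(x in torus_itv L) f x.
Proof. by move=> mf; rewrite /Rintegral torus_integralE//; exact/measurable_EFinP. Qed.

End torus_measure_integral.

(** * Pinsker and logarithmic Sobolev inequalities on the circle *)

Section continuity_rules.
Set Implicit Arguments.
Unset Strict Implicit.
Context {R : realType}.
Implicit Types (f g : R -> R) (c : R).

Lemma cC c : continuous (fun _ : R => c).
Proof. by move=> x; exact: cvg_cst. Qed.
Lemma cI : continuous (fun x : R => x).
Proof. by move=> x; exact: cvg_id. Qed.
Lemma cD f g : continuous f -> continuous g -> continuous (fun x => f x + g x).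
Proof. by move=> cf cg x; apply: cvgD; [exact: cf|exact: cg]. Qed.
Lemma cN f : continuous f -> continuous (fun x => - f x).
Proof. by move=> cf x; apply: cvgN; exact: cf. Qed.
Lemma cM f g : continuous f -> continuous g -> continuous (fun x => f x * g x).
Proof. by move=> cf cg x; apply: cvgM; [exact: cf|exact: cg]. Qed.
Lemma cX f n : continuous f -> continuous (fun x => f x ^+ n).
Proof.
move=> cf; elim: n => [|n IH]; first exact: cC.
rewrite (_ : (fun x => f x ^+ n.+1) = (fun x => f x * f x ^+ n)); first exact: cM.
by apply/funext => x; rewrite exprS.
Qed.
Lemma cV f : (forall x, f x != 0) -> continuous f -> continuous (fun x => (f x)^-1).
Proof. by move=> f0 cf x; apply: cvgV; [exact: f0|exact: cf]. Qed.
Lemma cln f : (forall x, 0 < f x) -> continuous f -> continuous (fun x => ln (f x)).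
Proof. by move=> f0 cf x; apply: (continuous_comp (cf x)); exact: continuous_ln. Qed.
Lemma cexp f : continuous f -> continuous (fun x => expR (f x)).
Proof. by move=> cf x; apply: (continuous_comp (cf x)); exact: continuous_expR. Qed.
Lemma csqrt f : continuous f -> continuous (fun x => Num.sqrt (f x)).
Proof. by move=> cf x; apply: (continuous_comp (cf x)); exact: sqrt_continuous. Qed.
Lemma ccomp f g : continuous f -> continuous g -> continuous (fun x => f (g x)).
Proof. by move=> cf cg x; apply: (continuous_comp (cg x)); exact: cf. Qed.
Lemma cabs f : continuous f -> continuous (fun x => `|f x|).
Proof. exact: continuous_abs. Qed.

End continuity_rules.

Ltac cts1 := match goal with
  | |- continuous ?F =>
    first [eassumption |
    match F with
    | (fun _ => ?c) => exact: cC
    | (fun x => x) => exact: cI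
    | (fun x => @?f x + @?g x) => refine (@cD _ f g _ _)
    | (fun x => - @?f x) => refine (@cN _ f _)
    | (fun x => `|@?f x|) => refine (@cabs _ f _)
    | (fun x => expR (@?f x)) => refine (@cexp _ f _)
    | (fun x => ln (@?f x)) => refine (@cln _ f _ _)
    | (fun x => Num.sqrt (@?f x)) => refine (@csqrt _ f _)
    | (fun x => @?f x ^+ ?n) => refine (@cX _ f n _)
    | (fun x => (@?f x)^-1) => refine (@cV _ f _ _)
    | (fun x => @?f x * @?g x) => refine (@cM _ f g _ _)
    end]
  end; cbv beta.
Ltac cts := repeat cts1.

Section relative_entropy_density.
Set Implicit Arguments.
Unset Strict Implicit.
Context {R : realType}.
Variable L : R.
Hypothesis L0 : 0 < L.
Implicit Types a b r : R.

(** The terms [- r + l^-1] integrate to zero for a probability density on the circle of length [l].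
    They make the entropy integrand nonnegative, so that Tonelli applies and integrals are
    monotone. *)
Definition Phi (l r : R) : R := r * ln (r / l^-1) - r + l^-1.

Lemma PhiE r : Phi L r = r * ln (L * r) - r + L^-1.
Proof. by rewrite /Phi invrK mulrC (mulrC r L) mulrC. Qed.

Lemma Phi_scale r : L * Phi L r = (L * r) * ln (L * r) - L * r + 1.
Proof.
rewrite PhiE; have L1 : L * L^-1 = 1 by rewrite divff ?gt_eqF.
by rewrite mulrDr L1; ring.
Qed.

(** The slope of [Phi] at [b] is [ln (L * b)]. The inequality is [ln y <= y - 1] at [y = b / a], and
    the end point [a = 0] is covered by [0 * ln 0 = 0]. *)
Lemma Phi_tangent a b : 0 <= a -> 0 < b -> Phi L b - Phi L a <= ln (L * b) * (b - a).
Proof.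
move=> a0 b0; rewrite !PhiE; have [->|a1] := eqVneq a 0; first by lra.
have {}a0 : 0 < a by rewrite lt_neqAle eq_sym a1.
have h := @ln_le_sub1 _ (b / a) (divr_gt0 b0 a0).
rewrite ln_div ?posrE// in h; rewrite !lnM ?posrE//.
have := ler_wpM2l (ltW a0) h.
have -> : a * (b / a - 1) = b - a by field; rewrite gt_eqF.
by lra.
Qed.

(** For positive [r] this is the tangent at the minimum [L^-1]. The sign of [r] is free because [ln]
    is zero on nonpositive arguments, which leaves [L^-1 - r]. *)
Lemma Phi_ge0 r : 0 <= Phi L r.
Proof.
rewrite PhiE; have iL : 0 < L^-1 by rewrite invr_gt0.
have [r0|r0] := leP r 0.
  by rewrite ln0; [lra|rewrite pmulr_rle0].
have := Phi_tangent (ltW r0) iL; rewrite !PhiE divff ?gt_eqF// ln1.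
by lra.
Qed.

End relative_entropy_density.

Section functional_inequalities.
Set Implicit Arguments.
Unset Strict Implicit.
Context {R : realType}.
Variable L : R.
Hypothesis L0 : 0 < L.
Implicit Types (p h k : R -> R) (x a b c v lam om : R).
Notation leb := (@lebesgue_measure R).
Local Notation I f := (\int[leb]_(x in torus_itv L) f x).

Lemma cint_le_on p h : continuous p -> continuous h ->
  (forall x, - (L / 2) <= x <= L / 2 -> p x <= h x) -> I p <= I h.
Proof.
by move=> cp ch ph; apply: le_Rintegral => //; exact: cint_integrable.
Qed.

Lemma continuous_Phi p : continuous p -> (forall x, 0 < p x) -> continuous (fun x => Phi L (p x)).
Proof.
move=> cp p0; rewrite /Phi; cts => x.
by rewrite divr_gt0// invr_gt0.
Qed.

(* The pointwise inequality is linearised by [2 s t <= lam s^2 + t^2 / lam]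
   with [lam] half the L^1 distance. *)
Lemma pinsker p : continuous p -> (forall x, 0 < p x) -> I p = 1 ->
  (I (fun x => `|p x - L^-1|)) ^+ 2 <= 2 * I (fun x => Phi L (p x)).
Proof.
move=> cp p0 p1.
have iL : L * L^-1 = 1 by rewrite divff ?gt_eqF.
have iL0 : 0 < L^-1 by rewrite invr_gt0.
have cPhi := continuous_Phi cp p0.
set N := (X in X ^+ 2); set E := (X in 2 * X).
have N0 : 0 <= N by apply: cint_ge0.
have [->|Nn0] := eqVneq N 0.
  by rewrite expr0n/= mulr_ge0//; apply: cint_ge0 => x; exact: Phi_ge0.
have Ngt0 : 0 < N by rewrite lt_neqAle eq_sym Nn0.
suff : N <= N / 2 * I (fun x => (2 * p x + 4 * L^-1) / 6) + N^-1 * E.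
  have cc : continuous (fun x => 2 * p x) by cts.
  have cc2 : continuous (fun _ : R => 4 * L^-1) by cts.
  (* A probability weight: [p] and [L^-1] both have mass one, and [2 + 4 = 6]. *)
  have -> : I (fun x => (2 * p x + 4 * L^-1) / 6) = 1.
    rewrite (_ : (fun x => (2 * p x + 4 * L^-1) / 6) = (fun x => 6^-1 * (2 * p x + 4 * L^-1))); last first.
      by apply/funext => x; rewrite mulrC.
    rewrite cintZ; last by cts.
    rewrite cintD// cintZ// p1 cint_cst//.
    by rewrite -mulrA (mulrC _ L) iL; field.
  move=> hN; have := ler_wpM2l N0 hN.
  have -> : N * (N / 2 * 1 + N^-1 * E) = N ^+ 2 / 2 + E by field.
  by rewrite -expr2; lra.
rewrite -cintZ; last by cts.
rewrite /E -cintZ// -cintD; [|by cts..].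
apply: cint_le; [by cts|by cts|] => x.
have u0 : 0 < L * p x by rewrite mulr_gt0.
have := pinsker_pointwise u0; rewrite -Phi_scale// => hP.
set P := Phi L (p x) in hP *.
have hP' : 3 * (p x - L^-1) ^+ 2 <= (2 * p x + 4 * L^-1) * P.
  have : 3 * (p x - L^-1) ^+ 2 * L ^+ 2 <= (2 * p x + 4 * L^-1) * P * L ^+ 2.
    have e1 : 3 * (p x - L^-1) ^+ 2 * L ^+ 2 = 3 * (L * p x - 1) ^+ 2.
      by rewrite -iL; ring.
    have e2 : (2 * p x + 4 * L^-1) * P * L ^+ 2 = (2 * (L * p x) + 4) * (L * P).
      have -> : (2 * (L * p x) + 4) = (2 * (L * p x) + 4 * (L * L^-1)) by rewrite iL mulr1.
      by ring.
    by rewrite e1 e2.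
  by rewrite ler_pM2r// exprn_gt0.
have P0 : 0 <= P by exact: Phi_ge0.
set q := 2 * p x + 4 * L^-1 in hP' *.
have q0 : 0 < q by rewrite /q addr_gt0// mulr_gt0.
rewrite -(ler_pXn2r (n := 2))// ?nnegrE//; last first.
  by rewrite addr_ge0// mulr_ge0// ?invr_ge0// ?divr_ge0// ltW.
rewrite real_normK ?num_real//.
have -> : (N / 2 * (q / 6) + N^-1 * P) ^+ 2 =
  (N * q / 12 - N^-1 * P) ^+ 2 + q * P / 3 by field.
by have := sqr_ge0 (N * q / 12 - N^-1 * P); lra.
Qed.

(* [om^2 k^2 <= k'^2 + (om k^2 tan (om (x - c)))'], a completed square. *)
Lemma dirichlet_wirtinger k (k' : R -> R) a b om : a < b -> 0 < om -> om * (b - a) < pi ->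
  k a = 0 -> k b = 0 -> (forall x, is_derive x 1 k (k' x)) -> continuous k' ->
  om ^+ 2 * \int[leb]_(x in `[a, b]) k x ^+ 2 <= \int[leb]_(x in `[a, b]) k' x ^+ 2.
Proof.
move=> ab om0 ompi ka kb dk ck'.
have ck : continuous k by move=> x; exact: is_derive_continuous (dk x).
have c1 : continuous (fun x => k x ^+ 2) by cts.
have c2 : continuous (fun x => k' x ^+ 2) by cts.
have [F1 [dF1 F1E]] := antiderivative (ltW ab) c1.
have [F2 [dF2 F2E]] := antiderivative (ltW ab) c2.
rewrite -F1E ?lexx ?(ltW ab)// -F2E ?lexx ?(ltW ab)//.
(* Centred at the midpoint, the argument of the tangent stays between [- pi / 2] and [pi / 2], since
   the interval is shorter than [pi / om]. *)
pose c := (a + b) / 2; pose t x := tan (om * (x - c)).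
have dt x : a <= x <= b -> is_derive x 1 t ((1 + t x ^+ 2) * om).
  move=> /andP[ax xb].
  have cn0 : cos (om * (x - c)) != 0.
    by rewrite gt_eqF// cos_gt0_pihalf// /c; apply/andP; split; nra.
  have d1 : is_derive (om * (x - c)) 1 tan (1 + t x ^+ 2).
    by rewrite /t -cos2_tan2//; exact: is_derive_tan.
  have d2 : is_derive x 1 (fun x => om * (x - c)) om by der; ring.
  exact: (@dcomp _ tan (fun x => om * (x - c)) x _ _ d1 d2).
have h : om ^+ 2 * F1 b - om ^+ 2 * F1 a <=
   (F2 b + om * (k b ^+ 2 * t b)) - (F2 a + om * (k a ^+ 2 * t a)).
  apply: (@derive_le_segment _ (fun x => om ^+ 2 * F1 x) (fun x => om ^+ 2 * k x ^+ 2)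
    (fun x => k' x ^+ 2 + om * (2 * k x * k' x * t x + k x ^+ 2 * ((1 + t x ^+ 2) * om)))
    (fun x => F2 x + om * (k x ^+ 2 * t x))).
  - exact: ltW.
  - move=> x /dF1 dF1x; by der; ring.
  - move=> x xab; have dF2x := dF2 _ xab; have dtx := dt _ xab; have dkx := dk x.
    by der; ring.
  - move=> x _; have := sqr_ge0 (k' x + om * k x * t x); nra.
move: h; rewrite ka kb expr0n/= !mul0r mulr0 !addr0 mulrBr; apply: le_trans.
by [].
Qed.

(** Integrates [(h' - lam) ^+ 2 >= 0] on the way up to [b] and [(h' + lam) ^+ 2 >= 0] on the way
    back to [v]; the slope [lam] is left to be optimised later. *)
Lemma arc_energy h (h' : R -> R) a b c v lam : a <= b -> b <= c -> h a = v -> h c = v ->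
  (forall x, is_derive x 1 h (h' x)) -> continuous h' ->
  4 * lam * (h b - v) - lam ^+ 2 * (c - a) <= \int[leb]_(x in `[a, c]) h' x ^+ 2.
Proof.
move=> ab bc ha hc dh ch'.
have c2 : continuous (fun x => h' x ^+ 2) by cts.
have ac := le_trans ab bc.
have [F [dF FE]] := antiderivative ac c2.
rewrite -FE ?lexx ?ac//.
have e1 : (2 * lam * h b - lam ^+ 2 * b) - (2 * lam * h a - lam ^+ 2 * a) <= F b - F a.
  apply: (@derive_le_segment _ (fun x => 2 * lam * h x - lam ^+ 2 * x)
    (fun x => 2 * lam * h' x - lam ^+ 2) (fun x => h' x ^+ 2) F) => //.
  - by move=> x _; have dhx := dh x; der; ring.
  - by move=> x /andP[ax xb]; apply: dF; rewrite ax (le_trans xb).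
  - by move=> x _; have := sqr_ge0 (h' x - lam); nra.
have e2 : (- (2 * lam * h c) - lam ^+ 2 * c) - (- (2 * lam * h b) - lam ^+ 2 * b) <= F c - F b.
  apply: (@derive_le_segment _ (fun x => - (2 * lam * h x) - lam ^+ 2 * x)
    (fun x => - (2 * lam * h' x) - lam ^+ 2) (fun x => h' x ^+ 2) F) => //.
  - by move=> x _; have dhx := dh x; der; ring.
  - by move=> x /andP[bx xc]; apply: dF; rewrite xc (le_trans ab).
  - by move=> x _; have := sqr_ge0 (h' x + lam); nra.
by move: e1 e2; rewrite ha hc; nra.
Qed.

(** The difference of the values at antipodal points changes sign after half a period. The circle is
    thus cut into two arcs of length [L / 2] on which [h - h a] vanishes at both ends, and whose
    Dirichlet frequency is [2 pi / L]. *)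
Lemma half_period_value h : periodic h L -> continuous h ->
  exists2 a, - (L / 2) <= a <= 0 & h (a + L / 2) = h a.
Proof.
move=> ph ch; pose d x := h (x + L / 2) - h x.
have cd : continuous d.
  have cs : continuous (fun x => h (x + L / 2)).
    by apply: (@ccomp _ h (fun x => x + L / 2)) => //; cts.
  by rewrite /d; cts.
have e : d (- (L / 2)) = - d 0.
  rewrite /d addNr add0r opprB; congr (_ - _).
  by rewrite -(ph (- (L / 2))); congr h; lra.
have l0 : - (L / 2) <= 0 by move: L0; lra.
have mM : Num.min (d (- (L / 2))) (d 0) <= 0 <= Num.max (d (- (L / 2))) (d 0).
  rewrite e ge_min le_max; have [h1|h1] := leP 0 (d 0).
    by apply/andP; split; apply/orP; [left|right]; lra.
  by apply/andP; split; apply/orP; [right|left]; lra.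
have [c] := @IVT R d (- (L / 2)) 0 0 l0 (continuous_subspaceT cd) mM.
rewrite in_itv/= => cab dc; exists c => //.
by apply/eqP; rewrite -subr_eq0 -[_ - _]/(d c) dc.
Qed.

(** With [h] the square root of [p] and [c] its common value at two antipodal points, there are two
    cases. If [h <= 4 c], the entropy is bounded by a multiple of the square norm of [h - c], which
    Wirtinger's inequality controls on both arcs. Otherwise the energy spent in climbing to the
    maximum [M] pays for the crude bound [ln (L * M ^+ 2)]. *)
Lemma log_sobolev p (p' : R -> R) : periodic p L -> (forall x, 0 < p x) ->
  (forall x, is_derive x 1 p (p' x)) -> continuous p' -> I p = 1 ->
  I (fun x => Phi L (p x)) <= L ^+ 2 / (4 * pi ^+ 2) * I (fun x => p' x ^+ 2 / p x).
Proof.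
move=> pp p0 dp cp' p1; have L0' := L0.
have iL : L * L^-1 = 1 by rewrite divff ?gt_eqF.
have cp := deriv_continuous dp.
pose h x := Num.sqrt (p x); pose h' x := (2 * h x)^-1 * p' x.
have h0 x : 0 < h x by rewrite sqrtr_gt0.
have dh x : is_derive x 1 h (h' x) by apply: dsqrt.
have ch : continuous h := deriv_continuous dh.
have h20 x : 2 * h x != 0 by rewrite gt_eqF// mulr_gt0.
have ch' : continuous h' by rewrite /h'; cts.
have ph : periodic h L by move=> x; rewrite /h pp.
have hsq x : h x ^+ 2 = p x by rewrite sqr_sqrtr// ltW.
have cPhi := continuous_Phi cp p0.
have ch2 : continuous (fun x => h' x ^+ 2) by cts.
have pn0 x : p x != 0 by rewrite gt_eqF.
have -> : I (fun x => p' x ^+ 2 / p x) = 4 * I (fun x => h' x ^+ 2).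
  rewrite -cintZ//; apply: eq_Rintegral => x _.
  by rewrite /h' -hsq; field; rewrite gt_eqF.
set s := I (fun x => h' x ^+ 2).
have s0 : 0 <= s by apply: cint_ge0 => x; exact: sqr_ge0.
have pi0 : 0 < pi :> R := pi_gt0 R.
have piQ : pi ^+ 2 <= 45 / 4 :> R := pi_sq_le.
have piQ0 : 0 < pi ^+ 2 :> R by rewrite exprn_gt0.
suff : I (fun x => Phi L (p x)) <= L ^+ 2 * s / pi ^+ 2.
  move=> H; apply: le_trans H _; rewrite le_eqVlt; apply/orP; left; apply/eqP.
  have gen P : P != 0 -> L ^+ 2 * s / P = L ^+ 2 / (4 * P) * (4 * s) by move=> P0; field.
  by apply: gen; rewrite gt_eqF.
have [a /andP[aL a0] ha] := half_period_value ph ch.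
set c := h a in ha; have c0 : 0 < c := h0 a.
have haL : h (a + L) = c by rewrite ph.
have ab : a <= a + L / 2 by lra.
have bc : a + L / 2 <= a + L by lra.
have split2 f : periodic f L -> continuous f ->
    I f = \int[leb]_(x in `[a, a + L / 2]) f x + \int[leb]_(x in `[a + L / 2, a + L]) f x.
  move=> pf cf; rewrite -int_itv_split// (int_periodic_shift a (- (L / 2)) L0 pf cf).
  by rewrite /torus_itv; have -> : - (L / 2) + L = L / 2 by lra.
have ph'2 : periodic (fun x => h' x ^+ 2) L.
  move=> x /=; rewrite /h' ph; congr ((_ * _) ^+ 2).
  have d1 := dp x.
  have d2 : is_derive x 1 p (p' (x + L)).
    have d3 : is_derive x 1 (fun y => y + L) 1 by der; ring.
    have := @dcomp _ p (fun y => y + L) x _ _ (dp (x + L)) d3.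
    by rewrite mulr1 (_ : (fun y => p (y + L)) = p)//; apply/funext => y; exact: pp.
  by case: d1 => _ <-; case: d2 => _ <-.
have LL : - (L / 2) <= L / 2 by lra.
have [b0 b0U hmax] := EVT_max LL (continuous_subspaceT ch).
have {}hmax x : - (L / 2) <= x <= L / 2 -> h x <= h b0.
  by move=> xU; apply: hmax; rewrite in_itv.
have [small|large] := leP (h b0) (4 * c).
  pose k x := h x - c.
  have dk x : is_derive x 1 k (h' x) by have dhx := dh x; rewrite /k; der; ring.
  have ck : continuous k := deriv_continuous dk.
  have ck2 : continuous (fun x => k x ^+ 2) by cts.
  have ka : k a = 0 by rewrite /k subrr.
  have kb : k (a + L / 2) = 0 by rewrite /k ha subrr.
  have kc : k (a + L) = 0 by rewrite /k haL subrr.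
  (* Strictly below the critical frequency [2 pi / L], as the tangent must stay finite on the arcs;
     [4 * (19 / 20) ^+ 2 = 361 / 100] still exceeds [18 / 5]. *)
  pose om : R := 19 / 20 * pi * 2 / L.
  have om0 : 0 < om by rewrite /om divr_gt0//; lra.
  have omL : om * (L / 2) < pi.
    by rewrite /om (_ : _ / L * (L / 2) = 19 / 20 * pi); [lra|field; rewrite gt_eqF].
  have om1 : om * (a + L / 2 - a) < pi by rewrite (_ : a + L / 2 - a = L / 2)//; lra.
  have om2 : om * (a + L - (a + L / 2)) < pi.
    by rewrite (_ : a + L - (a + L / 2) = L / 2)//; lra.
  have l1 : a < a + L / 2 by lra.
  have l2 : a + L / 2 < a + L by lra.
  have w1 := dirichlet_wirtinger l1 om0 om1 ka kb dk ch'.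
  have w2 := dirichlet_wirtinger l2 om0 om2 kb kc dk ch'.
  have W : om ^+ 2 * I (fun x => k x ^+ 2) <= s.
    rewrite /s !split2//; last by move=> x /=; rewrite /k ph.
    by rewrite mulrDr lerD.
  have c20 : 0 < c ^+ 2 by rewrite exprn_gt0.
  (* [lsi_pointwise] at [y = h x / c], multiplied by [c ^+ 2]. The remainder integrates to
     [ln (L * c ^+ 2) + 1 - L * c ^+ 2], which is at most zero. *)
  have key : I (fun x => Phi L (p x)) <= I (fun x => 18 / 5 * k x ^+ 2 + (ln (L * c ^+ 2) * p x + (L^-1 - c ^+ 2))).
    apply: cint_le_on => //; first by cts.
    move=> x xU.
    have yb : 0 < h x / c <= 4.
      by rewrite divr_gt0// ler_pdivrMr//=; apply: le_trans small; exact: hmax.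
    have lp := lsi_pointwise yb.
    have e1 : (h x / c) ^+ 2 = p x / c ^+ 2 by rewrite expr_div_n hsq.
    have e2 : ln (p x / c ^+ 2) = ln (p x) - ln (c ^+ 2) by rewrite ln_div ?posrE.
    rewrite e1 e2 in lp; have := ler_wpM2l (ltW c20) lp.
    have -> : c ^+ 2 * (p x / c ^+ 2 * (ln (p x) - ln (c ^+ 2)) - p x / c ^+ 2 + 1) =
       p x * (ln (p x) - ln (c ^+ 2)) - p x + c ^+ 2 by field; rewrite gt_eqF.
    have -> : c ^+ 2 * (18 / 5 * (h x / c - 1) ^+ 2) = 18 / 5 * k x ^+ 2.
      by rewrite /k; field; rewrite gt_eqF.
    rewrite PhiE !lnM ?posrE//; clear; lra.
  have cr : continuous (fun x => ln (L * c ^+ 2) * p x + (L^-1 - c ^+ 2)) by cts.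
  have cr1 : continuous (fun x => ln (L * c ^+ 2) * p x) by cts.
  have cr2 : continuous (fun _ : R => L^-1 - c ^+ 2) by cts.
  have ck3 : continuous (fun x => 18 / 5 * k x ^+ 2) by cts.
  apply: le_trans key _; rewrite cintD// cintD// !cintZ// p1 cint_cst//.
  have lnle : ln (L * c ^+ 2) <= L * c ^+ 2 - 1 by apply: ln_le_sub1; rewrite mulr_gt0.
  apply: (@le_trans _ _ (18 / 5 * I (fun x => k x ^+ 2))).
    by rewrite mulrBl [_^-1 * L]mulrC iL; move: lnle; clear; lra.
  rewrite ler_pdivlMr//.
  have -> : 18 / 5 * I (fun x => k x ^+ 2) * pi ^+ 2 = 360 / 361 * L ^+ 2 * (om ^+ 2 * I (fun x => k x ^+ 2)).
    by rewrite /om; field; rewrite gt_eqF.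
  have L20 : 0 <= L ^+ 2 by exact: sqr_ge0.
  have := ler_wpM2l L20 W; have : 0 <= L ^+ 2 * s by rewrite mulr_ge0.
  by rewrite -mulrA; clear; lra.
set M := h b0 in large hmax.
have M0 : 0 < M := h0 b0.
have [b bU hb] : exists2 b, a <= b <= a + L & h b = M.
  move: b0U; rewrite in_itv/= => /andP[b1 b2].
  have [ab0|b0a] := leP a b0; first by exists b0 => //; lra.
  by exists (b0 + L); [lra|rewrite ph].
have sE : s = \int[leb]_(x in `[a, a + L / 2]) h' x ^+ 2 + \int[leb]_(x in `[a + L / 2, a + L]) h' x ^+ 2.
  by rewrite /s split2.
have g0 u v : 0 <= \int[leb]_(x in `[u, v]) h' x ^+ 2.
  by apply: Rintegral_ge0 => x _; exact: sqr_ge0.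
(* The maximiser of [4 * lam * (M - c) - lam ^+ 2 * (L / 2)]. *)
pose lam := 4 * (M - c) / L.
have energy : 4 * lam * (M - c) - lam ^+ 2 * (L / 2) <= s.
  move: bU => /andP[ab' bL]; rewrite sE.
  have [h1|h1] := leP b (a + L / 2).
    have := @arc_energy h h' a b (a + L / 2) c lam ab' h1 erefl ha dh ch'.
    rewrite hb (_ : a + L / 2 - a = L / 2); last by ring.
    by move=> H; apply: (le_trans H); rewrite lerDl g0.
  have := @arc_energy h h' (a + L / 2) b (a + L) c lam (ltW h1) bL ha haL dh ch'.
  rewrite hb (_ : a + L - (a + L / 2) = L / 2); last by field.
  by move=> H; apply: (le_trans H); rewrite lerDr g0.
(* Here [M > 4 c] gives [M - c >= 3 / 4 * M], and [8 * 9 / 16 = 9 / 2]. *)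
have energy2 : 9 / 2 * M ^+ 2 <= L * s.
  apply: (@le_trans _ _ (8 * (M - c) ^+ 2)); first by nra.
  have := ler_wpM2l (ltW L0) energy.
  have e8 : L * (4 * lam * (M - c) - lam ^+ 2 * (L / 2)) = 8 * (M - c) ^+ 2.
    by rewrite /lam; field; rewrite gt_eqF.
  by rewrite e8.
have LM0 : 0 < L * M ^+ 2 by rewrite mulr_gt0// exprn_gt0.
have cr1 : continuous (fun x => ln (L * M ^+ 2) * p x) by cts.
have cr2 : continuous (fun x => L^-1 - p x) by cts.
have cr3 : continuous (fun _ : R => L^-1) by cts.
have key : I (fun x => Phi L (p x)) <= I (fun x => ln (L * M ^+ 2) * p x + (L^-1 - p x)).
  apply: cint_le_on => //; first by cts.
  move=> x xU; rewrite PhiE.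
  have : ln (L * p x) <= ln (L * M ^+ 2).
    rewrite ler_ln ?posrE// ?mulr_gt0// ler_pM2l// -hsq.
    by apply: lerXn2r; [exact: ltW|exact: ltW|exact: hmax].
  by move=> /(ler_wpM2l (ltW (p0 x))); clear; lra.
apply: le_trans key _; rewrite cintD// cintZ// cintB// p1 cint_cst// [_^-1 * L]mulrC iL subrr addr0 mulr1.
apply: (le_trans (ln_le_2fifth LM0)).
rewrite ler_pdivlMr//.
have := ler_wpM2l (ltW L0) energy2.
have := ler_wpM2l (ltW LM0) piQ.
rewrite expr2 (expr2 L); clear; lra.
Qed.

End functional_inequalities.

(** * Monotonicity from left Dini derivatives *)

Section left_dini.
Set Implicit Arguments.
Unset Strict Implicit.
Context {R : realType}.
Implicit Types (g : R -> R) (s t e d h r T : R).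

Lemma le_addgt0 (x y C : R) : (forall e, 0 < e -> x <= y + e * C) -> x <= y.
Proof.
move=> H; rewrite leNgt; apply/negP => yx.
have C1 : 0 < `|C| + 1 by rewrite ltr_wpDl.
have e0 : 0 < (x - y) / 2 / (`|C| + 1) by rewrite !divr_gt0// subr_gt0.
have := H _ e0.
have : (x - y) / 2 / (`|C| + 1) * C <= (x - y) / 2 / (`|C| + 1) * (`|C| + 1).
  by apply: ler_wpM2l; [exact: ltW|have := ler_norm C; lra].
by rewrite mulfVK ?gt_eqF//; lra.
Qed.

(* A function with nonpositive upper left Dini derivative and no upward jump
   from the right is nonincreasing: consider the infimum of the
   [s] with [g T - g s <= eta (T - s)]. *)
Lemma left_dini_le0 g T : 0 <= T ->
  (forall s, 0 <= s -> forall e, 0 < e -> exists2 d, 0 < d &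
     forall r, s < r < s + d -> g r <= g s + e) ->
  (forall t, 0 < t -> forall e, 0 < e -> exists2 d, 0 < d &
     forall h, 0 < h < d -> h < t -> g t - g (t - h) <= e * h) ->
  g T <= g 0.
Proof.
move=> T0 usc dini.
apply: (@le_addgt0 _ _ T) => eta eta0; rewrite addrC -lerBlDr.
pose S := [set s | 0 <= s <= T /\ g T - g s <= eta * (T - s)].
have ST : S T by split; [rewrite T0 lexx|rewrite !subrr mulr0].
have lbS : lbound S 0 by move=> s [/andP[]].
have hiS : has_inf S by split; [exists T|exists 0].
pose m := inf S.
have m0 : 0 <= m by apply: lb_le_inf => //; exists T.
have mT : m <= T by apply: ge_inf => //; exists 0.
(* The infimum is attained: a positive gap at [m] would persist at points of [S] slightly to its
   right, where [g] has not jumped up. *)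
have Sm : S m.
  split; first by rewrite m0.
  rewrite leNgt; apply/negP => gap.
  pose e := (g T - g m - eta * (T - m)) / 2.
  have e0 : 0 < e by rewrite /e; lra.
  have [d d0 hd] := usc _ m0 _ e0.
  have [s Ss sm] := inf_adherent d0 hiS; rewrite -/m in sm.
  have ms : m <= s by apply: ge_inf => //; exists 0.
  have [_ gs] := Ss.
  have [ms1|sm1] := ltP m s.
    have := hd s; rewrite ms1 sm => /(_ isT) gsm.
    have : eta * (T - s) <= eta * (T - m) by apply: ler_wpM2l; [exact: ltW|lra].
    by move: gsm gs; rewrite /e; lra.
  have sE : s = m by apply/eqP; rewrite eq_le sm1 ms.
  by move: gs; rewrite sE; lra.
have [m1|m1] := ltP 0 m; last first.
  have mE : m = 0 by apply/eqP; rewrite eq_le m1 m0.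
  by case: Sm => _; rewrite mE subr0.
have [d d0 hd] := dini _ m1 _ eta0.
(* A left step short enough for the Dini bound and for staying nonnegative leads to an element of
   [S] below [m]. *)
pose h := Num.min d m / 2.
have mn0 : 0 < Num.min d m by rewrite lt_min d0.
have hd1 : h < d.
  have : Num.min d m <= d by rewrite ge_min lexx.
  by rewrite /h; lra.
have hm : h < m.
  have : Num.min d m <= m by rewrite ge_min lexx orbT.
  by rewrite /h; lra.
have h0 : 0 < h by rewrite /h; lra.
have := hd h; rewrite h0 hd1 => /(_ isT hm) gm.
have : m <= m - h.
  apply: ge_inf; first by exists 0.
  case: Sm => _ gTm; split; first by lra.
  have -> : eta * (T - (m - h)) = eta * (T - m) + eta * h by ring.
  by lra.
by lra.
Qed.

End left_dini.

Section periodic_bounded.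
Set Implicit Arguments.
Unset Strict Implicit.
Context {R : realType}.
Variable L : R.
Hypothesis L0 : 0 < L.

Lemma periodic_rep (x : R) : exists2 n : int, - (L / 2) <= x + n%:~R * L & x + n%:~R * L < L / 2.
Proof.
have L0' := L0.
pose q := (x + L / 2) / L.
have xE : x = q * L - L / 2 by rewrite /q mulfVK ?gt_eqF// addrK.
have /andP[f1 f2] := floor_itv q; exists (- Num.floor q).
  rewrite mulrNz mulNr xE.
  have := ler_wpM2r (ltW L0) f1; lra.
rewrite mulrNz mulNr xE.
have : q * L < (Num.floor q + 1)%:~R * L by rewrite ltr_pM2r.
by rewrite intrD mulrDl mul1r; lra.
Qed.

Lemma periodic_forall (f : R -> R) (P : R -> Prop) : periodic f L ->
  (forall x, - (L / 2) <= x <= L / 2 -> P (f x)) -> forall x, P (f x).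
Proof.
move=> pf H x; have [n n1 n2] := periodic_rep x.
by rewrite -(periodicMz pf n x); apply: H; rewrite n1 ltW.
Qed.

Lemma periodic_bounded (f : R -> R) : periodic f L -> continuous f ->
  exists2 C, 0 <= C & forall x, `|f x| <= C.
Proof.
move=> pf cf; have L0' := L0.
have LL : - (L / 2) <= L / 2 by lra.
have ca : continuous (fun x => `|f x|) by cts.
have [c _ hc] := EVT_max LL (continuous_subspaceT ca).
exists `|f c| => // x.
apply: (periodic_forall (P := fun y => `|y| <= `|f c|) pf) => y yU.
by apply: hc; rewrite in_itv.
Qed.

End periodic_bounded.

(** * Entropy dissipation for fixed (xi, w) *)

Section flow.
Set Implicit Arguments.
Unset Strict Implicit.
Context {R : realType}.
Variables (L beta kappa w : R).
Hypotheses (L0 : 0 < L) (beta0 : 0 < beta) (kappa0 : 0 < kappa).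
Variables (u du ux uxx V V' : R -> R -> R) (lam : R -> R).
Implicit Types (t x y e h s d r a b : R).
Notation leb := (@lebesgue_measure R).
Local Notation I f := (\int[leb]_(x in torus_itv L) f x).

(* [u], [V] stand for rho and its interaction at fixed (xi, w); time derivatives
   and the initial limit are uniform in x, and V' need not be continuous. *)
Record flow : Prop := Flow {
  flow_per : forall t, 0 < t -> periodic (u t) L;
  flow_dx : forall t, 0 < t -> forall x, is_derive x 1 (u t) (ux t x);
  flow_dxx : forall t, 0 < t -> forall x, is_derive x 1 (ux t) (uxx t x);
  flow_cxx : forall t, 0 < t -> continuous (uxx t);
  flow_cdu : forall t, 0 < t -> continuous (du t);
  flow_dt : forall t, 0 < t -> forall e, 0 < e -> exists2 d, 0 < d &
    forall h, h != 0 -> `|h| < d -> forall x, `|u (t + h) x - u t x - h * du t x| <= e * `|h|;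
  flow_ct : forall t, 0 < t -> forall e, 0 < e -> exists2 d, 0 < d &
    forall s, `|s - t| < d -> forall x, `|du s x - du t x| <= e;
  flow_0 : forall e, 0 < e -> exists2 d, 0 < d &
    forall t, 0 < t < d -> forall x, `|u t x - u 0 x| <= e;
  flow_per0 : periodic (u 0) L;
  flow_mass0 : I (u 0) = 1;
  flow_neg0 : I (fun x => `|u 0 x| - u 0 x) = 0;
  flow_perV : forall t, 0 < t -> periodic (V t) L;
  flow_dV : forall t, 0 < t -> forall x, is_derive x 1 (V t) (V' t x);
  flow_lam : forall t, 0 < t -> forall x, `|V' t x| <= lam t;
  flow_eq : forall t, 0 < t -> forall x, du t x =
    derive1 (fun y => - w * u t y + kappa * u t y * V t y) x + beta^-1 * uxx t x }.

Hypothesis F : flow.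

Let J t y := - w * u t y + kappa * u t y * V t y.
Let Jx t x := du t x - beta^-1 * uxx t x.

(** Differentiability comes from the product rule, the value from the equation: written as
    [du t x - beta^-1 * uxx t x], the derivative of the flux is continuous even if [V'] is not. *)
Lemma flow_dJ t : 0 < t -> forall x, is_derive x 1 (J t) (Jx t x).
Proof.
move=> t0 x; rewrite /Jx (flow_eq F t0) addrK.
have d1 := flow_dx F t0 x; have d2 := flow_dV F t0 x.
have [dJ _] : is_derive x 1 (J t) (- w * ux t x + (kappa * ux t x * V t x + kappa * u t x * V' t x)).
  by rewrite /J; der; ring.
by apply: DeriveDef; [exact: dJ|rewrite derive1E].
Qed.

Lemma flow_perJ t : 0 < t -> periodic (J t) L.
Proof. by move=> t0 x; rewrite /J (flow_per F t0) (flow_perV F t0). Qed.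

Lemma flow_perx t : 0 < t -> periodic (ux t) L.
Proof.
move=> t0 x; have d1 := flow_dx F t0 x.
have d3 : is_derive x 1 (fun y => y + L) 1 by der; ring.
have := @dcomp _ (u t) (fun y => y + L) x _ _ (flow_dx F t0 (x + L)) d3.
rewrite mulr1 (_ : (fun y => u t (y + L)) = u t); last first.
  by apply/funext => y; exact: flow_per.
by move=> [_ <-]; case: d1.
Qed.

Lemma flow_cx t : 0 < t -> continuous (ux t).
Proof. by move=> t0; exact: deriv_continuous (flow_dxx F t0). Qed.

(** At time zero only the uniform convergence as time decreases to zero is available; a uniform
    limit of continuous functions is continuous. *)
Lemma flow_cu t : 0 <= t -> continuous (u t).
Proof.
rewrite le_eqVlt => /predU1P[<-|t0]; last exact: deriv_continuous (flow_dx F t0).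
move=> x; apply/cvgrPdist_le => e e0.
have e3 : 0 < e / 3 by rewrite divr_gt0.
have [d d0 hd] := flow_0 F e3.
have d20 : 0 < d / 2 by rewrite divr_gt0.
have h2 z : `|u (d / 2) z - u 0 z| <= e / 3 by apply: hd; lra.
have cx := @deriv_continuous _ _ _ (flow_dx F d20) x.
move/cvgrPdist_le : cx => /(_ _ e3); apply: filterS => y hy.
have -> : u 0 x - u 0 y = (u (d / 2) x - u (d / 2) y) + (u (d / 2) y - u 0 y) - (u (d / 2) x - u 0 x) by ring.
apply: (le_trans (ler_normB _ _)); have := ler_normD (u (d / 2) x - u (d / 2) y) (u (d / 2) y - u 0 y).
by have := h2 x; have := h2 y; lra.
Qed.

Lemma flow_perge0 t : 0 <= t -> periodic (u t) L.
Proof. by rewrite le_eqVlt => /predU1P[<-|t0]; [exact: flow_per0|exact: flow_per]. Qed.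

Lemma flow_time t : 0 < t -> forall e, 0 < e -> exists2 d, 0 < d &
  forall s, `|s - t| < d -> forall x, `|u s x - u t x| <= e.
Proof.
move=> t0 e e0.
(* [du t] is a uniform limit of difference quotients of periodic functions; being also continuous,
   it is bounded. *)
have pdu : periodic (du t) L.
  move=> x; apply/eqP; rewrite -subr_eq0 -normr_le0; apply: (@le_addgt0 _ _ _ 2) => a a0.
  have [d d0 hd] := flow_dt F t0 a0.
  pose h := Num.min d t / 2.
  have mn0 : 0 < Num.min d t by rewrite lt_min d0.
  have h0 : 0 < h by rewrite /h; lra.
  have hd1 : h < d by have : Num.min d t <= d by [rewrite ge_min lexx]; rewrite /h; lra.
  have hn : h != 0 by rewrite gt_eqF.
  have hab : `|h| < d by rewrite gtr0_norm.
  have h1 := hd h hn hab x; have h2 := hd h hn hab (x + L).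
  have th0 : 0 < t + h by lra.
  move: h2; rewrite (flow_per F t0) (flow_per F th0) => h2.
  rewrite (gtr0_norm h0) in h1 h2.
  have : h * `|du t (x + L) - du t x| <= h * (0 + a * 2).
    rewrite -{1}(gtr0_norm h0) -normrM.
    have -> : h * (du t (x + L) - du t x) = (u (t + h) x - u t x - h * du t x) - (u (t + h) x - u t x - h * du t (x + L)) by ring.
    by apply: (le_trans (ler_normB _ _)); lra.
  by rewrite ler_pM2l.
have [C C0 hC] := periodic_bounded L0 pdu (flow_cdu F t0).
have [d d0 hd] := flow_dt F t0 ltr01.
have C1 : 0 < C + 1 by lra.
exists (Num.min d (e / (C + 1))).
  by rewrite lt_min d0 divr_gt0.
move=> s; rewrite lt_min => /andP[sd se] x.
have [->|st] := eqVneq s t; first by rewrite subrr normr0 ltW.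
have hn : s - t != 0 by rewrite subr_eq0.
have := hd _ hn sd x; rewrite mul1r (_ : t + (s - t) = s); last by ring.
move=> h1.
have h2 : `|(s - t) * du t x| <= `|s - t| * C by rewrite normrM; apply: ler_wpM2l.
have h3 : `|s - t| * (C + 1) < e by rewrite -ltr_pdivlMr.
have -> : u s x - u t x = (u s x - u t x - (s - t) * du t x) + (s - t) * du t x by ring.
by apply: (le_trans (ler_normD _ _)); lra.
Qed.

Lemma flow_time_right t : 0 <= t -> forall e, 0 < e -> exists2 d, 0 < d &
  forall s, t < s < t + d -> forall x, `|u s x - u t x| <= e.
Proof.
rewrite le_eqVlt => /predU1P[<-|t0] e e0.
  by have [d d0 hd] := flow_0 F e0; exists d => // s; rewrite add0r; exact: hd.
have [d d0 hd] := flow_time t0 e0; exists d => // s /andP[s1 s2]; apply: hd.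
by rewrite gtr0_norm; lra.
Qed.

Lemma flow_dt_left t : 0 < t -> forall e, 0 < e -> exists2 d, 0 < d &
  forall h, 0 < h < d -> h < t -> forall x, `|u t x - u (t - h) x - h * du t x| <= e * h.
Proof.
move=> t0 e e0; have [d d0 hd] := flow_dt F t0 e0; exists d => // h /andP[h0 hd1] ht x.
have hn : - h != 0 by rewrite oppr_eq0 gt_eqF.
have := hd _ hn; rewrite normrN (gtr0_norm h0) => /(_ hd1 x).
have -> : u t x - u (t - h) x - h * du t x = - (u (t - h) x - u t x - - h * du t x) by ring.
by rewrite normrN.
Qed.

(** The total flux, in terms of which the equation is in divergence form. *)
Let G t y := J t y + beta^-1 * ux t y.

Lemma flow_dG t : 0 < t -> forall x, is_derive x 1 (G t) (du t x).
Proof.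
move=> t0 x; have d1 := flow_dJ t0 x; have d2 := flow_dxx F t0 x.
by rewrite /G; der; rewrite /Jx; ring.
Qed.

Lemma flow_perG t : 0 < t -> periodic (G t) L.
Proof. by move=> t0 x; rewrite /G flow_perJ// flow_perx. Qed.

Lemma flow_int_du t : 0 < t -> I (du t) = 0.
Proof.
move=> t0.
by apply: (@cint_derive _ _ L0 (G t)); [exact: flow_perG|exact: flow_dG|exact: flow_cdu].
Qed.

Lemma cint_close (f g : R -> R) e : continuous f -> continuous g ->
  (forall x, `|f x - g x| <= e) -> `|I f - I g| <= e * L.
Proof.
move=> cf cg fg; rewrite -cintB//; apply: cint_abs_le => //.
by cts.
Qed.

Lemma flow_mass_dini t : 0 < t -> forall e, 0 < e -> exists2 d, 0 < d &
  forall h, 0 < h < d -> h < t -> `|I (u t) - I (u (t - h))| <= e * h.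
Proof.
move=> t0 e e0; have eL0 : 0 < e / L by rewrite divr_gt0.
have [d d0 hd] := flow_dt_left t0 eL0; exists d => // h hh ht.
have c1 : continuous (u t) by apply: flow_cu; lra.
have c2 : continuous (u (t - h)) by apply: flow_cu; lra.
have c3 := flow_cdu F t0.
have c4 : continuous (fun x => h * du t x) by cts.
have c5 : continuous (fun x => u t x - u (t - h) x) by cts.
have := cint_close c5 c4 (hd h hh ht).
rewrite cintB// cintZ// flow_int_du// mulr0 subr0.
by rewrite mulrAC mulfVK ?gt_eqF.
Qed.

(** The Dini criterion for the mass and for its negative. *)
Lemma flow_mass t : 0 <= t -> I (u t) = 1.
Proof.
move=> t0; rewrite -(flow_mass0 F).
have usc s e : 0 <= s -> 0 < e -> exists2 d, 0 < d &
    forall r, s < r < s + d -> `|I (u r) - I (u s)| <= e.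
  move=> s0 e0; have eL0 : 0 < e / L by rewrite divr_gt0.
  have [d d0 hd] := flow_time_right s0 eL0; exists d => // r hr.
  have c1 : continuous (u r) by apply: flow_cu; lra.
  have := cint_close c1 (flow_cu s0) (hd r hr).
  by rewrite mulfVK ?gt_eqF.
apply/eqP; rewrite eq_le; apply/andP; split.
  apply: (@left_dini_le0 _ (fun s => I (u s))) => // s s0 e e0.
    have [d d0 hd] := usc _ _ s0 e0; exists d => // r /hd.
    by have := ler_norm (I (u r) - I (u s)); lra.
  have [d d0 hd] := flow_mass_dini s0 e0; exists d => // h h1 h2.
  by apply: le_trans (hd h h1 h2); exact: ler_norm.
rewrite -lerN2; apply: (@left_dini_le0 _ (fun s => - I (u s))) => // s s0 e e0.
  have [d d0 hd] := usc _ _ s0 e0; exists d => // r /hd.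
  by rewrite distrC; have := ler_norm (I (u s) - I (u r)); lra.
have [d d0 hd] := flow_mass_dini s0 e0; exists d => // h h1 h2.
apply: le_trans (hd h h1 h2); rewrite distrC opprK addrC.
by exact: ler_norm.
Qed.

(* [eta d] is a smooth convex approximation of twice the negative part. *)
Let eta d r : R := Num.sqrt (r ^+ 2 + d ^+ 2) - r.
Let eta' d r : R := r / Num.sqrt (r ^+ 2 + d ^+ 2) - 1.

Let sq_gt0 (d r : R) : 0 < d -> 0 < r ^+ 2 + d ^+ 2.
Proof. by move=> d0; rewrite ltr_wpDl ?sqr_ge0// exprn_gt0. Qed.

Let sqrt_ge_abs (d r : R) : 0 < d -> `|r| <= Num.sqrt (r ^+ 2 + d ^+ 2).
Proof. by move=> d0; rewrite -sqrtr_sqr ler_wsqrtr// lerDl sqr_ge0. Qed.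

Let eta_close d r : 0 < d -> `|eta d r - (`|r| - r)| <= d.
Proof.
move=> d0; rewrite /eta opprB addrA subrK.
rewrite ger0_norm ?subr_ge0 ?sqrt_ge_abs// lerBlDr.
rewrite -[leRHS]ger0_norm ?addr_ge0 ?(ltW d0)// -sqrtr_sqr ler_wsqrtr//.
rewrite sqrrD real_normK ?num_real// addrC lerD2r lerDl.
by rewrite mulrn_wge0// mulr_ge0// ltW.
Qed.

(** The tangent at [b]; it amounts to the Cauchy-Schwarz inequality for the vectors [(a, d)] and
    [(b, d)]. *)
Let eta_convex d a b : 0 < d -> eta d b - eta d a <= eta' d b * (b - a).
Proof.
move=> d0; rewrite /eta /eta'.
set sb := Num.sqrt (b ^+ 2 + _); set sa := Num.sqrt (a ^+ 2 + _).
have sb0 : 0 < sb by rewrite sqrtr_gt0 sq_gt0.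
have sa0 : 0 < sa by rewrite sqrtr_gt0 sq_gt0.
have hb : sb ^+ 2 = b ^+ 2 + d ^+ 2 by rewrite sqr_sqrtr// ltW// sq_gt0.
have ha : sa ^+ 2 = a ^+ 2 + d ^+ 2 by rewrite sqr_sqrtr// ltW// sq_gt0.
suff : sb - sa <= b / sb * (b - a) by lra.
rewrite mulrAC ler_pdivlMr//.
suff : a * b + d ^+ 2 <= sa * sb by rewrite mulrBl -expr2 hb; lra.
have h : (a * b + d ^+ 2) ^+ 2 <= (sa * sb) ^+ 2.
  rewrite exprMn ha hb.
  have -> : (a ^+ 2 + d ^+ 2) * (b ^+ 2 + d ^+ 2) = (a * b + d ^+ 2) ^+ 2 + d ^+ 2 * (a - b) ^+ 2 by ring.
  by rewrite lerDl mulr_ge0// sqr_ge0.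
apply: (le_trans (ler_norm _)).
rewrite -(ler_pXn2r (n := 2))// ?nnegrE ?mulr_ge0 ?(ltW sa0) ?(ltW sb0)//.
by rewrite real_normK ?num_real.
Qed.

Let eta'_bound d r : 0 < d -> `|eta' d r| <= 2.
Proof.
move=> d0; have s0 : 0 < Num.sqrt (r ^+ 2 + d ^+ 2) by rewrite sqrtr_gt0 sq_gt0.
have : `|r / Num.sqrt (r ^+ 2 + d ^+ 2)| <= 1.
  by rewrite normrM normfV (gtr0_norm s0) ler_pdivrMr// mul1r sqrt_ge_abs.
by rewrite /eta' => h; apply: (le_trans (ler_normB _ _)); rewrite normr1; lra.
Qed.

(** After integration by parts against the flux, diffusion contributes with a sign because [eta] is
    convex, and the drift [W] is paired with [phi'], where [|phi| <= d]. So the bound vanishes with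
    the smoothing parameter. *)
Let eta_dissip d t : 0 < d -> 0 < t ->
  I (fun x => eta' d (u t x) * du t x) <= kappa * lam t * (d * L).
Proof.
move=> d0 t0.
pose s x := Num.sqrt (u t x ^+ 2 + d ^+ 2).
have s0 x : 0 < s x by rewrite sqrtr_gt0 sq_gt0.
have ssq x : s x ^+ 2 = u t x ^+ 2 + d ^+ 2 by rewrite sqr_sqrtr// ltW// sq_gt0.
have sn0 x : s x != 0 by rewrite gt_eqF.
have sp x : 0 < u t x ^+ 2 + d ^+ 2 by exact: sq_gt0.
pose eta'' x := d ^+ 2 * ux t x / s x ^+ 3.
have cu : continuous (u t) by apply: flow_cu; exact: ltW.
have cux := flow_cx t0.
have cs : continuous s by rewrite /s; cts.
have s30 x : s x ^+ 3 != 0 by rewrite expf_neq0.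
have ds x : is_derive x 1 s (u t x * ux t x / s x).
  have d1 := flow_dx F t0 x; have spx := sp x.
  rewrite /s; der; rewrite -/(s x).
  by field.
have deta x : is_derive x 1 (fun x => eta' d (u t x)) (eta'' x).
  have d1 := flow_dx F t0 x; have d2 := ds x; have snx := sn0 x.
  rewrite /eta' -/(s _); der; rewrite -/(s x) /eta''.
  have e : d ^+ 2 * ux t x = (s x ^+ 2 - u t x ^+ 2) * ux t x.
    by rewrite ssq addrAC subrr add0r.
  by rewrite e; field.
have ceta : continuous (fun x => eta'' x) by rewrite /eta''; cts.
have pu := flow_per F t0.
have peta : periodic (fun x => eta' d (u t x)) L by move=> x /=; rewrite pu.
rewrite (cint_by_parts L0 peta (flow_perG t0) deta (flow_dG t0) ceta (flow_cdu F t0)).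
pose phi x := - (d ^+ 2 / s x).
pose phi' x := d ^+ 2 * u t x * ux t x / s x ^+ 3.
have dphi x : is_derive x 1 phi (phi' x).
  have d2 := ds x; have snx := sn0 x.
  by rewrite /phi; der; rewrite /phi'; field.
have cphi' : continuous phi' by rewrite /phi'; cts.
pose W x := w - kappa * V t x; pose W' x := - (kappa * V' t x).
have dW x : is_derive x 1 W (W' x).
  by have d1 := flow_dV F t0 x; rewrite /W; der; rewrite /W'; ring.
have W'le x : `|W' x| <= kappa * lam t.
  by rewrite normrN normrM (gtr0_norm kappa0) ler_pM2l// flow_lam.
have pW : periodic W L by move=> x; rewrite /W (flow_perV F t0).
have pphi : periodic phi L by move=> x; rewrite /phi /s pu.
have cW : continuous W := deriv_continuous dW.
have cphi : continuous phi := deriv_continuous dphi.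
have key := cint_derive_mul_le L0 pphi pW dphi cphi' dW W'le.
have lam0 : 0 <= lam t by apply: le_trans (flow_lam F t0 0).
have phiL : I (fun x => `|phi x|) <= d * L.
  rewrite -cint_cst//; apply: cint_le; [by cts|by cts|] => x.
  rewrite /phi normrN normrM normfV (gtr0_norm (s0 x)) ger0_norm ?sqr_ge0//.
  rewrite ler_pdivrMr// expr2 ler_pM2l//.
  rewrite -[leLHS]ger0_norm ?(ltW d0)// -sqrtr_sqr /s ler_wsqrtr//.
  by rewrite lerDr sqr_ge0.
apply: (@le_trans _ _ (I (fun x => phi' x * W x))); last first.
  apply: (le_trans key); apply: ler_wpM2l => //.
  by rewrite mulr_ge0// ltW.
have cG : continuous (G t) := deriv_continuous (flow_dG t0).
rewrite -mulN1r -cintZ; last by cts.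
apply: cint_le; [by cts|by cts|] => x.
have -> : -1 * (eta'' x * G t x) = phi' x * W x - beta^-1 * d ^+ 2 * ux t x ^+ 2 / s x ^+ 3.
  have s3 := s30 x; have bn : beta != 0 by rewrite gt_eqF.
  by rewrite /G /J /eta'' /phi' /W; ring.
rewrite gerBl; apply: divr_ge0; last by rewrite exprn_ge0// ltW.
by rewrite mulr_ge0 ?sqr_ge0// mulr_ge0 ?sqr_ge0// invr_ge0 ltW.
Qed.

(** The integral of [|u| - u], twice the negative part, starts at zero and does not increase. *)
Lemma flow_ge0 t : 0 <= t -> forall x, 0 <= u t x.
Proof.
pose E t := I (fun x => `|u t x| - u t x).
have cE s : 0 <= s -> continuous (fun x => `|u s x| - u s x).
  by move=> s0; have cs := flow_cu s0; cts.
suff E0 s : 0 <= s -> E s <= 0.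
  move=> t0 x; have pE : periodic (fun x => `|u t x| - u t x) L.
    by move=> y /=; rewrite flow_perge0.
  have nn y : 0 <= `|u t y| - u t y by rewrite subr_ge0 ler_norm.
  have Et : I (fun x => `|u t x| - u t x) = 0.
    by apply/eqP; rewrite eq_le E0// cint_ge0.
  have := cint_eq0 L0 pE (cE _ t0) nn Et x.
  by move=> /eqP; rewrite subr_eq0 => /eqP <-.
move=> s0; rewrite -(flow_neg0 F); apply: (@left_dini_le0 _ E) => //.
  move=> {s0}s s0 e e0.
  have eL0 : 0 < e / L / 2 by rewrite !divr_gt0.
  have [d d0 hd] := flow_time_right s0 eL0; exists d => // r hr.
  have r0 : 0 <= r by lra.
  have : `|E r - E s| <= (e / L) * L.
    apply: cint_close; [exact: cE|exact: cE|] => x.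
    have -> : `|u r x| - u r x - (`|u s x| - u s x) = (`|u r x| - `|u s x|) - (u r x - u s x) by ring.
    apply: (le_trans (ler_normB _ _)).
    have := hd r hr x; have := lerB_dist (u r x) (u s x).
    have := ler_dist_dist (u r x) (u s x).
    by lra.
  rewrite mulfVK ?gt_eqF//; have := ler_norm (E r - E s); lra.
move=> {s0}s s0 e e0.
have eL0 : 0 < e / L / 2 by rewrite !divr_gt0.
have [d d0 hd] := flow_dt_left s0 eL0; exists d => // h hh hs.
have h0 : 0 < h by case/andP: hh.
have sh0 : 0 <= s - h by lra.
have c1 : continuous (u s) by apply: flow_cu; lra.
have c2 := flow_cu sh0; have c3 := flow_cdu F s0.
(* The smoothing parameter [a] tends to zero with [h] fixed: [eta_dissip] contributes
   [h * kappa * lam s * L], and smoothing the integrand at the two times costs [L] each. *)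
apply: (@le_addgt0 _ _ _ (h * kappa * lam s * L + 2 * L)) => a a0.
pose Ea r := I (fun x => eta a (u r x)).
have ceta r : 0 <= r -> continuous (fun x => eta a (u r x)).
  by move=> r0; have cr := flow_cu r0; rewrite /eta; cts.
have EaE r : 0 <= r -> `|Ea r - E r| <= a * L.
  by move=> r0; apply: cint_close => [| |x]; [exact: ceta|exact: cE|exact: eta_close].
have k1 := EaE _ (ltW s0); have k2 := EaE _ sh0.
suff : Ea s - Ea (s - h) <= e * h + a * (h * kappa * lam s * L).
  have := ler_norm (Ea (s - h) - E (s - h)); have := ler_norm (- (Ea s - E s)).
  by rewrite normrN mulrDr; lra.
have spn x : Num.sqrt (u s x ^+ 2 + a ^+ 2) != 0 by rewrite gt_eqF// sqrtr_gt0 sq_gt0.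
have ceta' : continuous (fun x => eta' a (u s x)) by rewrite /eta'; cts.
have cc1 : continuous (fun x => h * (eta' a (u s x) * du s x)) by cts.
have cc2 : continuous (fun x => eta' a (u s x) * du s x) by cts.
have cc3 : continuous (fun _ : R => e / L * h) by cts.
have ceh := ceta _ sh0; have ces := ceta _ (ltW s0).
rewrite -cintB//.
apply: (@le_trans _ _ (I (fun x => h * (eta' a (u s x) * du s x) + e / L * h))).
  apply: cint_le; [by cts|by cts|] => x.
  apply: (le_trans (eta_convex _ _ a0)).
  have -> : eta' a (u s x) * (u s x - u (s - h) x) = h * (eta' a (u s x) * du s x) + eta' a (u s x) * (u s x - u (s - h) x - h * du s x) by ring.
  rewrite lerD2l; apply: (le_trans (ler_norm _)); rewrite normrM.
  have b1 := eta'_bound (u s x) a0; have b2 := hd h hh hs x.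
  apply: (@le_trans _ _ (2 * (e / L / 2 * h))); first by apply: ler_pM.
  by rewrite le_eqVlt; apply/orP; left; apply/eqP; field; rewrite gt_eqF.
rewrite cintD// cintZ// cint_cst//.
have -> : e / L * h * L = e * h by field; rewrite gt_eqF.
rewrite addrC lerD2l.
have := eta_dissip a0 s0 => /(ler_wpM2l (ltW h0)) /le_trans; apply.
by rewrite le_eqVlt; apply/orP; left; apply/eqP; ring.
Qed.


Section regularised.
Variable eps : R.
Hypothesis eps01 : 0 < eps < 1.

(* Keeping the density above [eps / L] makes its logarithm bounded. *)
Definition mix t x : R := (1 - eps) * u t x + eps / L.
Definition mix_entropy t : R := I (fun x => Phi L (mix t x)).
Definition mix_dist t : R := I (fun x => `|mix t x - L^-1|).
Definition mix_rate t : R := I (fun x => ln (L * mix t x) * ((1 - eps) * du t x)).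

Let e0 : 0 < eps. Proof. by case/andP: eps01. Qed.
Let e1 : 0 < 1 - eps. Proof. by case/andP: eps01; rewrite subr_gt0. Qed.
Let e1M (z : R) : (1 - eps) * `|z| <= `|z|.
Proof. by rewrite ler_piMl// gerBl ltW. Qed.
Let iL0 : 0 < L^-1. Proof. by rewrite invr_gt0. Qed.
Let LiL : L * L^-1 = 1. Proof. by rewrite divff ?gt_eqF. Qed.

Lemma mix_ge t x : 0 <= t -> eps / L <= mix t x.
Proof. by move=> t0; rewrite /mix lerDr mulr_ge0// ?flow_ge0// ltW. Qed.

Lemma mix_gt0 t x : 0 <= t -> 0 < mix t x.
Proof. by move=> t0; apply: lt_le_trans (mix_ge _ t0); rewrite divr_gt0. Qed.

Lemma mix_cont t : 0 <= t -> continuous (mix t).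
Proof. by move=> t0; have cu := flow_cu t0; rewrite /mix; cts. Qed.

Lemma mix_per t : 0 <= t -> periodic (mix t) L.
Proof. by move=> t0 x; rewrite /mix flow_perge0. Qed.

Lemma mix_mass t : 0 <= t -> I (mix t) = 1.
Proof.
move=> t0; have cu := flow_cu t0.
have c1 : continuous (fun x => (1 - eps) * u t x) by cts.
have c2 : continuous (fun _ : R => eps / L) by cts.
rewrite -[LHS]/(I (fun x => (1 - eps) * u t x + eps / L)).
rewrite (cintD L c1 c2) (cintZ L _ cu) (cint_cst L0) flow_mass// mulfVK ?gt_eqF//; ring.
Qed.

Lemma mix_cln t : 0 <= t -> continuous (fun x => ln (L * mix t x)).
Proof.
move=> t0; have cm := mix_cont t0; cts => x.
by rewrite mulr_gt0// mix_gt0.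
Qed.

Lemma mix_entropy_ge0 t : 0 <= mix_entropy t.
Proof. by apply: cint_ge0 => x; exact: Phi_ge0. Qed.

Lemma mix_pinsker t : 0 <= t -> mix_dist t ^+ 2 <= 2 * mix_entropy t.
Proof.
move=> t0; apply: (pinsker L0) => [|x|]; [exact: mix_cont|exact: mix_gt0|exact: mix_mass].
Qed.

Lemma mix_abs_ln t x : 0 <= t -> `|ln (L * mix t x)| <= - ln eps + L * mix t x.
Proof.
move=> t0; have m0 := mix_gt0 x t0.
have Lm0 : 0 < L * mix t x by rewrite mulr_gt0.
have h1 : ln eps <= ln (L * mix t x).
  rewrite ler_ln ?posrE//.
  have := mix_ge x t0; rewrite -(ler_pM2l L0).
  by have -> : L * (eps / L) = eps by rewrite mulrCA LiL mulr1.
have h2 : ln eps <= 0 by rewrite ln_le0// ltW//; case/andP: eps01.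
have h3 := ln_le_sub1 Lm0.
by rewrite ler_norml; apply/andP; split; lra.
Qed.

(** Conservation of mass makes this uniform in time, so a uniformly small change of the density has
    a small effect on the entropy. *)
Lemma mix_int_abs_ln t : 0 <= t -> I (fun x => `|ln (L * mix t x)|) <= (1 - ln eps) * L.
Proof.
move=> t0; have c1 := mix_cln t0; have cm := mix_cont t0.
have c2 : continuous (fun _ : R => - ln eps) by cts.
have c3 : continuous (fun x => L * mix t x) by cts.
apply: (@le_trans _ _ (I (fun x => - ln eps + L * mix t x))).
  by apply: cint_le => [| |x]; [cts|cts|exact: mix_abs_ln].
by rewrite cintD// cintZ// cint_cst// mix_mass//; lra.
Qed.

Lemma mix_abs_ln_mul t (f : R -> R) C : 0 <= t -> continuous f -> 0 <= C ->
  (forall x, `|f x| <= C) -> `|I (fun x => ln (L * mix t x) * f x)| <= C * ((1 - ln eps) * L).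
Proof.
move=> t0 cf C0 fC; have c1 := mix_cln t0.
apply: le_trans (ler_wpM2l C0 (mix_int_abs_ln t0)).
rewrite -cintZ; last by cts.
apply: (@le_trans _ _ (I (fun x => `|ln (L * mix t x) * f x|))).
  by apply: cint_abs; cts.
apply: cint_le => [| |x]; [by cts|by cts|].
by rewrite normrM mulrC; apply: ler_wpM2r.
Qed.

(** Convexity with the tangent at [t], so that left difference quotients at [t] involve the
    logarithm at [t] only. *)
Lemma mix_entropy_step s t : 0 <= s -> 0 <= t ->
  mix_entropy t - mix_entropy s <= I (fun x => ln (L * mix t x) * (mix t x - mix s x)).
Proof.
move=> s0 t0; have ct := mix_cont t0; have cs := mix_cont s0; have cl := mix_cln t0.
have cPt := continuous_Phi L0 ct (fun x => mix_gt0 x t0).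
have cPs := continuous_Phi L0 cs (fun x => mix_gt0 x s0).
rewrite /mix_entropy -cintB//; apply: cint_le => [| |x]; [by cts|by cts|].
by apply: Phi_tangent => //; [exact/ltW/mix_gt0|exact: mix_gt0].
Qed.

Let mixB s t x : mix t x - mix s x = (1 - eps) * (u t x - u s x).
Proof. by rewrite /mix; ring. Qed.

Let mix_close s t x c : `|u t x - u s x| <= c -> `|mix t x - mix s x| <= c.
Proof. by move=> h; rewrite mixB normrM (gtr0_norm e1); exact: le_trans (e1M _) h. Qed.

Let K := (1 - ln eps) * L.
Let K0 : 0 < K.
Proof.
by rewrite mulr_gt0// subr_gt0; apply: le_lt_trans ltr01; rewrite ln_le0// ltW//; case/andP: eps01.
Qed.

Lemma mix_entropy_usc s : 0 <= s -> forall e, 0 < e -> exists2 d, 0 < d &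
  forall r, s < r < s + d -> mix_entropy r <= mix_entropy s + e.
Proof.
move=> s0 e ep; have eK0 : 0 < e / K by rewrite divr_gt0.
have [d d0 hd] := flow_time_right s0 eK0; exists d => // r hr.
have r0 : 0 <= r by lra.
rewrite -lerBlDl; apply: (le_trans (mix_entropy_step s0 r0)).
apply: (le_trans (ler_norm _)).
have cr := mix_cont r0; have cs := mix_cont s0.
apply: (le_trans (@mix_abs_ln_mul r (fun x => mix r x - mix s x) (e / K) r0 _ (ltW eK0) _)).
- by cts.
- by move=> x; apply: mix_close; exact: hd.
- by rewrite -/K mulfVK ?gt_eqF.
Qed.

Lemma mix_entropy_dini t : 0 < t -> forall e, 0 < e -> exists2 d, 0 < d &
  forall h, 0 < h < d -> h < t -> mix_entropy t - mix_entropy (t - h) <= (mix_rate t + e) * h.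
Proof.
move=> t0 e ep; have eK0 : 0 < e / K by rewrite divr_gt0.
have [d d0 hd] := flow_dt_left t0 eK0; exists d => // h hh ht.
have h0 : 0 < h by case/andP: hh.
have t0' := ltW t0; have th0 : 0 <= t - h by lra.
apply: (le_trans (mix_entropy_step th0 t0')).
have cl := mix_cln t0'; have ct := flow_cu t0'; have cth := flow_cu th0.
have cd := flow_cdu F t0.
pose f x := (1 - eps) * (u t x - u (t - h) x - h * du t x).
have cf : continuous f by rewrite /f; cts.
have fC x : `|f x| <= e / K * h.
  rewrite /f normrM (gtr0_norm e1).
  exact: le_trans (e1M _) (hd h hh ht x).
have ehK0 : 0 <= e / K * h by rewrite mulr_ge0// ltW.
have key := mix_abs_ln_mul t0' cf ehK0 fC.
have c1 : continuous (fun x => ln (L * mix t x) * ((1 - eps) * du t x)) by cts.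
have c2 : continuous (fun x => ln (L * mix t x) * f x) by cts.
have c3 : continuous (fun x => h * (ln (L * mix t x) * ((1 - eps) * du t x))) by cts.
have -> : I (fun x => ln (L * mix t x) * (mix t x - mix (t - h) x)) =
    I (fun x => h * (ln (L * mix t x) * ((1 - eps) * du t x)) + ln (L * mix t x) * f x).
  by apply: eq_Rintegral => x _; rewrite mixB /f; ring.
rewrite cintD// cintZ// -/(mix_rate t) mulrDl [h * _]mulrC lerD2l.
apply: (le_trans (ler_norm _)); apply: (le_trans key).
by rewrite mulrAC -/K mulfVK ?gt_eqF.
Qed.

(** [r - L^-1] and [ln (L * r)] have the same sign, and [q <= r], [q <= L^-1] give
    [q * |ln (L * r)| <= |r - L^-1|]: subtracting the logarithm only brings the value closer to
    zero. *)
Let theta_bound q r : 0 < q -> q <= r -> q <= L^-1 -> `|r - L^-1 - q * ln (L * r)| <= `|r - L^-1|.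
Proof.
move=> q0 qr qL; have r0 : 0 < r by exact: lt_le_trans qr.
have Lr0 : 0 < L * r by rewrite mulr_gt0.
have [h|h] := leP L^-1 r.
  have l0 : 0 <= ln (L * r) by rewrite ln_ge0// -LiL ler_pM2l.
  have l1 : q * ln (L * r) <= r - L^-1.
    apply: (@le_trans _ _ (L^-1 * (L * r - 1))); last by rewrite mulrBr mulr1 mulrA mulVf ?gt_eqF// mul1r.
    by apply: ler_pM => //; [exact: ltW|exact: ln_le_sub1].
  have l2 : 0 <= q * ln (L * r) by rewrite mulr_ge0// ltW.
  by rewrite !ger0_norm; lra.
have iLr : 0 < (L * r)^-1 by rewrite invr_gt0.
have l0 : ln (L * r) <= 0 by rewrite ln_le0// -LiL ler_pM2l// ltW.
have l1 := ln_le_sub1 iLr; rewrite lnV ?posrE// in l1.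
have l2 : q * - ln (L * r) <= L^-1 - r.
  apply: (@le_trans _ _ (r * ((L * r)^-1 - 1))); last first.
    by rewrite mulrBr mulr1 invfM mulrCA divff ?gt_eqF// mulr1.
  by apply: ler_pM => //; [exact: ltW|rewrite oppr_ge0].
have l3 : q * ln (L * r) <= 0 by rewrite mulr_ge0_le0// ltW.
by rewrite !ler0_norm; lra.
Qed.

Lemma mix_rate_le t : 0 < t ->
  mix_rate t <= - (4 * pi ^+ 2 / (L ^+ 2 * beta)) * mix_entropy t + kappa * lam t * mix_dist t.
Proof.
move=> t0; have t0' := ltW t0.
pose p := mix t; pose p' x := (1 - eps) * ux t x.
have p0 x : 0 < p x by exact: mix_gt0.
have pn0 x : p x != 0 by rewrite gt_eqF.
have dp x : is_derive x 1 p (p' x).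
  by have d1 := flow_dx F t0 x; rewrite /p /mix; der; rewrite /p'; ring.
have pp := mix_per t0' : periodic p L.
have cp := mix_cont t0' : continuous p.
have cux := flow_cx t0; have cdu := flow_cdu F t0.
have cp' : continuous p' by rewrite /p'; cts.
pose l x := ln (L * p x); pose l' x := p' x / p x.
have cl' : continuous l' by rewrite /l'; cts.
have dl x : is_derive x 1 l (l' x).
  have dpx := dp x; have Lp0 : 0 < L * p x by rewrite mulr_gt0.
  rewrite /l; der; rewrite /l' invfM.
  by rewrite mul0r add0r mulrACA mulVf ?gt_eqF// mul1r mulrC.
have pl : periodic l L by move=> x; rewrite /l pp.
have cl : continuous l := deriv_continuous dl.
have -> : mix_rate t = (1 - eps) * I (fun x => l x * du t x).
  rewrite -cintZ; last by cts.
  by apply: eq_Rintegral => x _; rewrite /l /p; ring.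
rewrite (cint_by_parts L0 pl (flow_perG t0) dl (flow_dG t0) cl' cdu).
have cG : continuous (G t) := deriv_continuous (flow_dG t0).
pose q := eps / L.
have q0 : 0 < q by rewrite /q divr_gt0.
have qL : q <= L^-1 by rewrite /q ler_pdivrMr// mulVf ?gt_eqF// ltW//; case/andP: eps01.
(* The drift carries only [(1 - eps) * u = p - q], and [(p - q) * p' / p] is the derivative of
   [p - q * ln (L * p)]. Subtracting [L^-1] makes [phi] vanish at the uniform density. *)
pose phi x := p x - L^-1 - q * l x.
pose phi' x := p' x - q * l' x.
have dphi x : is_derive x 1 phi (phi' x).
  by have d1 := dp x; have d2 := dl x; rewrite /phi; der; rewrite /phi'; ring.
have cphi' : continuous phi' by rewrite /phi'; cts.
have cphi : continuous phi := deriv_continuous dphi.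
pose W x := w - kappa * V t x; pose W' x := - (kappa * V' t x).
have dW x : is_derive x 1 W (W' x).
  by have d1 := flow_dV F t0 x; rewrite /W; der; rewrite /W'; ring.
have W'le x : `|W' x| <= kappa * lam t.
  by rewrite normrN normrM (gtr0_norm kappa0) ler_pM2l// flow_lam.
have pW : periodic W L by move=> x; rewrite /W (flow_perV F t0).
have cW : continuous W := deriv_continuous dW.
have pphi : periodic phi L by move=> x; rewrite /phi pl pp.
have key := cint_derive_mul_le L0 pphi pW dphi cphi' dW W'le.
have lam0 : 0 <= lam t by apply: le_trans (flow_lam F t0 0).
have cp2 : continuous (fun x => p' x ^+ 2 / p x) by cts.
have c1 : continuous (fun x => phi' x * W x) by cts.
have c2 : continuous (fun x => l' x * G t x) by cts.
have -> : (1 - eps) * - I (fun x => l' x * G t x) =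
    I (fun x => phi' x * W x) - beta^-1 * I (fun x => p' x ^+ 2 / p x).
  rewrite mulrN -mulNr -cintZ// -cintZ// -cintB//; last by cts.
  apply: eq_Rintegral => x _.
  have e : (1 - eps) * u t x = p x - q by rewrite /p /mix /q addrK.
  have -> : - (1 - eps) * (l' x * G t x) = l' x * ((1 - eps) * u t x) * W x - beta^-1 * (l' x * p' x).
    by rewrite /G /J /W /p'; ring.
  rewrite e /phi' /l'; congr (_ - _).
    by congr (_ * _); rewrite mulrBr mulfVK// mulrC.
  by congr (_ * _); rewrite expr2 mulrAC.
have LS := log_sobolev L0 pp p0 dp cp' (mix_mass t0').
have cm : continuous (fun x => `|phi x|) by cts.
have cd : continuous (fun x => `|p x - L^-1|) by cts.
have phile : I (fun x => `|phi x|) <= mix_dist t.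
  apply: cint_le => // x; apply: theta_bound => //.
  exact: mix_ge.
rewrite addrC; apply: lerD; last first.
  by apply: (le_trans key); apply: ler_wpM2l => //; rewrite mulr_ge0// ltW.
rewrite mulNr lerN2.
have pi20 : 0 < 4 * pi ^+ 2 / (L ^+ 2 * beta) :> R.
  by rewrite divr_gt0 ?mulr_gt0 ?exprn_gt0 ?pi_gt0.
apply: (le_trans (ler_wpM2l (ltW pi20) LS)).
rewrite le_eqVlt; apply/orP; left; apply/eqP.
have gen (P X : R) : P != 0 -> 4 * P / (L ^+ 2 * beta) * (L ^+ 2 / (4 * P) * X) = beta^-1 * X.
  move=> P0; have Ln0 : L != 0 by rewrite gt_eqF.
  by have bn0 : beta != 0 by [rewrite gt_eqF]; field; rewrite P0 Ln0 bn0.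
by apply: gen; rewrite expf_neq0// gt_eqF// pi_gt0.
Qed.

Lemma mix_rate_cont t : 0 < t -> forall e, 0 < e -> exists2 d, 0 < d &
  forall s, 0 < s -> `|s - t| < d -> `|mix_rate s - mix_rate t| <= e.
Proof.
move=> t0 e ep; have t0' := ltW t0.
have pdu : periodic (du t) L.
  move=> x; have d1 := flow_dG t0 x.
  have d3 : is_derive x 1 (fun y => y + L) 1 by der; ring.
  have := @dcomp _ (G t) (fun y => y + L) x _ _ (flow_dG t0 (x + L)) d3.
  rewrite mulr1 (_ : (fun y => G t (y + L)) = G t); last first.
    by apply/funext => y; exact: flow_perG.
  by move=> [_ <-]; case: d1.
have [C C0 hC] := periodic_bounded L0 pdu (flow_cdu F t0).
pose C1 := C + 1; have C10 : 0 < C1 by rewrite /C1; lra.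
have a0 : 0 < e / 2 / (C1 * L / eps * L) by rewrite !divr_gt0// !mulr_gt0// invr_gt0.
have b0 : 0 < e / 2 / K by rewrite !divr_gt0.
have [d1 d10 hd1] := flow_time t0 a0.
have [d2 d20 hd2] := flow_ct F t0 b0.
have [d3 d30 hd3] := flow_ct F t0 ltr01.
exists (Num.min d1 (Num.min d2 d3)); first by rewrite !lt_min d10 d20.
move=> s s0; rewrite !lt_min => /and3P[s1 s2 s3].
have s0' := ltW s0.
have cls := mix_cln s0'; have clt := mix_cln t0'.
have cds := flow_cdu F s0; have cdt := flow_cdu F t0.
pose f x := (1 - eps) * (du s x - du t x).
pose g x := (ln (L * mix s x) - ln (L * mix t x)) * ((1 - eps) * du s x).
have cf : continuous f by rewrite /f; cts.
have cg : continuous g by rewrite /g; cts.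
have c1 : continuous (fun x => ln (L * mix t x) * f x) by cts.
have -> : mix_rate s - mix_rate t = I g + I (fun x => ln (L * mix t x) * f x).
  rewrite -cintB; [|by cts..]; rewrite -cintD//.
  by apply: eq_Rintegral => x _; rewrite /g /f; ring.
apply: (le_trans (ler_normD _ _)).
have fC x : `|f x| <= e / 2 / K.
  rewrite /f normrM (gtr0_norm e1).
  exact: le_trans (e1M _) (hd2 s s2 x).
have h1 := mix_abs_ln_mul t0' cf (ltW b0) fC.
rewrite -/K mulfVK ?gt_eqF// in h1.
(* Above [eps / L] the logarithm has slope at most [L / eps]. *)
have lnB (a b : R) : eps / L <= a -> eps / L <= b -> ln (L * a) - ln (L * b) <= `|a - b| * (L / eps).
  move=> ha hb; have eL : 0 < eps / L by rewrite divr_gt0.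
  have a0' : 0 < a := lt_le_trans eL ha.
  have b0' : 0 < b := lt_le_trans eL hb.
  rewrite !lnM ?posrE//.
  have -> : ln L + ln a - (ln L + ln b) = ln (a / b) by rewrite ln_div ?posrE//; lra.
  apply: (le_trans (ln_le_sub1 (divr_gt0 a0' b0'))).
  have -> : a / b - 1 = (a - b) / b by rewrite mulrBl divff ?gt_eqF.
  apply: (@le_trans _ _ (`|a - b| / b)); first by rewrite ler_pM2r ?invr_gt0// ler_norm.
  apply: ler_wpM2l => //; rewrite -[L / eps]invrK invfM invrK mulrC.
  by rewrite lef_pV2 ?posrE.
have gC x : `|g x| <= e / 2 / L.
  rewrite /g normrM.
  have k1 : `|ln (L * mix s x) - ln (L * mix t x)| <= e / 2 / (C1 * L / eps * L) * (L / eps).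
    have ms := mix_ge x s0'; have mt := mix_ge x t0'.
    have Le0 : 0 <= L / eps by rewrite divr_ge0// ltW.
    have k2 := mix_close (hd1 s s1 x).
    have k3 := lnB _ _ ms mt; have k4 := lnB _ _ mt ms.
    have k5 := ler_wpM2r Le0 k2.
    rewrite distrC in k4.
    by rewrite ler_norml; apply/andP; split; lra.
  have k6 : `|(1 - eps) * du s x| <= C1.
    have := hd3 s s3 x; have := hC x.
    rewrite normrM (gtr0_norm e1) => q1 q2.
    have q4 : `|du s x| <= C1.
      have -> : du s x = (du s x - du t x) + du t x by rewrite subrK.
      by apply: (le_trans (ler_normD _ _)); rewrite /C1; lra.
    exact: le_trans (e1M _) q4.
  apply: (le_trans (ler_pM _ _ k1 k6)) => //.
  rewrite le_eqVlt; apply/orP; left; apply/eqP; field.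
  by rewrite !gt_eqF.
have h2 := cint_abs_le L0 cg gC.
rewrite mulfVK ?gt_eqF// in h2.
lra.
Qed.

(** The Dini criterion for the entropy minus [B] times the elapsed time, with the clock started at
    [s]. *)
Lemma mix_entropy_lipschitz B : (forall t, 0 < t -> mix_rate t <= B) ->
  forall s t, 0 <= s -> s <= t -> mix_entropy t - mix_entropy s <= B * (t - s).
Proof.
move=> HB s t s0 st.
have ts0 : 0 <= t - s by rewrite subr_ge0.
suff : mix_entropy (s + (t - s)) - B * (t - s) <= mix_entropy (s + 0) - B * 0.
  by rewrite addr0 mulr0 subr0 (addrC s) subrK; lra.
apply: (@left_dini_le0 _ (fun r => mix_entropy (s + r) - B * r)) => //.
  move=> r r0 e ep; have sr0 : 0 <= s + r by lra.
  have e20 : 0 < e / 2 by lra.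
  have [d d0 hd] := mix_entropy_usc sr0 e20.
  pose d' := Num.min d (e / 2 / (`|B| + 1)).
  have B1 : 0 < `|B| + 1 by rewrite ltr_wpDl.
  exists d'; first by rewrite lt_min d0 divr_gt0.
  move=> r' /andP[r1]; rewrite -ltrBlDl lt_min => /andP[r2 r3].
  have hh : s + r < s + r' < s + r + d by apply/andP; split; lra.
  have := hd _ hh.
  rewrite ltr_pdivlMr// in r3.
  have : - (B * r') + B * r <= (r' - r) * (`|B| + 1).
    have -> : - (B * r') + B * r = (r' - r) * (- B) by ring.
    by apply: ler_wpM2l; [lra|have := ler_norm (- B); rewrite normrN; lra].
  by lra.
move=> r r0 e ep; have sr0 : 0 < s + r by lra.
have [d d0 hd] := mix_entropy_dini sr0 ep; exists d => // h hh hr.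
have hsr : h < s + r by lra.
have h0 : 0 < h by case/andP: hh.
have := hd h hh hsr; have := HB _ sr0 => /(ler_wpM2r (ltW h0)).
have -> : s + (r - h) = s + r - h by rewrite addrA.
by lra.
Qed.

End regularised.
End flow.

(** * Weak derivatives and regularity of the interaction *)

Section smooth_functions.
Set Implicit Arguments.
Unset Strict Implicit.
Context {R : realType}.
Implicit Types (f g : R -> R) (x c L : R).

(** Differentiates [f] once and recurses on the derivative, so that closure under sums and products
    is an induction on [n] in which the functions vary. *)
Fixpoint Cn n f : Prop :=
  if n is m.+1 then (forall x, derivable f x 1) /\ Cn m (derive1 f) else True.

Lemma Cn_derivable f : (forall n, Cn n f) -> forall n x, derivable (derive1n n f) x 1.
Proof.
move=> H n; elim: n f H => [|n IH] f H x; first by have [] := H 1%N.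
by rewrite /derive1n iterSr; apply: IH => k; have [] := H k.+1.
Qed.

Lemma CnS f f' n : (forall x, is_derive x 1 f (f' x)) -> Cn n f' -> Cn n.+1 f.
Proof.
move=> df cf'; split; first by move=> x; case: (df x).
rewrite (_ : derive1 f = f')//; apply/funext => x.
by rewrite derive1E; case: (df x).
Qed.

Lemma CnW f n : Cn n.+1 f -> Cn n f.
Proof. by elim: n f => [//|n IH] f [df cf]; split => //; exact: IH. Qed.

Lemma Cn_is_derive f n : Cn n.+1 f -> forall x, is_derive x 1 f (derive1 f x).
Proof. by move=> [df _] x; apply: DeriveDef; [exact: df|rewrite derive1E]. Qed.

Lemma Cn_cst c n : Cn n (fun=> c).
Proof.
elim: n c => [//|n IH] c.
have h x : is_derive x 1 (fun=> c) 0 by exact: dC.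
exact: (CnS h (IH 0)).
Qed.

Lemma CnD f g n : Cn n f -> Cn n g -> Cn n (fun x => f x + g x).
Proof.
elim: n f g => [//|n IH] f g cf cg.
have h x := dD (Cn_is_derive cf x) (Cn_is_derive cg x).
by apply: (CnS h); case: cf => _ cf; case: cg => _ cg; exact: IH.
Qed.

Lemma CnM f g n : Cn n f -> Cn n g -> Cn n (fun x => f x * g x).
Proof.
elim: n f g => [//|n IH] f g cf cg.
have h x := dM (Cn_is_derive cf x) (Cn_is_derive cg x).
by apply: (CnS h); apply: CnD; apply: IH; [case: cf|exact: CnW|exact: CnW|case: cg].
Qed.

Lemma Cn_sin_cos c d n : Cn n (fun x => sin (c * x + d)) /\ Cn n (fun x => cos (c * x + d)).
Proof.
elim: n => [//|n [IHs IHc]]; split.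
  apply: (@CnS _ (fun x => c * cos (c * x + d))).
    by move=> x; der; ring.
  by apply: CnM => //; exact: Cn_cst.
apply: (@CnS _ (fun x => (- c) * sin (c * x + d))).
  by move=> x; der; ring.
by apply: CnM => //; exact: Cn_cst.
Qed.

Definition logistic g x := (1 + expR (- g x))^-1.

Lemma logistic_denom_gt0 g x : 0 < 1 + expR (- g x).
Proof. by rewrite ltr_pwDl// expR_ge0. Qed.

Lemma logistic_ge0 g x : 0 <= logistic g x.
Proof. by rewrite invr_ge0 ltW// logistic_denom_gt0. Qed.

Lemma logistic_le1 g x : logistic g x <= 1.
Proof. by rewrite invf_le1 ?logistic_denom_gt0// lerDl expR_ge0. Qed.

(** The logistic equation [s' = s * (1 - s) * g'] reduces the next order of differentiability to the
    previous one. *)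
Lemma Cn_logistic g : (forall n, Cn n g) -> forall n, Cn n (logistic g).
Proof.
move=> cg; elim=> [//|n IH].
apply: (@CnS _ (fun x => logistic g x * (1 + (-1) * logistic g x) * derive1 g x)).
  move=> x; have dg := Cn_is_derive (cg 1%N) x.
  have d0 : 1 + expR (- g x) != 0 by rewrite gt_eqF// logistic_denom_gt0.
  rewrite /logistic; der.
  by field.
apply: CnM; last by have [] := cg n.+1.
apply: CnM => //; apply: CnD; first exact: Cn_cst.
by apply: CnM => //; exact: Cn_cst.
Qed.

End smooth_functions.

Section smooth_step.
Set Implicit Arguments.
Unset Strict Implicit.
Context {R : realType}.
Variables (L b : R).
Hypothesis L0 : 0 < L.
Hypothesis bL : - (L / 2) < b < L / 2.
Implicit Types x : R.

(* Positive on ]-L/2, b[ and negative on ]b, L/2[ *)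
Definition arc_sign x : R :=
  sin (pi / L * x + pi / 2) * sin (- (pi / L) * x + pi / L * b).

(** Smooth periodic functions that converge, inside the period, to the indicator of the points left
    of [b]. A logistic function of a large multiple of [arc_sign] takes the place of
    mollification. *)
Definition smooth_step (n : nat) := logistic (fun x => n%:R * arc_sign x).

Lemma smooth_step_Cn n k : Cn k (smooth_step n).
Proof.
apply: Cn_logistic => {}k; apply: CnM; first exact: Cn_cst.
have [h1 _] := Cn_sin_cos (pi / L) (pi / 2) k.
have [h2 _] := Cn_sin_cos (- (pi / L)) (pi / L * b) k.
exact: CnM.
Qed.

Lemma smooth_step_periodic n : periodic (smooth_step n) L.
Proof.
move=> x; rewrite /smooth_step /logistic /arc_sign.
(* Each sine changes sign after one period, so the product is periodic. *)
have -> : pi / L * (x + L) + pi / 2 = pi / L * x + pi / 2 + pi by field; rewrite gt_eqF.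
have -> : - (pi / L) * x + pi / L * b = - (pi / L) * (x + L) + pi / L * b + pi by field; rewrite gt_eqF.
by rewrite !sinDpi; congr ((1 + expR (- (_ * _)))^-1); ring.
Qed.

Lemma arc_sign_gt0 x : - (L / 2) < x < b -> 0 < arc_sign x.
Proof.
move=> /andP[x1 x2]; case/andP: bL => b1 b2.
have piL : 0 < pi / L :> R by rewrite divr_gt0// pi_gt0.
have pie : pi / L * L = pi by rewrite mulfVK ?gt_eqF.
have e1 : pi / L * x + pi / 2 = pi / L * (x + L / 2) by rewrite -{2}pie; ring.
have e2 : - (pi / L) * x + pi / L * b = pi / L * (b - x) by ring.
have h y : 0 < y -> y < L -> 0 < sin (pi / L * y).
  move=> y0 yL; apply: sin_gt0_pi; rewrite mulr_gt0//=.
  by rewrite -{2}pie ltr_pM2l.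
by rewrite /arc_sign e1 e2 mulr_gt0//; apply: h; lra.
Qed.

Lemma arc_sign_lt0 x : b < x < L / 2 -> arc_sign x < 0.
Proof.
move=> /andP[x1 x2]; case/andP: bL => b1 b2.
have piL : 0 < pi / L :> R by rewrite divr_gt0// pi_gt0.
have pie : pi / L * L = pi by rewrite mulfVK ?gt_eqF.
have e1 : pi / L * x + pi / 2 = pi / L * (x + L / 2) by rewrite -{2}pie; ring.
have e2 : - (pi / L) * x + pi / L * b = - (pi / L * (x - b)) by ring.
have h y : 0 < y -> y < L -> 0 < sin (pi / L * y).
  move=> y0 yL; apply: sin_gt0_pi; rewrite mulr_gt0//=.
  by rewrite -{2}pie ltr_pM2l.
by rewrite /arc_sign e1 e2 sinN mulrN oppr_lt0 mulr_gt0//; apply: h; lra.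
Qed.

Lemma expR_ge_id (y : R) : y <= expR y.
Proof. by apply: le_trans (expR_ge1Dx y); rewrite lerDr. Qed.

Lemma nat_large (y : R) : exists N : nat, forall n, (N <= n)%N -> y <= n%:R.
Proof.
exists (Num.truncn `|y|).+1 => n Nn; apply: (le_trans (ler_norm y)).
apply: (@le_trans _ _ (Num.truncn `|y|).+1%:R); last by rewrite ler_nat.
by apply: ltW; have := truncnS_gt `|y|.
Qed.

Lemma smooth_step_cvg1 x : - (L / 2) < x < b -> (smooth_step n x) @[n --> \oo] --> (1 : R).
Proof.
move=> xb; have q0 := arc_sign_gt0 xb.
apply/cvgrPdist_le => e e0.
have [N HN] := nat_large (e^-1 / arc_sign x).
exists N => // n /= Nn; have := HN n Nn; rewrite ler_pdivrMr// => h.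
have E : e^-1 <= expR (n%:R * arc_sign x) by apply: le_trans h (expR_ge_id _).
rewrite ger0_norm ?subr_ge0 ?logistic_le1//.
rewrite lerBlDl -lerBlDr /smooth_step /logistic expRN.
have Ep : 0 < expR (n%:R * arc_sign x) by exact: expR_gt0.
have Ei : (expR (n%:R * arc_sign x))^-1 <= e by rewrite -[e]invrK lef_pV2 ?posrE ?invr_gt0.
set z := (expR _)^-1 in Ei *.
have z0 : 0 < z by rewrite invr_gt0.
have e1 : 1 - z <= (1 + z)^-1.
  rewrite -[leRHS]mul1r ler_pdivlMr; last by lra.
  by have := sqr_ge0 z; lra.
lra.
Qed.

Lemma smooth_step_cvg0 x : b < x < L / 2 -> (smooth_step n x) @[n --> \oo] --> (0 : R).
Proof.
move=> xb; have q0 := arc_sign_lt0 xb.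
apply/cvgrPdist_le => e e0.
have q1 : 0 < - arc_sign x by rewrite oppr_gt0.
have [N HN] := nat_large (e^-1 / - arc_sign x).
exists N => // n /= Nn; have := HN n Nn; rewrite ler_pdivrMr// => h.
have E : e^-1 <= expR (n%:R * - arc_sign x) by apply: le_trans h (expR_ge_id _).
rewrite sub0r normrN ger0_norm ?logistic_ge0//.
rewrite /smooth_step /logistic -mulrN -[e]invrK lef_pV2 ?posrE ?invr_gt0//.
  by apply: (le_trans E); rewrite lerDr.
Qed.

End smooth_step.

(** * Primitives of bounded measurable functions *)

Section bounded_measurable.
Set Implicit Arguments.
Unset Strict Implicit.
Context {R : realType}.
Notation leb := (@lebesgue_measure R).
Implicit Types (f g : R -> R) (a b c x y M L : R).

(** The bound holds everywhere, so it survives translations and products without any null set. *)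
Definition bounded_meas M f := measurable_fun (setT : set (measurableTypeR R)) f /\ forall x, `|f x| <= M.

Lemma bm_integrable M f a b : bounded_meas M f -> leb.-integrable `[a, b] (EFin \o f).
Proof.
move=> [mf fM]; apply: measurable_bounded_integrable => //.
- by rewrite [X in (X < _)%E]lebesgue_measure_itv/=; case: ifP => _; rewrite ?ltry.
- exact: measurable_funTS.
- by exists M; split; [exact: num_real|move=> N MN x _; exact: le_trans (fM x) (ltW MN)].
Qed.

Lemma int_itv_empty f a b : b <= a -> \int[leb]_(t in `[a, b]) f t = 0.
Proof.
rewrite le_eqVlt => /predU1P[->|ba]; first by rewrite set_itv1 Rintegral_set1.
by rewrite set_itv_ge ?Rintegral_set0// bnd_simp -ltNge.
Qed.

Lemma bm_split M f a b c : bounded_meas M f -> a <= b -> b <= c ->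
  \int[leb]_(x in `[a, c]) f x =
  \int[leb]_(x in `[a, b]) f x + \int[leb]_(x in `[b, c]) f x.
Proof.
move=> bf ab bc; have fac := bm_integrable a c bf.
have := @Rintegral_itvB _ f (BLeft a) (BRight c) b fac.
rewrite !bnd_simp => /(_ ab bc) e.
rewrite -(@Rintegral_itv_obnd_cbnd _ b (BRight c)) -?e; first by rewrite addrC subrK.
by apply: integrableS fac => //; apply: subset_itv; rewrite !bnd_simp.
Qed.

(** The oriented integral from [0] to [y]: at most one of the two intervals is nondegenerate. *)
Definition prim f y := \int[leb]_(t in `[0, y]) f t - \int[leb]_(t in `[y, 0]) f t.

Lemma prim_sub M f x y : bounded_meas M f -> x <= y ->
  prim f y - prim f x = \int[leb]_(t in `[x, y]) f t.
Proof.
move=> bf xy; rewrite /prim.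
have [x0|x0] := leP 0 x.
  rewrite (bm_split bf x0 xy) !(int_itv_empty f x0).
  by rewrite (int_itv_empty f (le_trans x0 xy)); ring.
have [y0|y0] := leP 0 y.
  rewrite (bm_split bf (ltW x0) y0) (int_itv_empty f (ltW x0)) (int_itv_empty f y0).
  by ring.
rewrite (bm_split bf xy (ltW y0)) (int_itv_empty f (ltW x0)) (int_itv_empty f (ltW y0)).
by ring.
Qed.

Lemma bm_int_le M f x y : bounded_meas M f -> x <= y ->
  `|\int[leb]_(t in `[x, y]) f t| <= M * (y - x).
Proof.
move=> bf xy; have [mf fM] := bf.
apply: (le_trans (le_normr_Rintegral _ (bm_integrable x y bf))) => //.
have babs : bounded_meas M (fun t => `|f t|).
  by split; [exact: measurableT_comp|move=> t; rewrite normr_id].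
have bcst : bounded_meas `|M| (fun _ => M).
  by split; [exact: measurable_cst|].
apply: (@le_trans _ _ (\int[leb]_(t in `[x, y]) M)).
  by apply: le_Rintegral => //; [exact: bm_integrable babs|exact: bm_integrable bcst].
rewrite Rintegral_cst// le_eqVlt; apply/orP; left; apply/eqP; congr (_ * _).
rewrite -[RHS]/(fine (y - x)%:E); congr fine; apply: etrans (lebesgue_measure_itv _) _.
rewrite /= lte_fin; case: ltP => [_|yx]; first by rewrite -EFinD.
by congr EFin; apply/eqP; rewrite eq_sym subr_eq0 eq_le xy yx.
Qed.

Lemma prim_lipschitz M f x y : bounded_meas M f -> `|prim f y - prim f x| <= M * `|y - x|.
Proof.
move=> bf; wlog xy : x y / x <= y.
  move=> H; have [/H//|/ltW/H] := leP x y.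
  by rewrite distrC (distrC x).
by rewrite (prim_sub bf xy) (ger0_norm (_ : 0 <= y - x)) ?subr_ge0//; exact: bm_int_le.
Qed.

Lemma lipschitz_continuous f M : (forall x y, `|f y - f x| <= M * `|y - x|) -> continuous f.
Proof.
move=> H x; apply/cvgrPdist_le => e e0.
have M1 : 0 < `|M| + 1 by rewrite ltr_wpDl.
near=> y; rewrite distrC; apply: (le_trans (H _ _)).
apply: (@le_trans _ _ ((`|M| + 1) * `|y - x|)).
  by apply: ler_wpM2r => //; have := ler_norm M; lra.
rewrite mulrC -ler_pdivlMr//; near: y.
have d0 : 0 < e / (`|M| + 1) by rewrite divr_gt0.
by exists (e / (`|M| + 1)) => //= y /ltW; rewrite distrC.
Unshelve. all: by end_near. Qed.

Let prim_local M f c x y : bounded_meas M f -> c <= y ->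
  prim f y = \int[leb]_(t in `[c, y]) f t + prim f c.
Proof. by move=> bf cy; rewrite -(prim_sub bf cy) subrK. Qed.

Let prim_is_derive M f c x d : bounded_meas M f -> c < x ->
  is_derive x 1 (fun y => \int[leb]_(t in `[c, y]) f t) d -> is_derive x 1 (prim f) d.
Proof.
move=> bf cx h.
have h2 : is_derive x 1 (fun y => \int[leb]_(t in `[c, y]) f t + prim f c) d.
  by apply: is_derive_ext_val (dD h (dC (prim f c) x)) _; rewrite addr0.
apply: near_eq_is_derive h2; near=> y.
rewrite [RHS](@prim_local M f c x y bf)//.
by apply/ltW; near: y; exact: lt_nbhsr.
Unshelve. all: by end_near. Qed.

Lemma prim_derive_cont M f : bounded_meas M f -> continuous f ->
  forall x, is_derive x 1 (prim f) (f x).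
Proof.
move=> bf cf x; have x1 : x - 1 < x by lra.
exact: (prim_is_derive bf x1 (FTC_continuous cf x1)).
Qed.

(** Lebesgue differentiation on the half-lines starting at [- n], for all [n] at once; primitives
    with different base points differ by a constant. *)
Lemma prim_derive_ae M f : bounded_meas M f ->
  {ae leb, forall x, is_derive x 1 (prim f) (f x)}.
Proof.
move=> bf; have [mf fM] := bf.
have loc : locally_integrable [set: R] f.
  split => //; first exact: openT.
  move=> K _ cK; apply: (@le_lt_trans _ _ (\int[leb]_(x in K) cst M%:E x)%E).
    apply: ge0_le_integral => //=; first exact: compact_measurable.
    - by apply/measurable_EFinP; apply: measurableT_comp => //; exact: measurable_funTS.
    - by move=> x _; rewrite lee_fin; apply: le_trans (fM x).
  rewrite integral_cst//=; last exact: compact_measurable.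
  by rewrite lte_mul_pinfty// ?lee_fin ?(le_trans _ (fM 0))//; exact: compact_finite_measure.
have H n : {ae leb, forall x, - n%:R < x -> is_derive x 1 (prim f) (f x)}.
  have := @FTC1 R f (BLeft (- n%:R)) (fun y => bm_integrable _ _ bf) loc.
  apply: filterS; first exact: (ae_filter_ringOfSetsType leb).
  move=> x hx nx; have [dF F'] := hx nx.
  by apply: (prim_is_derive bf nx); apply: DeriveDef; [exact: dF|rewrite -derive1E; exact: F'].
have := ae_foralln H; apply: filterS => x Hx.
have [N HN] := nat_large (`|x| + 1).
apply: (Hx N); have := HN N (leqnn _); have := ler_norm (- x); rewrite normrN; lra.
Qed.

Definition shift_by a : measurableTypeR R -> measurableTypeR R := fun x => x + a.

Lemma measurable_shift a : measurable_fun setT (shift_by a).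
Proof. by apply: measurable_funD => //; exact: measurable_cst. Qed.

HB.instance Definition _ a :=
  isMeasurableFun.Build _ _ _ _ (shift_by a) (measurable_shift a).

(** Lebesgue measure is determined by its values on half-open intervals. *)
Lemma lebesgue_measure_shift a (A : set (measurableTypeR R)) : measurable A ->
  pushforward leb (shift_by a) A = leb A.
Proof.
move=> mA; apply/esym/lebesgue_measure_unique => //= _ [[u v]] _ <-.
rewrite /pushforward/=.
have -> : shift_by a @^-1` `]u, v] = `]u - a, v - a]%classic.
  by apply/seteqP; split => x /=; rewrite !in_itv/= ltrBlDr lerBrDr.
rewrite !lebesgue_measure_itv/= !lte_fin ltrD2r.
by case: ifP => // _; rewrite -!EFinD; congr EFin; ring.
Qed.

Lemma negligible_shift a (N : set R) : leb.-negligible N ->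
  leb.-negligible [set x | N (x + a)].
Proof.
move=> [A [mA A0 NA]].
exists (shift_by a @^-1` A); split; last by move=> x /NA.
  by have := measurable_shift a measurableT mA; rewrite setTI.
exact: etrans (lebesgue_measure_shift a mA) A0.
Qed.

Lemma negligible_opp (N : set R) : leb.-negligible N ->
  leb.-negligible [set x | N (- x)].
Proof.
move=> [A [mA A0 NA]].
exists (-%R @^-1` A); split; last by move=> x /NA.
  by rewrite -[X in measurable X]setTI; apply: oppr_measurable.
exact: etrans (lebesgue_measureN mA) A0.
Qed.

Lemma ae_reflect (P : R -> Prop) x : {ae leb, forall y, P y} -> {ae leb, forall y, P (x - y)}.
Proof.
move=> h; have h1 := negligible_opp (negligible_shift x h).
apply: negligibleS h1 => y /= ny; rewrite addrC; exact: ny.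
Qed.

(** The exceptional set is covered by countably many translates of its part in one period. *)
Lemma ae_periodic (P : R -> Prop) L : 0 < L -> (forall x, P (x + L) <-> P x) ->
  {ae leb, forall x, - (L / 2) <= x <= L / 2 -> P x} -> {ae leb, forall x, P x}.
Proof.
move=> L0 PL h.
have PnL (n : nat) x : P (x + n%:R * L) <-> P x.
  elim: n => [|n IH]; first by rewrite mul0r addr0.
  by rewrite -natr1 mulrDl mul1r addrA PL.
have Pz (n : int) x : P (x + n%:~R * L) <-> P x.
  case: n => n; first exact: PnL.
  by rewrite NegzE -{2}(subrK (n.+1%:R * L) x) PnL mulrNz mulNr.
have H1 (n : nat) := negligible_shift (n%:R * L) h.
have H2 (n : nat) := negligible_shift (- (n%:R * L)) h.
have H := negligibleU (negligible_bigcup H1) (negligible_bigcup H2).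
apply: negligibleS H => x /= nPx.
have [n n1 n2] := periodic_rep L0 x.
have nP : ~ (- (L / 2) <= x + n%:~R * L <= L / 2 -> P (x + n%:~R * L)).
  by move=> /(_ ltac:(by rewrite n1 ltW)); rewrite Pz.
case: n n1 n2 nP => [n|n] n1 n2 nP; [left|right].
  by exists n.
by exists n.+1 => //=; move: nP; rewrite NegzE mulrNz mulNr.
Qed.

(** Increments of the primitive over an interval and over its translate agree; the zero integral
    over one period fixes the remaining constant. *)
Lemma prim_periodic M f L : 0 < L -> bounded_meas M f -> periodic f L ->
  \int[leb]_(t in `[- (L / 2), L / 2]) f t = 0 -> periodic (prim f) L.
Proof.
move=> L0 bf pf I0.
have shift x y : x <= y -> prim f (y + L) - prim f (x + L) = prim f y - prim f x.
  move=> xy; have xyL : x + L <= y + L by rewrite lerD2r.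
  rewrite (prim_sub bf xy) (prim_sub bf xyL).
  have [mf _] := bf.
  rewrite /Rintegral; congr fine.
  have pre : shift_by L @^-1` `[x + L, y + L] = `[x, y]%classic.
    by apply/seteqP; split => t /=; rewrite !in_itv/= !lerD2r.
  transitivity (\int[pushforward leb (shift_by L)]_(t in [set` `[(x + L)%R, (y + L)%R]]) (f t)%:E)%E.
    by apply: eq_measure_integral => A mA _; exact/esym/lebesgue_measure_shift.
  rewrite (integral_pushforward (measurable_shift L))//=.
  - rewrite pre; apply: eq_integral => t _ /=; by rewrite pf.
  - exact/measurable_EFinP.
  - rewrite pre; apply: eq_integrable (bm_integrable x y bf) => // t _ /=.
    by rewrite pf.
have e : prim f (L / 2) = prim f (- (L / 2)).
  have LL : - (L / 2) <= L / 2 by lra.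
  by apply/eqP; rewrite -subr_eq0 (prim_sub bf LL) I0.
have e2 : - (L / 2) + L = L / 2 by lra.
move=> x; have [h|h] := leP (- (L / 2)) x.
  have := shift _ _ h; rewrite e2 e => /eqP.
  by rewrite subr_eq => /eqP ->; rewrite subrK.
have := shift _ _ (ltW h); rewrite e2 e => /eqP.
by move=> /eqP H; lra.
Qed.

End bounded_measurable.

Section real_dominated_convergence.
Set Implicit Arguments.
Unset Strict Implicit.
Context d (T : measurableType d) (R : realType) (mu : {measure set T -> \bar R}).
Variables (D : set T) (mD : measurable D).
Variables (f_ : nat -> T -> R) (f g : T -> R).
Hypothesis mf_ : forall n, measurable_fun D (f_ n).
Hypothesis mf : measurable_fun D f.
Hypothesis cvg_f : {ae mu, forall x, D x -> f_ n x @[n --> \oo] --> f x}.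
Hypothesis ig : mu.-integrable D (EFin \o g).
Hypothesis dom : {ae mu, forall x n, D x -> `|f_ n x| <= g x}.

Lemma Rintegral_dominated_convergence :
  (\int[mu]_(x in D) f_ n x) @[n --> \oo] --> \int[mu]_(x in D) f x.
Proof.
have [|||||i _ c] := @dominated_convergence _ _ _ mu D mD (fun n => EFin \o f_ n) (EFin \o f) (EFin \o g).
- by move=> n; exact/measurable_EFinP.
- exact/measurable_EFinP.
- move: cvg_f; apply: filterS.
  by move=> x h Dx; apply: cvg_EFin; [near=> n|exact: h].
- exact: ig.
- move: dom; apply: filterS.
  by move=> x h n Dx /=; rewrite lee_fin; exact: h.
apply: fine_cvg; rewrite fineK; last exact: integrable_fin_num.
exact: c.
Unshelve. all: by end_near. Qed.

End real_dominated_convergence.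

Section difference_quotients.
Set Implicit Arguments.
Unset Strict Implicit.
Context {R : realType}.
Implicit Types (F : R -> R) (x y z l C : R) (u : nat -> R).

(** Derivatives are expressed along sequences in order to use dominated convergence. *)
Lemma is_derive_seq F x l u : is_derive x 1 F l -> (forall n, u n != 0) ->
  u n @[n --> \oo] --> 0 -> ((F (x + u n) - F x) / u n) @[n --> \oo] --> l.
Proof.
move=> [dF <-] u0 ucvg.
have h : (fun h => h^-1 *: (F (h *: 1 + x) - F x)) @ 0^' --> 'D_1 F x by exact: dF.
move/cvgr_dnbhsP : h => /(_ u (conj u0 ucvg)).
under eq_fun do rewrite /GRing.scale/= mulr1 mulrC (addrC _ x).
by [].
Qed.

Lemma seq_is_derive F x l :
  (forall u, (forall n, u n != 0) -> u n @[n --> \oo] --> 0 ->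
     ((F (x + u n) - F x) / u n) @[n --> \oo] --> l) -> is_derive x 1 F l.
Proof.
move=> H.
have h : (fun h => h^-1 *: (F (h *: 1 + x) - F x)) @ 0^' --> l.
  apply/cvgr_dnbhsP => u [u0 ucvg].
  have := H u u0 ucvg; apply: cvg_trans; apply: near_eq_cvg; near=> n.
  by rewrite /GRing.scale/= mulr1 mulrC (addrC _ x).
apply: DeriveDef; first by apply/cvg_ex; exists l.
by apply/cvg_lim => //; exact: Rhausdorff.
Unshelve. all: by end_near. Qed.

Lemma harmonic_neq0 n : (n.+1%:R^-1 : R) != 0.
Proof. by rewrite invr_eq0 pnatr_eq0. Qed.

Lemma derive_lipschitz F (F' : R -> R) C x y : (forall z, is_derive z 1 F (F' z)) ->
  (forall z, `|F' z| <= C) -> `|F y - F x| <= C * `|y - x|.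
Proof.
move=> dF F'C; wlog xy : x y / x <= y.
  move=> H; have [/H//|/ltW/H] := leP x y.
  by rewrite distrC (distrC x).
rewrite (ger0_norm (_ : 0 <= y - x)) ?subr_ge0//.
have dl z : is_derive z 1 (fun t => C * t) C by der; ring.
have dl2 z : is_derive z 1 (fun t => (- C) * t) (- C) by der; ring.
have h1 := @derive_le_segment _ F F' (fun=> C) (fun t => C * t) x y xy (fun z _ => dF z) (fun z _ => dl z).
have h2 := @derive_le_segment _ (fun t => (- C) * t) (fun=> - C) F' F x y xy (fun z _ => dl2 z) (fun z _ => dF z).
rewrite ler_norml; apply/andP; split.
  suff : - C * y - - C * x <= F y - F x by lra.
  apply: h2 => z _; have := F'C z; rewrite ler_norml => /andP[h _]; exact: h.
suff : F y - F x <= C * y - C * x by lra.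
by apply: h1 => z _; have := F'C z; rewrite ler_norml => /andP[_].
Qed.

End difference_quotients.

#[global] Instance filter_ae_lebesgue {R : realType} :
  Filter (almost_everywhere (@lebesgue_measure R)) := ae_filter_ringOfSetsType _.

Lemma ae_leb_and {R : realType} (P Q : R -> Prop) :
  {ae (@lebesgue_measure R), forall x, P x} -> {ae (@lebesgue_measure R), forall x, Q x} ->
  {ae (@lebesgue_measure R), forall x, P x /\ Q x}.
Proof. exact: filterI. Qed.

(** * Functions with a bounded weak derivative *)

Section weak_derivative.
Set Implicit Arguments.
Unset Strict Implicit.
Context {R : realType}.
Variable L : R.
Hypothesis L0 : 0 < L.
Notation leb := (@lebesgue_measure R).
Local Notation I f := (\int[leb]_(x in torus_itv L) f x).
Implicit Types (f g phi : R -> R) (x b c M : R).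

Lemma bm_int M f : bounded_meas M f -> leb.-integrable (torus_itv L) (EFin \o f).
Proof. exact: bm_integrable. Qed.

Lemma continuous_meas f : continuous f -> measurable_fun (setT : set (measurableTypeR R)) f.
Proof. exact: continuous_measurable_fun. Qed.

Lemma bmM M N f g : bounded_meas M f -> bounded_meas N g ->
  bounded_meas (M * N) (fun x => f x * g x).
Proof.
move=> [mf fM] [mg gN]; split; first exact: measurable_funM.
by move=> x; rewrite normrM; apply: ler_pM.
Qed.

Lemma ae_neq (a : R) : {ae leb, forall x, x != a}.
Proof.
exists [set a]; split; [exact: measurable_set1|exact: lebesgue_measure_set1|].
by move=> x /= /negP; rewrite negbK => /eqP.
Qed.

(** A smooth periodic function minus its mean is the derivative of a smooth periodic function, and
    [f] is orthogonal to constants. So [f] is orthogonal to every [smooth_step], and these converge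
    almost everywhere in the period to the indicator of [[- (L / 2), b]]. *)
Lemma weak_derivative0_prefix M f b : bounded_meas M f -> I f = 0 ->
  (forall phi, smooth_on_torus L phi -> I (fun x => f x * derive1 phi x) = 0) ->
  - (L / 2) < b < L / 2 -> \int[leb]_(x in `[- (L / 2), b]) f x = 0.
Proof.
move=> bf If H bU; have [mf fM] := bf; have [b1 b2] := andP bU.
pose psi n := smooth_step L b n.
have cpsi n : continuous (psi n).
  by move=> x; exact: is_derive_continuous (Cn_is_derive (smooth_step_Cn L b n 1) x).
have psi01 n x : `|psi n x| <= 1 by rewrite ger0_norm ?logistic_ge0 ?logistic_le1.
have bpsi n : bounded_meas 1 (psi n) by split; [exact: continuous_meas|].
have bfpsi n := bmM bf (bpsi n).
have Ifpsi n : I (fun x => f x * psi n x) = 0.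
  pose m := I (psi n) / L.
  pose h x := psi n x - m.
  have ch : continuous h by have cp := cpsi n; rewrite /h; cts.
  have bh : bounded_meas (1 + `|m|) h.
    split; first exact: continuous_meas.
    by move=> x; apply: (le_trans (ler_normB _ _)); rewrite lerD2r.
  have ph : periodic h L by move=> x; rewrite /h /psi smooth_step_periodic.
  have Ih : \int[leb]_(t in `[- (L / 2), L / 2]) h t = 0.
    rewrite -[LHS]/(I (fun x => psi n x - m)) cintB//; last exact: cC.
    by rewrite cint_cst// /m mulfVK ?gt_eqF// subrr.
  have dphi := prim_derive_cont bh ch.
  have sphi : smooth_on_torus L (prim h).
    split; first exact: prim_periodic bh ph Ih.
    apply: Cn_derivable => -[//|k]; apply: (CnS dphi).
    by apply: CnD; [exact: smooth_step_Cn|exact: Cn_cst].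
  have := H _ sphi.
  have -> : I (fun x => f x * derive1 (prim h) x) = I (fun x => f x * psi n x - f x * m).
    apply: eq_Rintegral => x _; rewrite derive1E.
    by case: (dphi x) => _ ->; rewrite /h mulrBr.
  have bm' : bounded_meas `|m| (fun _ : R => m) by split; [exact: measurable_cst|].
  rewrite RintegralB//; [|exact: bm_int (bfpsi n)|exact: bm_int (bmM bf bm')].
  by rewrite RintegralZr//; [rewrite If mul0r subr0|exact: bm_int bf].
have split2 n : I (fun x => f x * psi n x) =
   \int[leb]_(x in `[- (L / 2), b]) (f x * psi n x) + \int[leb]_(x in `[b, L / 2]) (f x * psi n x).
  by apply: (bm_split (bfpsi n)); exact: ltW.
have bM : bounded_meas `|M| (fun _ : R => M) by split; [exact: measurable_cst|].
have domi n x : `|f x * psi n x| <= M.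
  by rewrite normrM -[M]mulr1; apply: ler_pM.
have c1 : (\int[leb]_(x in `[- (L / 2), b]) (f x * psi n x)) @[n --> \oo] --> \int[leb]_(x in `[- (L / 2), b]) f x.
  apply: (@Rintegral_dominated_convergence _ _ _ leb _ _ _ _ (fun=> M)) => //.
  - by move=> n; apply: measurable_funTS; case: (bfpsi n).
  - exact: measurable_funTS.
  - have := ae_leb_and (ae_neq (- (L / 2))) (ae_neq b); apply: filterS => x [n1 n2].
    rewrite /= in_itv/= => /andP[x1 x2].
    have h : - (L / 2) < x < b by rewrite !lt_neqAle x1 x2 n2 eq_sym n1.
    have : f x * psi n x @[n --> \oo] --> f x * 1.
      by apply: cvgMr; exact: (smooth_step_cvg1 L0 bU h).
    by rewrite mulr1.
  - exact: (bm_integrable _ _ bM).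
  - by apply: nearW.
have c2 : (\int[leb]_(x in `[b, L / 2]) (f x * psi n x)) @[n --> \oo] --> \int[leb]_(x in `[b, L / 2]) (0 : R).
  apply: (@Rintegral_dominated_convergence _ _ _ leb _ _ _ _ (fun=> M)) => //.
  - by move=> n; apply: measurable_funTS; case: (bfpsi n).
  - have := ae_leb_and (ae_neq (L / 2)) (ae_neq b); apply: filterS => x [n1 n2].
    rewrite /= in_itv/= => /andP[x1 x2].
    rewrite -(mulr0 (f x)); apply: cvgMr; apply: smooth_step_cvg0 => //.
    by rewrite !lt_neqAle x1 x2 n1 eq_sym n2.
  - exact: (bm_integrable _ _ bM).
  - by apply: nearW.
have c3 := cvgD c1 c2.
have e : (fun n => \int[leb]_(x in `[- (L / 2), b]) (f x * psi n x) + \int[leb]_(x in `[b, L / 2]) (f x * psi n x)) = (fun=> 0).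
  by apply/funext => n; rewrite -split2.
have c4 : (fun=> 0 : R) @ \oo --> \int[leb]_(x in `[- (L / 2), b]) f x + \int[leb]_(x in `[b, L / 2]) (0 : R).
  by rewrite -e; exact: c3.
have := cvg_lim (@Rhausdorff R) c4; rewrite lim_cst; last exact: Rhausdorff.
by rewrite (Rintegral_cst leb _ 0)// mul0r addr0 => ->.
Qed.

(** The primitive of [f] is constant inside the period, while almost everywhere its derivative is
    [f]. *)
Lemma weak_derivative0 M f : bounded_meas M f -> I f = 0 ->
  (forall phi, smooth_on_torus L phi -> I (fun x => f x * derive1 phi x) = 0) ->
  {ae leb, forall x, - (L / 2) <= x <= L / 2 -> f x = 0}.
Proof.
move=> bf If H.
have P := weak_derivative0_prefix bf If H.
have := ae_leb_and (prim_derive_ae bf) (ae_leb_and (ae_neq (- (L / 2))) (ae_neq (L / 2))).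
apply: filterS => x [d1 [n1 n2]] /andP[x1 x2].
have x1' : - (L / 2) < x by rewrite lt_neqAle eq_sym n1.
have x2' : x < L / 2 by rewrite lt_neqAle n2.
have d2 : is_derive x 1 (prim f) 0.
  have dc : is_derive x 1 (fun _ : R => prim f (- (L / 2))) 0 by exact: dC.
  apply: near_eq_is_derive dc; near=> y; apply/eqP; rewrite eq_sym -subr_eq0.
  have y1 : - (L / 2) < y by near: y; exact: lt_nbhsr.
  have y2 : y < L / 2 by near: y; exact: lt_nbhsl.
  by rewrite (prim_sub bf (ltW y1)) P// y1.
by case: d1 => _ <-; case: d2.
Unshelve. all: by end_near. Qed.

Lemma int_shift g h : continuous g -> periodic g L -> I (fun x => g (x + h)) = I g.
Proof.
move=> cg pg; have [C C0 gC] := periodic_bounded L0 pg cg.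
have bg : bounded_meas C g by split; [exact: continuous_meas|].
have L0' := L0; have LL : - (L / 2) <= L / 2 by lra.
have dF x : is_derive x 1 (fun y => prim g (y + h)) (g (x + h)).
  have d1 : is_derive x 1 (fun y => y + h) 1 by der; ring.
  have := @dcomp _ (prim g) (fun y => y + h) x _ _ (prim_derive_cont bg cg (x + h)) d1.
  by rewrite mulr1.
have cgh : continuous (fun x => g (x + h)).
  by apply: (@ccomp _ g (fun x => x + h)) => //; cts.
rewrite /torus_itv (int_derive LL dF cgh).
have LLh : - (L / 2) + h <= L / 2 + h by rewrite lerD2r.
rewrite (prim_sub bg LLh).
have -> : L / 2 + h = (- (L / 2) + h) + L by lra.
rewrite (int_periodic_shift (- (L / 2) + h) (- (L / 2)) L0 pg cg).
by have -> : - (L / 2) + L = L / 2 by lra.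
Qed.

(** Summation by parts for the translation by [u n] is exact, by invariance of the integral over a
    period. The difference quotients of [phi] and of the Lipschitz primitive are bounded and
    converge, the latter almost everywhere. *)
Lemma prim_by_parts M f phi (phi' : R -> R) : bounded_meas M f -> periodic f L -> I f = 0 ->
  periodic phi L -> (forall x, is_derive x 1 phi (phi' x)) -> continuous phi' ->
  periodic phi' L ->
  I (fun x => prim f x * phi' x) = - I (fun x => f x * phi x).
Proof.
move=> bf pf If pphi dphi cphi' pphi'.
pose K := prim f.
have KM x y := prim_lipschitz x y bf.
have cK : continuous K := lipschitz_continuous KM.
have pK : periodic K L by exact: prim_periodic bf pf If.
have cphi : continuous phi := deriv_continuous dphi.
have [C C0 phi'C] := periodic_bounded L0 pphi' cphi'.
have [C1 C10 phiC] := periodic_bounded L0 pphi cphi.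
have [C2 C20 KC] := periodic_bounded L0 pK cK.
have phiL x y := derive_lipschitz x y dphi phi'C.
pose u n : R := n.+1%:R^-1.
have u0 n : u n != 0 := harmonic_neq0 n.
have un0 n : 0 < `|u n| by rewrite normr_gt0.
have ucvg : u n @[n --> \oo] --> 0 by exact: cvg_harmonic.
have bK : bounded_meas C2 K by split; [exact: continuous_meas|].
have bphi : bounded_meas C1 phi by split; [exact: continuous_meas|].
have bphi' : bounded_meas C phi' by split; [exact: continuous_meas|].
have csh (g : R -> R) h : continuous g -> continuous (fun x => g (x + h)).
  by move=> cg; apply: (@ccomp _ g (fun x => x + h)) => //; cts.
have cq n : continuous (fun x => (phi (x + u n) - phi x) / u n).
  by have c := csh _ (u n) cphi; cts => x; exact: u0.
have cq2 n : continuous (fun x => (K (x + - u n) - K x) / - u n).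
  by have c := csh _ (- u n) cK; cts => x; rewrite oppr_eq0; exact: u0.
have bq n : bounded_meas C (fun x => (phi (x + u n) - phi x) / u n).
  split; first exact: continuous_meas.
  move=> x; rewrite normrM normfV ler_pdivrMr//.
  by have := phiL x (x + u n); rewrite [x + _]addrC addrK.
have bq2 n : bounded_meas M (fun x => (K (x + - u n) - K x) / - u n).
  split; first exact: continuous_meas.
  move=> x; rewrite normrM normfV normrN ler_pdivrMr//.
  by have := KM x (x + - u n); rewrite [x + _]addrC addrK normrN.
have bc (c : R) : bounded_meas `|c| (fun _ : R => c) by split; [exact: measurable_cst|].
have c1 : I (fun x => K x * ((phi (x + u n) - phi x) / u n)) @[n --> \oo] --> I (fun x => K x * phi' x).
  apply: (@Rintegral_dominated_convergence _ _ _ leb _ _ _ _ (fun=> C2 * C)) => //.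
  - by move=> n; apply: measurable_funTS; case: (bmM bK (bq n)).
  - by apply: measurable_funTS; case: (bmM bK bphi').
  - by apply: nearW => x _; apply: cvgMr; exact: is_derive_seq.
  - exact: (bm_integrable _ _ (bc _)).
  - by apply: nearW => x n _; case: (bmM bK (bq n)).
have mf : measurable_fun (setT : set (measurableTypeR R)) f by case: bf.
have c2 : I (fun x => ((K (x + - u n) - K x) / - u n) * phi x) @[n --> \oo] --> I (fun x => f x * phi x).
  apply: (@Rintegral_dominated_convergence _ _ _ leb _ _ _ _ (fun=> M * C1)) => //.
  - by move=> n; apply: measurable_funTS; case: (bmM (bq2 n) bphi).
  - by apply: measurable_funTS; case: (bmM bf bphi).
  - have := prim_derive_ae bf; apply: filterS => x dx _; apply: cvgMl.
    apply: is_derive_seq => //; first by move=> n; rewrite oppr_eq0; exact: u0.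
    by rewrite -oppr0; exact: cvgN.
  - exact: (bm_integrable _ _ (bc _)).
  - by apply: nearW => x n _; case: (bmM (bq2 n) bphi).
have e n : I (fun x => ((K (x + - u n) - K x) / - u n) * phi x) = - I (fun x => K x * ((phi (x + u n) - phi x) / u n)).
  have ck := csh _ (- u n) cK; have cp := csh _ (u n) cphi.
  have ca : continuous (fun x => K (x + - u n) * phi x) by cts.
  have cb : continuous (fun x => K x * phi x) by cts.
  have cc : continuous (fun x => K x * phi (x + u n)) by cts.
  have s : I (fun x => K x * phi (x + u n)) = I (fun x => K (x + - u n) * phi x).
    rewrite -(int_shift (u n) ca); last by move=> x /=; rewrite addrAC pK pphi.
    by apply: eq_Rintegral => x _; rewrite addrK.
  transitivity ((- (u n)^-1) * (I (fun x => K (x + - u n) * phi x) - I (fun x => K x * phi x))).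
    rewrite -cintB// -cintZ; last by cts.
    by apply: eq_Rintegral => x _; field; exact: u0.
  rewrite mulNr; congr (- _).
  rewrite -s -cintB// -cintZ; last by cts.
  by apply: eq_Rintegral => x _; field; exact: u0.
have c3 : - I (fun x => K x * ((phi (x + u n) - phi x) / u n)) @[n --> \oo] --> I (fun x => f x * phi x).
  by under eq_fun do rewrite -e.
have c4 : - I (fun x => K x * ((phi (x + u n) - phi x) / u n)) @[n --> \oo] --> - I (fun x => K x * phi' x).
  by apply: cvgN; exact: c1.
have := cvg_unique _ c3 c4.
by move=> -> //; rewrite opprK.
Qed.

(** Testing with the constant [1] shows that [f2] has mean zero, so its primitive is periodic. With
    [c] the difference of the means, [f1 - prim f2 - c] has mean zero and zero weak derivative. *)
Lemma weak_derivative_prim M1 M2 f1 f2 :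
  bounded_meas M1 f1 -> bounded_meas M2 f2 -> periodic f1 L -> periodic f2 L ->
  (forall phi, smooth_on_torus L phi ->
     I (fun x => f1 x * derive1 phi x) = - I (fun x => f2 x * phi x)) ->
  periodic (prim f2) L /\ exists c, {ae leb, forall x, f1 x = prim f2 x + c}.
Proof.
move=> bf1 bf2 pf1 pf2 H.
have s1 : smooth_on_torus L (fun=> 1).
  by split => //; apply: Cn_derivable => n; exact: Cn_cst.
have If2 : I f2 = 0.
  have := H _ s1.
  have -> : I (fun x => f1 x * derive1 (fun _ : R => 1 : R) x) = 0.
    transitivity (I (fun _ : R => 0)); last by rewrite cint_cst// mul0r.
    by apply: eq_Rintegral => x _; rewrite derive1E; case: (dC (1 : R) x) => _ ->; rewrite mulr0.
  rewrite (_ : (fun x => f2 x * 1) = f2); last by apply/funext => x; rewrite mulr1.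
  by move=> /eqP; rewrite eq_sym oppr_eq0 => /eqP.
pose K := prim f2.
have KM x y := prim_lipschitz x y bf2.
have cK : continuous K := lipschitz_continuous KM.
have pK : periodic K L by exact: prim_periodic bf2 pf2 If2.
split => //.
have [C C0 KC] := periodic_bounded L0 pK cK.
have bK : bounded_meas C K by split; [exact: continuous_meas|].
pose c := (I f1 - I K) / L; exists c.
pose f x := f1 x - K x - c.
have bc : bounded_meas `|c| (fun _ : R => c) by split; [exact: measurable_cst|].
have bf1K : bounded_meas (M1 + C) (fun x => f1 x - K x).
  split; first by apply: measurable_funB; [case: bf1|case: bK].
  move=> x; apply: (le_trans (ler_normB _ _)).
  by apply: lerD; [case: bf1|].
have bf : bounded_meas (M1 + C + `|c|) f.
  split; first by apply: measurable_funB; [case: bf1K|exact: measurable_cst].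
  move=> x; apply: (le_trans (ler_normB _ _)).
  by apply: lerD; [case: bf1K|].
have If : I f = 0.
  rewrite RintegralB//; [|exact: bm_int bf1K|exact: bm_int bc].
  rewrite RintegralB//; [|exact: bm_int bf1|exact: bm_int bK].
  by rewrite cint_cst// /c mulfVK ?gt_eqF// subrr.
have Hf phi : smooth_on_torus L phi -> I (fun x => f x * derive1 phi x) = 0.
  move=> sphi; have [pphi dphi] := sphi.
  have d0 x : is_derive x 1 phi (derive1 phi x).
    by apply: DeriveDef; [exact: (dphi 0%N)|rewrite derive1E].
  have d1 x : is_derive x 1 (derive1 phi) (derive1 (derive1 phi) x).
    by apply: DeriveDef; [exact: (dphi 1%N)|rewrite derive1E].
  have cd1 : continuous (derive1 phi) := deriv_continuous d1.
  have pd1 : periodic (derive1 phi) L.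
    move=> x; have d3 : is_derive x 1 (fun y => y + L) 1 by der; ring.
    have := @dcomp _ phi (fun y => y + L) x _ _ (d0 (x + L)) d3.
    rewrite mulr1 (_ : (fun y => phi (y + L)) = phi); last by apply/funext => y; exact: pphi.
    by move=> [_ <-]; rewrite derive1E.
  have [N N0 dN] := periodic_bounded L0 pd1 cd1.
  have bd1 : bounded_meas N (derive1 phi) by split; [exact: continuous_meas|].
  have E1 : I (fun x => f x * derive1 phi x) = I (fun x => f1 x * derive1 phi x) - I (fun x => K x * derive1 phi x) - I (fun x => c * derive1 phi x).
    rewrite -RintegralB//; [|exact: bm_int (bmM bf1 bd1)|exact: bm_int (bmM bK bd1)].
    rewrite -RintegralB//; [|by have h := bmM bf1K bd1; apply: eq_integrable (bm_int h) => // x _ /=; rewrite mulrBl|exact: bm_int (bmM bc bd1)].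
    by apply: eq_Rintegral => x _; rewrite /f; ring.
  rewrite E1 H// (prim_by_parts bf2 pf2 If2 pphi d0 cd1 pd1) opprK addNr sub0r.
  by rewrite cintZ// (cint_derive L0 pphi d0 cd1) mulr0 oppr0.
have ae0 := weak_derivative0 bf If Hf.
have fP x : f (x + L) = 0 <-> f x = 0 by rewrite /f pf1 pK.
have := ae_periodic L0 fP ae0; apply: filterS => x; rewrite /f => /eqP.
by rewrite subr_eq0 => /eqP <-; rewrite addrC subrK.
Qed.

End weak_derivative.

Section Linfty.
Set Implicit Arguments.
Unset Strict Implicit.
Context d (T : measurableType d) (R : realType) (mu : {measure set T -> \bar R}).
Implicit Types f : T -> R.

Lemma Lfun_measurable p f : f \in Lfun mu p -> measurable_fun setT f.
Proof. by move=> /sub_Lfun_mfun; rewrite inE. Qed.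

Lemma Lfun_norm_lty p f : f \in Lfun mu p -> ('N[mu]_p [EFin \o f] < +oo)%E.
Proof. by move=> /sub_Lfun_finLfun; rewrite inE. Qed.

Lemma LfunI p f : measurable_fun setT f -> ('N[mu]_p [EFin \o f] < +oo)%E -> f \in Lfun mu p.
Proof. by move=> mf nf; apply/andP; split; rewrite inE. Qed.

Lemma Lnorm_oo f : (0 < mu setT)%E -> ('N[mu]_+oo [EFin \o f])%E = ess_sup mu (fun x => `|f x|%:E).
Proof. by move=> mu0; rewrite unlock mu0. Qed.

Lemma Linfty_bound f : (0 < mu setT)%E -> f \in Lfun mu +oo ->
  0 <= fine ('N[mu]_+oo [EFin \o f])%E /\
  {ae mu, forall x, `|f x| <= fine ('N[mu]_+oo [EFin \o f])%E}.
Proof.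
move=> mu0 /Lfun_norm_lty; have := Lnorm_ge0 mu +oo (EFin \o f).
rewrite Lnorm_oo// => n0 noo; split; first exact: fine_ge0.
have h := ess_sup_ge mu (fun x => `|f x|%:E).
have fin : ess_sup mu (fun x => `|f x|%:E) \is a fin_num by rewrite ge0_fin_numE.
by move: h; apply: filterS => x; rewrite -{1}(fineK fin) lee_fin.
Qed.

Lemma Linfty_intro f C : (0 < mu setT)%E -> measurable_fun setT f ->
  {ae mu, forall x, `|f x| <= C} -> f \in Lfun mu +oo.
Proof.
move=> mu0 mf fC; apply: LfunI => //; rewrite Lnorm_oo//.
apply: (@le_lt_trans _ _ C%:E); last exact: ltry.
by apply/ess_supP; move: fC; apply: filterS => x; rewrite lee_fin.
Qed.

End Linfty.

Section torus_kernel.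
Set Implicit Arguments.
Unset Strict Implicit.
Context {R : realType}.
Variable L : R.
Hypothesis L0 : 0 < L.
Notation leb := (@lebesgue_measure R).
Implicit Types (f K k : R -> R) (x y M c : R).
Local Notation I f := (\int[leb]_(x in torus_itv L) f x).

Lemma torus_setT : torus L setT = L%:E.
Proof.
rewrite /torus /mfrestr /mrestr setTI [LHS]lebesgue_measure_itv/= lte_fin.
have L0' := L0.
by rewrite ifT -?EFinD; [congr (_%:E); lra|lra].
Qed.

Lemma torus_ae (P : R -> Prop) : {ae torus L, forall x, P x} ->
  {ae leb, forall x, - (L / 2) <= x <= L / 2 -> P x}.
Proof.
move=> [N [mN N0 h]]; exists (N `&` torus_itv L); split => //.
  by apply: measurableI.
move=> x /= nP; have /not_implyP[xU nPx] := nP.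
by split; [exact: h|rewrite /torus_itv/= in_itv].
Qed.

Lemma ae_torus (P : R -> Prop) : {ae leb, forall x, P x} -> {ae torus L, forall x, P x}.
Proof.
move=> [N [mN N0 h]]; exists N; split => //.
by apply: (@subset_measure0 _ _ _ _ (N `&` torus_itv L) N); rewrite //; apply: measurableI.
Qed.

(** Turns a bound valid almost everywhere into one valid everywhere; by [cut_ae] only a null set is
    affected. *)
Definition cut M f x := if `|f x| <= M then f x else 0.

Lemma cut_bounded M f : 0 <= M -> measurable_fun (setT : set (measurableTypeR R)) f ->
  bounded_meas M (cut M f).
Proof.
move=> M0 mf; split; last by move=> x; rewrite /cut; case: ifP => //; rewrite normr0.
apply: measurable_fun_ifT => //.
by apply: measurable_fun_ler; [exact: measurableT_comp|exact: measurable_cst].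
Qed.

Lemma cut_periodic M f : periodic f L -> periodic (cut M f) L.
Proof. by move=> pf x; rewrite /cut pf. Qed.

Lemma cut_ae M f : periodic f L -> {ae torus L, forall x, `|f x| <= M} ->
  {ae leb, forall x, cut M f x = f x}.
Proof.
move=> pf h; apply: (ae_periodic L0); first by move=> x; rewrite (cut_periodic M pf) pf.
by move: (torus_ae h); apply: filterS => x hx xU; rewrite /cut hx.
Qed.

Lemma I_ae f g : measurable_fun (setT : set (measurableTypeR R)) f ->
  measurable_fun (setT : set (measurableTypeR R)) g ->
  {ae leb, forall x, f x = g x} -> I f = I g.
Proof.
move=> mf mg h; rewrite /Rintegral; congr fine.
apply: ae_eq_integral => //.
- exact/measurable_EFinP/measurable_funTS.
- exact/measurable_EFinP/measurable_funTS.
- by move: h; apply: filterS => x /= -> .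
Qed.

(** The second weak derivative, cut to a bounded function, has a Lipschitz primitive, from which
    [D'] differs by a constant almost everywhere. Testing the first weak derivative with the
    constant [1] gives the zero mean. *)
Lemma sobolev_kernel (D : R -> R) (dD : nat -> R -> R) : sobolev_derivs L 2 +oo%E D dD ->
  let M := fine ('N[torus L]_+oo [EFin \o dD 2%N])%E in
  exists K k, 0 <= M /\ [/\ periodic K L, (forall x y, `|K y - K x| <= M * `|y - x|),
    bounded_meas M k, {ae leb, forall x, is_derive x 1 K (k x)} & I K = 0 /\
    {ae leb, forall x, dD 1%N x = K x}].
Proof.
move=> [D0 pd wd] M.
have T0 : (0 < torus L setT)%E by rewrite torus_setT lte_fin.
have [p0 l0] := pd 0%N isT; have [p1 l1] := pd 1%N isT; have [p2 l2] := pd 2%N isT.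
have [n1 h1] := Linfty_bound T0 l1; have [M0 h2] := Linfty_bound T0 l2.
rewrite -/M in M0 h2; set M1 := fine _ in n1 h1.
have m0 := Lfun_measurable l0; have m1 := Lfun_measurable l1; have m2 := Lfun_measurable l2.
have b1 := cut_bounded n1 m1; have b2 := cut_bounded M0 m2.
have e1 := cut_ae p1 h1; have e2 := cut_ae p2 h2.
have mcts (phi : R -> R) : (forall x, derivable phi x 1) -> measurable_fun (setT : set (measurableTypeR R)) phi.
  move=> d; apply: continuous_meas => x; exact/differentiable_continuous/derivable1_diffP.
have wd1 (phi : R -> R) : smooth_on_torus L phi ->
     I (fun x => cut M1 (dD 1%N) x * derive1 phi x) = - I (fun x => cut M (dD 2%N) x * phi x).
  move=> sphi; have [_ dphi] := sphi; have := wd 1%N isT phi sphi.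
  have mp := mcts _ (dphi 0%N); have mp' := mcts _ (dphi 1%N); rewrite /= in mp mp'.
  rewrite !torus_RintegralE; [|exact: measurable_funM|exact: measurable_funM].
  move=> e; rewrite (@I_ae _ (fun x => dD 1%N x * derive1 phi x)); first last.
  - by move: e1; apply: filterS => x ->.
  - exact: measurable_funM.
  - by apply: measurable_funM => //; case: b1.
  rewrite e; congr (- _); apply: I_ae.
  - exact: measurable_funM.
  - by apply: measurable_funM => //; case: b2.
  - by move: e2; apply: filterS => x ->.
have [pK [c hc]] := weak_derivative_prim L0 b1 b2 (cut_periodic _ p1) (cut_periodic _ p2) wd1.
pose K x := prim (cut M (dD 2%N)) x + c.
have KL x y : `|K y - K x| <= M * `|y - x|.
  rewrite /K (_ : _ - _ = prim (cut M (dD 2%N)) y - prim (cut M (dD 2%N)) x); last by ring.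
  exact: prim_lipschitz.
have eK : {ae leb, forall x, dD 1%N x = K x}.
  by move: (ae_leb_and e1 hc); apply: filterS => x [<- ->].
exists K, (cut M (dD 2%N)); split => //; split => //.
- by move=> x; rewrite /K pK.
- by move: (prim_derive_ae b2); apply: filterS => x d; rewrite /K; der; ring.
- split => //.
  have s1 : smooth_on_torus L (fun=> 1 : R).
    by split => //; apply: Cn_derivable => n; exact: Cn_cst.
  have := wd 0%N isT _ s1.
  have d1 x : derive1 (fun=> 1 : R) x = 0 by rewrite derive1_cst.
  under [X in X = _ -> _]eq_Rintegral do rewrite d1 mulr0.
  under [X in _ = - X -> _]eq_Rintegral do rewrite mulr1.
  rewrite Rintegral_cst// mul0r torus_RintegralE// => /esym/eqP; rewrite oppr_eq0 => /eqP <-.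
  apply: I_ae => //; last by move: eK; apply: filterS => x ->.
  apply: continuous_meas; exact: (lipschitz_continuous KL).
Qed.

End torus_kernel.

(** * Convolution with a Lipschitz kernel *)

Section convolution.
Set Implicit Arguments.
Unset Strict Implicit.
Context d (Z : measurableType d) (R : realType) (m : {measure set Z -> \bar R}).
Implicit Types (K k : R -> R) (a y : Z -> R) (x M C : R).

Lemma ae_imp (P Q : Z -> Prop) : (forall z, P z -> Q z) -> {ae m, forall z, P z} ->
  {ae m, forall z, Q z}.
Proof. by move=> PQ; apply: filterS. Qed.

Lemma prob_integral_cst (P : probability Z R) (c : \bar R) : (\int[P]_z c = c)%E.
Proof.
rewrite integral_cst// -[RHS]mule1; congr (_ * _)%E; exact: probability_setT.
Qed.

Lemma integral_ae_eq (f g : Z -> \bar R) : measurable_fun setT f -> measurable_fun setT g ->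
  {ae m, forall z, f z = g z} -> (\int[m]_z f z = \int[m]_z g z)%E.
Proof. by move=> mf mg fg; apply: ae_eq_integral => //; move: fg; apply: filterS => z ->. Qed.

Lemma integrable_ae_eq (f g : Z -> \bar R) : measurable_fun setT g ->
  {ae m, forall z, f z = g z} -> m.-integrable setT f -> m.-integrable setT g.
Proof.
move=> mg fg fi; apply/integrableP; split => //.
rewrite (_ : (\int[m]_z _)%E = (\int[m]_z `|f z|)%E); first by case/integrableP : fi.
apply: ae_eq_integral => //.
- exact: measurableT_comp.
- by apply: measurableT_comp => //; exact: measurable_int fi.
- by move: fg; apply: filterS => z ->.
Qed.

Lemma integrable_bounded_mul (h a : Z -> R) C : measurable_fun setT h ->
  (forall z, `|h z| <= C) ->
  m.-integrable setT (EFin \o a) -> m.-integrable setT (fun z => (h z * a z)%:E).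
Proof.
move=> mh hC ia; have ma : measurable_fun setT a by apply/measurable_EFinP; exact: measurable_int ia.
apply: (@le_integrable _ _ _ _ _ measurableT _ (fun z => (C * a z)%:E)).
- exact/measurable_EFinP/measurable_funM.
- move=> z _ /=; rewrite lee_fin !normrM ler_wpM2r// (le_trans (hC z))// ler_norm//.
- by under eq_fun do rewrite EFinM; exact: integrableZl.
Qed.

(** The Lipschitz bound dominates the difference quotients by [|M| * |a|]. For fixed [x] the kernel
    need only be differentiable at almost all the points [x - y z], yet the convolution is
    differentiable at [x] itself. *)
Lemma convolution_derive K k M C a y x :
  (forall s t, `|K t - K s| <= M * `|t - s|) -> (forall s, `|K s| <= C) ->
  measurable_fun (setT : set (measurableTypeR R)) k ->
  measurable_fun setT (y : Z -> measurableTypeR R) -> m.-integrable setT (EFin \o a) ->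
  {ae m, forall z, is_derive (x - y z) 1 K (k (x - y z))} ->
  is_derive x 1 (fun x => \int[m]_z (K (x - y z) * a z)) (\int[m]_z (k (x - y z) * a z)).
Proof.
move=> KL KC mk my ia dK.
have ma : measurable_fun setT a by apply/measurable_EFinP; exact: measurable_int ia.
have cK : continuous K := lipschitz_continuous KL.
have mK : measurable_fun (setT : set (measurableTypeR R)) K by exact: continuous_meas.
have mxy s : measurable_fun setT (fun z => s - y z : measurableTypeR R).
  by apply: measurable_funB => //; exact: measurable_cst.
have mKs s : measurable_fun setT (fun z => K (s - y z)) by exact: (measurableT_comp mK).
have iKs s : m.-integrable setT (EFin \o (fun z => K (s - y z) * a z)).
  by apply: (integrable_bounded_mul (C := C)) => //.
apply: seq_is_derive => u u0 ucvg.
rewrite (_ : (fun n => _) = fun n => \int[m]_z ((K (x + u n - y z) - K (x - y z)) / u n * a z)); last first.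
  apply/funext => n; rewrite -RintegralB// -RintegralZr//; last first.
    by have := integrableB measurableT (iKs (x + u n)) (iKs x).
  by apply: eq_Rintegral => z _; ring.
apply: (@Rintegral_dominated_convergence _ _ _ m _ measurableT _ _ (fun z => `|M| * `|a z|)).
- move=> n; apply: measurable_funM => //; apply: measurable_funM; last exact: measurable_cst.
  exact: measurable_funB.
- by apply: measurable_funM => //; exact: (measurableT_comp mk).
- move: dK; apply: filterS => z dz _.
  apply: cvgMl; have := is_derive_seq dz u0 ucvg.
  by under eq_fun do rewrite addrAC.
- rewrite (_ : _ \o _ = fun z => (`|M|%:E * `|(a z)%:E|)%E).
    by apply: integrableZl => //; exact: integrable_abse.
  by apply/funext => z.
- apply: aeW => z n _; rewrite normrM ler_wpM2r// normrM normfV ler_pdivrMr ?normr_gt0//.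
  apply: (le_trans (KL _ _)); rewrite (_ : _ - _ - _ = u n); last by ring.
  by rewrite ler_wpM2r// ler_norm.
Qed.

Lemma Rintegral_bounded_mul_le (h a : Z -> R) C : measurable_fun setT h ->
  (forall z, `|h z| <= C) -> m.-integrable setT (EFin \o a) ->
  `|\int[m]_z (h z * a z)| <= C * \int[m]_z `|a z|.
Proof.
move=> mh hC ia; have i1 := integrable_bounded_mul mh hC ia.
have iaa : m.-integrable setT (EFin \o (fun z => `|a z|)).
  by rewrite (_ : _ \o _ = fun z => `|(a z)%:E|%E) //; exact: integrable_abse.
rewrite -RintegralZl//; apply: (le_trans (le_normr_Rintegral measurableT i1)).
apply: le_Rintegral => //.
- rewrite (_ : _ \o _ = fun z => `|(h z * a z)%:E|%E) //; exact: integrable_abse.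
- by rewrite (_ : _ \o _ = fun z => (C%:E * `|(a z)%:E|)%E) //; apply: integrableZl => //; exact: integrable_abse.
- by move=> z _; rewrite normrM ler_wpM2r.
Qed.

End convolution.

Section product_ae.
Set Implicit Arguments.
Unset Strict Implicit.
Context d1 d2 (T1 : measurableType d1) (T2 : measurableType d2) (R : realType).
Variables (m1 : {measure set T1 -> \bar R}) (m2 : {sigma_finite_measure set T2 -> \bar R}).

Lemma ae_fst (P : T1 -> Prop) : {ae m1, forall x, P x} -> {ae (m1 \x m2)%E, forall z, P z.1}.
Proof.
move=> [N [mN N0 h]]; exists (N `*` setT); split; first exact: measurableX.
  by rewrite product_measure1E// N0 mul0e.
by move=> z /= nP; split => //; exact: h.
Qed.

End product_ae.

Section torus_interaction.
Set Implicit Arguments.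
Unset Strict Implicit.
Context {R : realType}.
Variables (L : R) (nu : probability (measurableTypeR R) R).
Hypothesis L0 : 0 < L.
Notation leb := (@lebesgue_measure R).
Implicit Types (K k : R -> R) (x y M c : R) (b : R -> R -> R).
Local Notation I f := (\int[leb]_(x in torus_itv L) f x).
Local Notation m := (torus L \x nu)%E.

Let tS : {sigma_finite_measure set (measurableTypeR R) -> \bar R} := torus L.

Lemma finite_mass : (m setT < +oo)%E.
Proof.
have h := @product_measure1E _ _ _ _ R tS nu _ _ measurableT measurableT.
rewrite -setXTT; apply: (le_lt_trans (y := (L%:E * 1)%E)); last by rewrite mule1 ltry.
by rewrite -(torus_setT L0) -(probability_setT nu) -h.
Qed.

Lemma cst_integrable c : m.-integrable setT (fun=> c%:E).
Proof.
apply: (measurable_bounded_integrable (mu := m)) => //.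
- exact: finite_mass.
- by exists `|c|; split; [exact: num_real|move=> N MN x _; exact: ltW].
Qed.

Lemma kernel_conv0 K M x : (forall x y, `|K y - K x| <= M * `|y - x|) -> periodic K L ->
  I K = 0 -> \int[torus L]_y K (x - y) = 0.
Proof.
move=> KL pK IK; have cK : continuous K := lipschitz_continuous KL.
have [C C0 KC] := periodic_bounded L0 pK cK.
have bK : bounded_meas C K by split => //; exact: continuous_meas.
have c1 : continuous (fun y => x - y).
  by have c0 : continuous (fun y : R => y) := (fun y => cvg_id); cts.
have c2 : continuous (fun y => K (x - y)) by exact: (ccomp cK c1).
rewrite torus_RintegralE; last exact: continuous_meas.
pose G y := - prim K (x - y).
have dG y : is_derive y 1 G (K (x - y)).
  have d1 : is_derive y 1 (fun y => x - y) (-1) by der; ring.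
  have d2 := @dcomp _ (prim K) (fun y => x - y) y _ _ (prim_derive_cont bK cK (x - y)) d1.
  by rewrite /G; der; ring.
apply: (@cint_derive _ _ L0 G) => //.
move=> y; rewrite /G; congr (- _).
rewrite -(prim_periodic L0 bK pK IK (x - (y + L))); congr prim; ring.
Qed.

(* Finitely many translates of a set where K is bounded below cover the circle. *)
Lemma kernel_cover K M x0 b : (forall x y, `|K y - K x| <= M * `|y - x|) -> periodic K L ->
  K x0 != 0 -> measurable_fun setT (fun z : measurableTypeR R * measurableTypeR R => b z.1 z.2) ->
  (forall x, m.-integrable setT (fun z => (K (x - z.1) * b z.1 z.2)%:E)) ->
  m.-integrable setT (fun z => (b z.1 z.2)%:E).
Proof.
move=> KL pK Kx0 mb ib.
have cK : continuous K := lipschitz_continuous KL.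
have [dl dl0 hdl] : exists2 dl, 0 < dl & forall y, `|y - x0| <= dl -> `|K x0| / 2 <= `|K y|.
  have e0 : 0 < `|K x0| / 2 by rewrite divr_gt0// normr_gt0.
  have /cvgrPdist_le/(_ _ e0) := cK x0.
  move=> /nbhs_ballP[dl /= dl0 hd]; exists (dl / 2); first by rewrite divr_gt0.
  move=> y yd; have := hd y; rewrite /ball/= distrC => H.
  have {}H : `|K x0 - K y| <= `|K x0| / 2 by apply: H; lra.
  have := ler_normB (K x0 - K y) (- K y); rewrite opprK subrK normrN; lra.
pose c := `|K x0| / 2; have c0 : 0 < c by rewrite divr_gt0// normr_gt0.
pose N := (Num.truncn (L / dl)).+1.
pose xi (i : nat) := x0 - L / 2 + i%:R * dl.
have cov y : exists2 i : 'I_N, true & c <= `|K (xi i - y)|.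
  have [n n1 n2] := periodic_rep L0 y; set y' := y + _ in n1 n2.
  have L0' := L0.
  have q0 : 0 <= (y' + L / 2) / dl by apply: divr_ge0; [lra|exact: ltW].
  have /andP[t1 t2] := truncn_itv q0; set j := Num.truncn _ in t1 t2.
  have jN : (j < N)%N.
    by rewrite ltnS; apply: le_truncn; rewrite ler_wpM2r ?invr_ge0 ?(ltW dl0)//; lra.
  exists (Ordinal jN) => //.
  rewrite -(periodicMz pK (- n)) (_ : xi _ - y + _ = xi j - y'); last by rewrite /y' mulrNz /=; ring.
  apply: hdl; rewrite (_ : _ - _ = j%:R * dl - (y' + L / 2)); last by rewrite /xi; ring.
  move: t1 t2; rewrite ler_pdivlMr// ltr_pdivrMr// -(natr1 j) mulrDl mul1r => t1 t2.
  rewrite ler_norml; apply/andP; split; lra.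
have isum : m.-integrable setT (fun z => (c^-1%:E * \sum_(i < N) `|(K (xi i - z.1) * b z.1 z.2)%:E|)%E).
  by apply: integrableZl => //; apply: integrable_sum => // i _; apply: integrable_abse.
apply: le_integrable isum => //; first exact/measurable_EFinP.
move=> z _ /=; rewrite sumEFin -EFinM lee_fin ger0_norm; last first.
  by apply: mulr_ge0; [rewrite invr_ge0 ltW|exact: sumr_ge0].
have [i _ hi] := cov z.1.
rewrite (bigD1 i)//= ler_pdivlMl//.
apply: (@le_trans _ _ (`|K (xi i - z.1) * b z.1 z.2|)); last by rewrite lerDl sumr_ge0.
by rewrite normrM ler_wpM2r.
Qed.

(* [c0] is free because K has mean zero. *)
Lemma interaction_derive (T : ptopologicalType) (dD1 : R -> R) K k M c0
    (Ar : R -> borel T -> R -> R) (xi : borel T) :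
  0 <= M -> periodic K L -> (forall x y, `|K y - K x| <= M * `|y - x|) -> bounded_meas M k ->
  {ae leb, forall x, is_derive x 1 K (k x)} -> I K = 0 -> 
  {ae leb, forall x, dD1 x = K x} -> jointly_measurable Ar ->
  interaction_well_defined L nu dD1 Ar xi ->
  let V x := interaction L nu dD1 Ar x xi in
  periodic V L /\ exists V', forall x, is_derive x 1 V (V' x) /\
    `|V' x| <= M * \int[m]_z `|Ar z.1 xi z.2 - c0|.
Proof.
move=> M0 pK KL [mk kM] dK IK dDK mAr wd V.
have cK : continuous K := lipschitz_continuous KL.
have mK : measurable_fun (setT : set (measurableTypeR R)) K by exact: continuous_meas.
have [C C0 KC] := periodic_bounded L0 pK cK.
pose b y w := Ar y xi w.
have mb : measurable_fun setT (fun z : measurableTypeR R * measurableTypeR R => b z.1 z.2).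
  have mp : measurable_fun setT (fun z : measurableTypeR R * measurableTypeR R => (z.1, ((xi : borel T), z.2))).
    by apply: measurable_fun_pair => //; apply: measurable_fun_pair => //; exact: measurable_cst.
  by have := measurableT_comp mAr mp.
have mKx x : measurable_fun setT (fun z : measurableTypeR R * measurableTypeR R => K (x - z.1)).
  by apply: (measurableT_comp mK); apply: measurable_funB.
have aeK x : {ae m, forall z, dD1 (x - z.1) = K (x - z.1)}.
  apply: (@ae_fst _ _ _ _ _ tS nu ( fun y => dD1 (x - y) = K (x - y))).
  have h := @ae_torus _ L _ (ae_reflect x dDK); exact: h.
have iK x : m.-integrable setT (fun z => (K (x - z.1) * b z.1 z.2)%:E).
  apply: (integrable_ae_eq _ _ (wd x)).
  - exact/measurable_EFinP/measurable_funM.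
  - by apply: ae_imp (aeK x) => z /= ->.
(* The iterated real integrals become one integral over the product: by Fubini, [fine] in the inner
   one is harmless for almost every [w], and [dD1] is replaced by [K] off a null set. *)
have VE x : V x = \int[m]_z (K (x - z.1) * b z.1 z.2).
  rewrite /V /interaction /Rintegral; congr fine.
  transitivity (\int[m]_z (dD1 (x - z.1) * b z.1 z.2)%:E)%E; last first.
    apply: integral_ae_eq.
    - exact: measurable_int (wd x).
    - exact: measurable_int (iK x).
    - by apply: ae_imp (aeK x) => z /= ->.
  rewrite -(integral21_prod_meas1 (wd x)).
  apply: integral_ae_eq.
  - apply/measurable_EFinP; apply: (measurableT_comp (@fine_measurable R setT _)) => //.
    exact: measurable_fubini_G (wd x).
  - exact: measurable_fubini_G (wd x).
  move: (ae_integrable2 (wd x)); apply: filterS => w iw.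
  rewrite /= fineK//. exact: integrable_fin_num iw.
split.
  by move=> x; rewrite !VE; apply: eq_Rintegral => z _; rewrite addrAC pK.
(* Well-definedness only makes the products with translates of the kernel integrable. Unless [K]
   vanishes identically, and then [V] does, [kernel_cover] deduces that [Ar] itself is
   integrable. *)
have [Kz|/existsNP[x0 /eqP Kx0]] := pselect (forall x, K x = 0).
  exists (fun=> 0) => x; split.
    have -> : V = cst 0.
      apply/funext => y; rewrite VE; under eq_Rintegral do rewrite Kz mul0r.
      by rewrite Rintegral_cst// mul0r.
    exact: is_derive_cst.
  by rewrite normr0 mulr_ge0// Rintegral_ge0.
have ib := kernel_cover KL pK Kx0 mb iK.
have ibc : m.-integrable setT (EFin \o (fun z => b z.1 z.2 - c0)).
  by have := integrableB measurableT ib (cst_integrable c0).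
have VE' x : V x = \int[m]_z (K (x - z.1) * (b z.1 z.2 - c0)).
  rewrite VE; under [RHS]eq_Rintegral do rewrite mulrBr.
  have iKc : m.-integrable setT (EFin \o (fun z => K (x - z.1) * c0)).
    by apply: (integrable_bounded_mul (C := C)) => //; exact: cst_integrable.
  rewrite RintegralB//; last exact: iK.
  suff -> : \int[m]_z (K (x - z.1) * c0) = 0 by rewrite subr0.
  rewrite /Rintegral -(integral12_prod_meas1 iKc) /fubini_F.
  have e y : (\int[nu]_w (K (x - y) * c0)%:E)%E = (K (x - y) * c0)%:E.
    by rewrite (prob_integral_cst nu).
  under eq_integral do rewrite /= e.
  change (\int[torus L]_y (K (x - y) * c0) = 0); rewrite RintegralZr//.
    by rewrite (kernel_conv0 x KL pK IK) mul0r.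
  apply: (measurable_bounded_integrable (mu := torus L)) => //.
  - by have := ltry L; rewrite -(torus_setT L0).
  - by apply: (measurableT_comp mK); apply: measurable_funB.
  - by exists C; split; [exact: num_real|move=> N MN y _; exact: le_trans (KC _) (ltW MN)].
exists (fun x => \int[m]_z (k (x - z.1) * (b z.1 z.2 - c0))) => x; split.
  rewrite (_ : V = fun x => \int[m]_z (K (x - z.1) * (b z.1 z.2 - c0))); last exact/funext.
  apply: (convolution_derive (M := M) (C := C)) => //.
  apply: (@ae_fst _ _ _ _ _ tS nu ( fun y => is_derive (x - y) 1 K (k (x - y)))).
  have h := @ae_torus _ L _ (ae_reflect x dK); exact: h.
apply: Rintegral_bounded_mul_le => //.
by apply: (measurableT_comp mk); apply: measurable_funB.
Qed.

End torus_interaction.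

(** * Classical solutions as flows *)

Section flow_of_solution.
Set Implicit Arguments.
Unset Strict Implicit.
Context {R : realType}.
Notation leb := (@lebesgue_measure R).
Implicit Types (L t x y e h s d : R) (f : R -> R) (k : nat).

Lemma Ck_norm_ge k f x : (`|f x|%:E <= Ck_norm k f)%E.
Proof.
rewrite /Ck_norm big_ord_recl/=; apply: (@le_trans _ _ (ereal_sup (range (fun x => `|f x|%:E)))).
  by apply: ereal_sup_ubound; exists x.
rewrite leeDl// sume_ge0// => i _.
apply: (@le_trans _ _ (`|derive1n (bump 0 i) f x|%:E)); first by rewrite lee_fin.
by apply: ereal_sup_ubound; exists x.
Qed.

Lemma Ck_norm_near (T : Type) (F : set_system T) {FF : Filter F} k (f : T -> R -> R) e :
  0 < e -> Ck_norm k (f h) @[h --> F] --> 0%E -> \forall h \near F, forall x, `|f h x| <= e.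
Proof.
move=> e0 c; have : \forall h \near F, (Ck_norm k (f h) < e%:E)%E.
  apply: (c [set z | (z < e%:E)%E]); apply: open_nbhs_nbhs; split; last by rewrite /= lte_fin.
  exact: open_ereal_lt_ereal.
by apply: filterS => h hh x; rewrite -lee_fin (le_trans (Ck_norm_ge k (f h) x))// ltW.
Qed.

Lemma derivable_is_derive1 f x : derivable f x 1 -> is_derive x 1 f (derive1 f x).
Proof. by move=> d; apply: DeriveDef; [exact: d|rewrite derive1E]. Qed.

Lemma derive1_unif (F : R -> R) t l :
  (forall e, 0 < e -> exists2 d, 0 < d &
    forall h, h != 0 -> `|h| < d -> `|F (t + h) - F t - h * l| <= e * `|h|) ->
  derive1 F t = l.
Proof.
move=> H; have [_ <-] : is_derive t 1 F l; last by rewrite derive1E.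
apply: seq_is_derive => u u0 ucvg; apply/cvgrPdist_le => e e0.
have [d d0 hd] := H _ e0.
move/cvgrPdist_lt : ucvg => /(_ _ d0); apply: filterS => n; rewrite sub0r normrN => ud.
have un0 := u0 n; rewrite (_ : _ - _ = - ((F (t + u n) - F t - u n * l) / u n)); last by field.
by rewrite normrN normrM normfV ler_pdivrMr ?normr_gt0//; exact: hd.
Qed.

Lemma solution_flow L beta kappa w (u V : R -> R -> R) (u0 lam : R -> R) :
  0 < L -> C1_C2 L u -> (forall x, u 0 x = u0 x) -> prob_density L u0 ->
  Ck_norm 0 (fun x => u t x - u 0 x) @[t --> 0^'+] --> 0%E ->
  (forall t, 0 < t -> periodic (V t) L) ->
  (forall t, 0 < t -> exists V', forall x, is_derive x 1 (V t) (V' x) /\ `|V' x| <= lam t) ->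
  (forall t, 0 < t -> forall x, derive1 (fun s => u s x) t =
     derive1 (fun y => - w * u t y + kappa * u t y * V t y) x + beta^-1 * derive1n 2 (u t) x) ->
  exists du, flow L beta kappa w u du (fun t => derive1 (u t)) (fun t => derive1n 2 (u t))
    V (fun t => derive1 (V t)) lam.
Proof.
move=> L0 [du hdu] /funext u00 [p0 l0 ge0 m0] c0 pV dV eq; exists du.
have mu0 := Lfun_measurable l0.
have dt t : 0 < t -> forall e, 0 < e -> exists2 d, 0 < d &
    forall h, h != 0 -> `|h| < d -> forall x, `|u (t + h) x - u t x - h * du t x| <= e * `|h|.
  move=> t0 e e0; have [_ _ c _] := hdu t t0.
  have H : nbhs (0 : R) (fun h => h != 0 ->
      forall x, `|h^-1 * (u (t + h) x - u t x) - du t x| <= e) by exact: Ck_norm_near e0 c.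
  move: H => /nbhs_ballP[d /= d0 hd].
  exists d => // h h0 hh x.
  have := hd h; rewrite /ball/= sub0r normrN => /(_ hh h0 x) H.
  rewrite (_ : _ - _ - _ = h * (h^-1 * (u (t + h) x - u t x) - du t x)); last by field.
  by rewrite normrM mulrC ler_wpM2r.
split.
- by move=> t t0; have [[]] := hdu t t0.
- move=> t t0 x; have [[_ d _] _ _ _] := hdu t t0.
  exact: derivable_is_derive1 (d 0%N isT x).
- move=> t t0 x; have [[_ d _] _ _ _] := hdu t t0.
  exact: derivable_is_derive1 (d 1%N isT x).
- by move=> t t0; have [[]] := hdu t t0.
- move=> t t0; have [_ [_ d _] _ _] := hdu t t0 => x.
  exact/differentiable_continuous/derivable1_diffP/(d 0%N isT x).
- exact: dt.
- move=> t t0 e e0; have [_ _ _ c] := hdu t t0.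
  have H : nbhs t (fun s =>
      forall x, `|du s x - du t x| <= e) by exact: Ck_norm_near e0 c.
  move: H => /nbhs_ballP[d /= d0 hd].
  exists d => // s hs x; apply: (hd s); by rewrite /ball/= distrC.
- move=> e e0; have H : nbhs (0 : R) (fun t => 0 < t ->
      forall x, `|u t x - u 0 x| <= e) by exact: Ck_norm_near e0 c0.
  move: H => /nbhs_ballP[d /= d0 hd].
  exists d => // t /andP[t0 td] x; apply: (hd t) => //.
  by rewrite /ball/= sub0r normrN ger0_norm// ltW.
- by rewrite u00.
- by rewrite u00 -torus_RintegralE.
- rewrite u00 -torus_RintegralE; last by apply: measurable_funB => //; exact: measurableT_comp.
  rewrite /Rintegral (@integral_ae_eq _ _ _ (torus L) _ (fun=> 0%E)).
  + by rewrite integral0.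
  + by apply/measurable_EFinP; apply: measurable_funB => //; exact: measurableT_comp.
  + exact: measurable_cst.
  + by apply: ae_imp ge0 => x x0; rewrite ger0_norm// subrr.
- exact: pV.
- move=> t t0 x; have [V' h] := dV t t0; have [d _] := h x.
  by apply: derivable_is_derive1; case: d.
- move=> t t0 x; have [V' h] := dV t t0; have [d le] := h x.
  by rewrite derive1E; case: d => _ ->.
- move=> t t0 x; rewrite -eq//; apply/esym/derive1_unif => e e0.
  by have [d d0 hd] := dt t t0 e e0; exists d => // h h0 hh; exact: hd.
Qed.

End flow_of_solution.

(** * Graphop estimates *)

Section square_integrable.
Set Implicit Arguments.
Unset Strict Implicit.
Context d (X : measurableType d) (R : realType) (mu : probability X R).
Implicit Types (f g h : X -> R) (C e : R) (P Q : X -> Prop).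
Local Notation S f := (\int[mu]_x (f x ^+ 2)).
Local Notation L2 := (Lfun mu 2%:E).
Local Notation Loo := (Lfun mu +oo%E).

Lemma ae_imp2 P Q (W : X -> Prop) : (forall z, P z -> Q z -> W z) -> {ae mu, forall z, P z} ->
  {ae mu, forall z, Q z} -> {ae mu, forall z, W z}.
Proof. by move=> PQ; apply: filterS2. Qed.

Lemma L2_measurable f : f \in L2 -> measurable_fun setT f.
Proof. exact: Lfun_measurable. Qed.

Lemma prob_gt0 : (0 < mu setT)%E.
Proof. by have := @lte01 R; rewrite -(probability_setT mu). Qed.

Lemma L2_norm f : f \in L2 -> ('N[mu]_2%:E [EFin \o f])%E = (Num.sqrt (S f))%:E.
Proof.
move=> f2; have := integrable_fin_num measurableT (Lfun2_integrable_sqr f2) => fin.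
rewrite unlock /Lnorm (_ : (\int[mu]_x _)%E = (S f)%:E).
  by rewrite poweR_EFin powR12_sqrt// Rintegral_ge0// => x _; exact: sqr_ge0.
rewrite /Rintegral fineK//; apply: eq_integral => x _ /=.
by rewrite powR_mulrn// real_normK// num_real.
Qed.

Lemma L2_intro f : measurable_fun setT f -> mu.-integrable setT (fun x => (f x ^+ 2)%:E) ->
  f \in L2.
Proof.
move=> mf /integrableP[_ i]; apply: LfunI => //; rewrite unlock /Lnorm; apply: poweR_lty.
move: i; congr (_ < _)%E; apply: eq_integral => x _ /=.
by rewrite powR_mulrn// normrX.
Qed.

Lemma L2_mul f g : f \in L2 -> g \in L2 -> mu.-integrable setT (EFin \o (fun x => f x * g x)).
Proof. by move=> f2 g2; apply/Lfun1_integrable; exact: Lfun2_mul_Lfun1. Qed.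

Lemma L2_comb (a : R) f g : f \in L2 -> g \in L2 -> (fun x => a * f x + g x) \in L2.
Proof.
move=> f2 g2; have mf := L2_measurable f2; have mg := L2_measurable g2.
apply: L2_intro; first by apply: measurable_funD => //; apply: measurable_funM.
have i : mu.-integrable setT (fun x => ((2 * a ^+ 2)%:E * (f x ^+ 2)%:E + 2%:E * (g x ^+ 2)%:E)%E).
  by apply: integrableD => //; apply: integrableZl => //; exact: Lfun2_integrable_sqr.
apply: le_integrable i => //.
  by apply/measurable_EFinP/measurable_funX/measurable_funD => //; apply: measurable_funM.
move=> x _ /=; rewrite lee_fin ger0_norm ?sqr_ge0// ger0_norm; last first.
  by rewrite addr_ge0// mulr_ge0 ?sqr_ge0// mulr_ge0// sqr_ge0.
rewrite -subr_ge0 (_ : _ - _ = (a * f x - g x) ^+ 2) ?sqr_ge0//; ring.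
Qed.

Lemma L2_abs f : f \in L2 -> (fun x => `|f x|) \in L2.
Proof.
move=> f2; apply: L2_intro; first exact: measurableT_comp (L2_measurable f2).
by under eq_fun do rewrite real_normK ?num_real//; exact: Lfun2_integrable_sqr.
Qed.

Lemma L2_bounded f : f \in Loo -> f \in L2.
Proof. by apply: Lfun_subset => //; rewrite ?lee1n// ?leey// fin_num_measure. Qed.

Lemma bounded_Loo f C : measurable_fun setT f -> (forall x, `|f x| <= C) -> f \in Loo.
Proof. by move=> mf fC; apply: (Linfty_intro prob_gt0 mf (C := C)); exact: aeW. Qed.

(** Cauchy-Schwarz in the form of Young's inequality, with a free weight [e]. *)
Lemma L2_mul_le e f g : 0 < e -> f \in L2 -> g \in L2 ->
  `|\int[mu]_x (f x * g x)| <= (e * S f + e^-1 * S g) / 2.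
Proof.
move=> e0 f2 g2; apply: (le_trans (le_normr_Rintegral measurableT (L2_mul f2 g2))).
have i1 := Lfun2_integrable_sqr f2; have i2 := Lfun2_integrable_sqr g2.
have j1 : mu.-integrable setT (EFin \o (fun x => e * f x ^+ 2)).
  by rewrite (_ : _ \o _ = fun x => (e%:E * (f x ^+ 2)%:E)%E)//; exact: integrableZl.
have j2 : mu.-integrable setT (EFin \o (fun x => e^-1 * g x ^+ 2)).
  by rewrite (_ : _ \o _ = fun x => (e^-1%:E * (g x ^+ 2)%:E)%E)//; exact: integrableZl.
have j3 : mu.-integrable setT (EFin \o (fun x => e * f x ^+ 2 + e^-1 * g x ^+ 2)).
  by have := integrableD measurableT j1 j2.
rewrite -(RintegralZl e)// -(RintegralZl e^-1)// -RintegralD// -RintegralZr//.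
apply: le_Rintegral => //.
- rewrite (_ : _ \o _ = fun z => `|(f z * g z)%:E|%E) //; exact: integrable_abse (L2_mul f2 g2).
- rewrite (_ : _ \o _ = fun x => ((e * f x ^+ 2 + e^-1 * g x ^+ 2)%:E * (2^-1)%:E)%E)//.
  exact: integrableZr.
- move=> x _; rewrite normrM -subr_ge0.
  rewrite (_ : _ - _ = e^-1 / 2 * (e * `|f x| - `|g x|) ^+ 2).
    by rewrite mulr_ge0 ?sqr_ge0// divr_ge0// invr_ge0 ltW.
  rewrite -(real_normK (num_real (f x))) -(real_normK (num_real (g x))).
  have e0' : e != 0 by rewrite gt_eqF.
  by field.
Qed.

(** Self-adjointness is given on bounded functions; truncations are bounded and approximate [f] in
    [L^2]. *)
Definition trunc_at (n : nat) f x := if `|f x| <= n%:R then f x else 0.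

Lemma trunc_at_bounded n f : measurable_fun setT f -> trunc_at n f \in Loo.
Proof.
move=> mf; apply: (@bounded_Loo _ n%:R).
  apply: measurable_fun_ifT => //.
  by apply: measurable_fun_ler; [exact: measurableT_comp|exact: measurable_cst].
by move=> x; rewrite /trunc_at; case: ifP => //; rewrite normr0.
Qed.

Lemma trunc_at_cvg f : f \in L2 ->
  (S (fun x => f x - trunc_at n f x)) @[n --> \oo] --> 0.
Proof.
move=> f2; have mf := L2_measurable f2.
have mt n : measurable_fun setT (trunc_at n f) by exact: Lfun_measurable (trunc_at_bounded n mf).
have -> : 0 = \int[mu]_x (fun=> 0 : R) x by rewrite Rintegral_cst// mul0r.
apply: (@Rintegral_dominated_convergence _ _ _ mu _ measurableT _ _ (fun x => f x ^+ 2)) => //.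
- by move=> n; apply/measurable_funX/measurable_funB.
- apply: aeW => x _; apply/cvgrPdist_le => e e0.
  near=> n; rewrite /trunc_at ifT ?subrr ?expr0n ?subrr ?normr0 ?ltW//.
  near: n; exists (Num.truncn `|f x|).+1 => // n /= hn.
  have := truncn_itv (normr_ge0 (f x)) => /andP[_ h]; apply: (lt_le_trans h).
  by rewrite ler_nat.
- exact: Lfun2_integrable_sqr.
- apply: aeW => x n _; rewrite ger0_norm ?sqr_ge0// /trunc_at.
  by case: ifP => _; rewrite ?subrr ?expr0n/= ?subr0// sqr_ge0.
Unshelve. all: by end_near. Qed.

End square_integrable.

Section graphop_estimates.
Set Implicit Arguments.
Unset Strict Implicit.
Context {R : realType} {T : ptopologicalType}.
Variable mu : probability (borel T) R.
Variable A : (borel T -> R) -> (borel T -> R).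
Hypotheses (hA22 : in_B22 mu A) (hA : graphop mu A).
Implicit Types (f g h zeta eta v : borel T -> R) (C e : R).
Local Notation S f := (\int[mu]_x (f x ^+ 2)).
Local Notation L2 := (Lfun mu 2%:E).
Local Notation Loo := (Lfun mu +oo%E).

Lemma op_L2 f : f \in L2 -> A f \in L2.
Proof. by have [_ _ [+ _ _] _] := hA22 => /[apply]. Qed.

Lemma op_bound : exists2 C, 0 <= C & forall f, f \in L2 -> S (A f) <= C * S f.
Proof.
have [_ _ _ [C hC]] := hA22; exists (C ^+ 2); first exact: sqr_ge0.
move=> f f2; have := hC f f2; rewrite !L2_norm ?op_L2// -EFinM lee_fin => h.
have s0 g : 0 <= S g by apply: Rintegral_ge0 => x _; exact: sqr_ge0.
rewrite -[leLHS]sqr_sqrtr// -[X in _ * X]sqr_sqrtr// -exprMn.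
by rewrite ler_pXn2r// ?nnegrE ?sqrtr_ge0// (le_trans _ h)// sqrtr_ge0.
Qed.

Lemma op_linear (a : R) f g : f \in L2 -> g \in L2 ->
  {ae mu, forall x, A (fun x => a * f x + g x) x = a * A f x + A g x}.
Proof.
by move=> f2 g2; have [_ _ [_ _ +] _] := hA22 => /(_ a f g f2 g2); apply: ae_imp => x; apply.
Qed.

(** Extends self-adjointness to an unbounded argument. Truncating [h] leaves a remainder small in
    [L^2], for which both pairings are small since [A] is bounded there. *)
Lemma op_adjoint eta h : eta \in Loo -> h \in L2 ->
  \int[mu]_x (eta x * A h x) = \int[mu]_x (h x * A eta x).
Proof.
move=> eta8 h2; have eta2 := L2_bounded eta8; have [C C0 hC] := op_bound.
have mh := L2_measurable h2.
pose b := S eta + S (A eta) + 1.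
have s0 g : 0 <= S g by apply: Rintegral_ge0 => x _; exact: sqr_ge0.
have b0 : 0 < b by rewrite ltr_wpDl// addr_ge0.
apply/eqP; rewrite -subr_eq0 -normr_le0; apply/ler_addgt0Pl => e e0; rewrite addr0.
(* The weight in Young's inequality: the fixed norms contribute at most [e], and the truncation is
   then fine enough for the remainder to contribute at most [e] as well. *)
pose del := e / b; have d0 : 0 < del by rewrite divr_gt0.
have C1 : 0 < C + 1 by exact: ltr_wpDl.
have e1 : 0 < e * del / (C + 1) by rewrite divr_gt0// mulr_gt0.
have /cvgrPdist_le/(_ _ e1)[N _ /(_ N (leqnn N))] := trunc_at_cvg h2.
set hN := trunc_at N h; rewrite sub0r normrN ger0_norm// => small.
have hN8 : hN \in Loo := trunc_at_bounded mu N mh.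
have hN2 := L2_bounded hN8.
pose k x := -1 * hN x + h x.
have k2 : k \in L2 by exact: L2_comb.
have Sk : S k <= e * del / (C + 1).
  by rewrite (_ : k = fun x => h x - hN x)//; apply/funext => x; rewrite /k mulN1r addrC.
have i1 := L2_mul eta2 (op_L2 h2); have i2 := L2_mul eta2 (op_L2 hN2).
have i3 := L2_mul h2 (op_L2 eta2); have i4 := L2_mul hN2 (op_L2 eta2).
have e2 : \int[mu]_x (eta x * A k x) = \int[mu]_x (eta x * A h x) - \int[mu]_x (eta x * A hN x).
  rewrite -RintegralB// /Rintegral; congr fine; apply: integral_ae_eq.
  - exact: measurable_int (L2_mul eta2 (op_L2 k2)).
  - by have := measurable_int _ (integrableB measurableT i1 i2).
  - by apply: ae_imp (op_linear (-1) hN2 h2) => x ->; congr (_%:E); ring.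
have e3 : \int[mu]_x (k x * A eta x) = \int[mu]_x (h x * A eta x) - \int[mu]_x (hN x * A eta x).
  by rewrite -RintegralB//; apply: eq_Rintegral => x _; rewrite /k; ring.
have sa : \int[mu]_x (eta x * A hN x) = \int[mu]_x (hN x * A eta x).
  by have [_ sa _] := hA; exact: sa.
have -> : \int[mu]_x (eta x * A h x) - \int[mu]_x (h x * A eta x) =
    \int[mu]_x (eta x * A k x) - \int[mu]_x (k x * A eta x).
  by rewrite e2 e3 sa; ring.
apply: (le_trans (ler_normB _ _)).
have h1 := L2_mul_le d0 eta2 (op_L2 k2).
have h2' : `|\int[mu]_x (k x * A eta x)| <= (del * S (A eta) + del^-1 * S k) / 2.
  have := L2_mul_le d0 (op_L2 eta2) k2; congr (`|_| <= _); apply: eq_Rintegral => x _; exact: mulrC.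
have h3 := hC k k2.
have h4 : del * (S eta + S (A eta)) <= e.
  by rewrite /del mulrAC ler_pdivrMr//; apply: ler_wpM2l; [exact: ltW|rewrite /b lerDl].
have h5 : del^-1 * ((C + 1) * S k) <= e.
  rewrite ler_pdivrMl//; move: Sk; rewrite ler_pdivlMr//.
  by rewrite mulrC (mulrC del).
have h6 : del^-1 * S (A k) <= del^-1 * (C * S k) by rewrite ler_wpM2l// invr_ge0 ltW.
apply: (le_trans (lerD h1 h2')); rewrite -mulrDl ler_pdivrMr//.
apply: (@le_trans _ _ (del * (S eta + S (A eta)) + del^-1 * ((C + 1) * S k))); last first.
  by rewrite mulr_natr mulr2n; exact: lerD.
rewrite (_ : del^-1 * ((C + 1) * S k) = del^-1 * (C * S k) + del^-1 * S k); last by ring.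
rewrite (mulrDr del).
by rewrite addrACA lerD2l lerD2r.
Qed.

(** Positivity applied to [zeta + eta] and [zeta - eta]; a scalar [a] of square one treats both
    signs together. *)
Lemma op_abs_le zeta eta : zeta \in Loo -> eta \in Loo -> (forall x, `|eta x| <= zeta x) ->
  {ae mu, forall x, `|A eta x| <= A zeta x}.
Proof.
move=> z8 e8 ez; have z2 := L2_bounded z8; have e2 := L2_bounded e8.
have [_ _ pos] := hA.
have mz := Lfun_measurable z8; have me := Lfun_measurable e8.
have [z0 zb] := Linfty_bound (prob_gt0 mu) z8.
have b8 (a : R) : a ^+ 2 = 1 -> (fun x => a * eta x + zeta x) \in Loo.
  move=> a1; apply: (@Linfty_intro _ _ _ _ _ (fine ('N[mu]_+oo [EFin \o zeta])%E *+ 2)).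
  - exact: prob_gt0.
  - by apply: measurable_funD => //; apply: measurable_funM.
  apply: ae_imp zb => x zx; rewrite mulr2n; apply: (le_trans (ler_normD _ _)).
  apply: lerD => //; rewrite normrM (_ : `|a| = 1) ?mul1r ?(le_trans (ez x))//.
    exact: le_trans (ler_norm _) zx.
  by apply/eqP; rewrite -(@eqrXn2 _ 2)// ?expr1n -?normrX ?a1 ?normr1.
have p (a : R) : a ^+ 2 = 1 -> {ae mu, forall x, 0 <= a * A eta x + A zeta x}.
  move=> a1; have := pos _ (b8 a a1).
  have h : {ae mu, forall x, 0 <= a * eta x + zeta x}.
    apply: aeW => x; have := ez x; rewrite ler_norml => /andP[h1 h2].
    have : (a == 1) || (a == -1) by rewrite -eqf_sqr expr1n a1.
    by move=> /orP[] /eqP ->; lra.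
  by move=> /(_ h); apply: ae_imp2 (op_linear a e2 z2) => x ->.
apply: (ae_imp2 _ (p 1 _) (p (-1) _)); [|exact: expr1n|by rewrite sqrrN expr1n].
by move=> x; rewrite mul1r mulN1r ler_norml => h1 h2; apply/andP; split; lra.
Qed.

Lemma op_ge0 zeta : zeta \in Loo -> (forall x, 0 <= zeta x) -> {ae mu, forall x, 0 <= A zeta x}.
Proof.
move=> z8 z0; apply: ae_imp (op_abs_le z8 z8 _); first by move=> x; exact: le_trans.
by move=> x; rewrite ger0_norm.
Qed.

(* Test A against [zeta sg (A h)] and move it to the other side. *)
Lemma op_abs_dual zeta h : zeta \in Loo -> (forall x, 0 <= zeta x) -> h \in L2 ->
  \int[mu]_x (zeta x * `|A h x|) <= \int[mu]_x (`|h x| * `|A zeta x|).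
Proof.
move=> z8 z0 h2; pose eta x := zeta x * Num.sg (A h x).
have mAh := L2_measurable (op_L2 h2); have mz := Lfun_measurable z8.
have msg : measurable_fun setT (fun x => Num.sg (A h x)).
  rewrite (_ : (fun x => _) = fun x => if A h x < 0 then -1 else if 0 < A h x then 1 else 0).
    apply: measurable_fun_ifT => //; first by apply: measurable_fun_ltr => //; exact: measurable_cst.
    apply: measurable_fun_ifT => //; by apply: measurable_fun_ltr => //; exact: measurable_cst.
  by apply/funext => x; case: (sgrP (A h x)) => // [->|/[dup] /ltW]; rewrite ?ltxx// => -> ; case: ltP.
have ez x : `|eta x| <= zeta x.
  by rewrite /eta normrM ger0_norm// ler_piMr// normr_sg; case: (A h x != 0).
have [b0 zb] := Linfty_bound (prob_gt0 mu) z8.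
have e8 : eta \in Loo.
  apply: (Linfty_intro (prob_gt0 mu) (C := fine ('N[mu]_+oo [EFin \o zeta])%E)).
    exact: measurable_funM.
  apply: ae_imp zb => x zx; apply: (le_trans (ez x)); exact: le_trans (ler_norm _) zx.
have e2 := L2_bounded e8; have z2 := L2_bounded z8.
have -> : \int[mu]_x (zeta x * `|A h x|) = \int[mu]_x (eta x * A h x).
  by apply: eq_Rintegral => x _; rewrite /eta -mulrA -normrEsg.
rewrite op_adjoint//; apply: (le_trans (ler_norm _)).
apply: (le_trans (le_normr_Rintegral measurableT (L2_mul h2 (op_L2 e2)))).
have i1 := L2_mul (L2_abs h2) (L2_abs (op_L2 e2)).
have i2 := L2_mul (L2_abs h2) (L2_abs (op_L2 z2)).
under eq_Rintegral do rewrite normrM.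
rewrite /Rintegral; apply: fine_le; [exact: integrable_fin_num i1|exact: integrable_fin_num i2|].
apply: ae_ge0_le_integral => //.
- exact: measurable_int i1.
- exact: measurable_int i2.
- apply: ae_imp (op_abs_le z8 e8 ez) => x hx _.
  by rewrite lee_fin ler_wpM2l// (le_trans hx)// ler_norm.
Qed.

End graphop_estimates.

Section numerical_radius_bound.
Set Implicit Arguments.
Unset Strict Implicit.
Context {R : realType} {T : ptopologicalType}.
Variable mu : probability (borel T) R.
Variable A : (borel T -> R) -> (borel T -> R).
Hypotheses (hA22 : in_B22 mu A) (hA : graphop mu A).
Implicit Types (f g h zeta eta v : borel T -> R) (C e : R).
Local Notation S f := (\int[mu]_x (f x ^+ 2)).
Local Notation L2 := (Lfun mu 2%:E).
Local Notation Loo := (Lfun mu +oo%E).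
Local Notation n := (fine (numerical_radius mu A)).

Lemma S_ge0 f : 0 <= S f.
Proof. by apply: Rintegral_ge0 => x _; exact: sqr_ge0. Qed.

Lemma one_Loo : (fun=> 1) \in Loo.
Proof. by apply: (@bounded_Loo _ _ _ mu _ 1) => // x; rewrite normr1. Qed.

Lemma op_zero : {ae mu, forall x, A (fun=> 0) x = 0}.
Proof.
have z2 : (fun=> 0 : R) \in L2 by exact: Lfun_cst.
apply: ae_imp (op_linear hA22 1 z2 z2) => x.
rewrite (_ : (fun _ => 1 * 0 + 0) = fun=> 0); last by apply/funext => y; rewrite mulr0 addr0.
by move=> /eqP; rewrite mul1r -subr_eq0 opprD addrA subrr sub0r oppr_eq0 => /eqP.
Qed.

Lemma op_scale (a : R) f : f \in L2 -> {ae mu, forall x, A (fun x => a * f x) x = a * A f x}.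
Proof.
move=> f2; have z2 : (fun=> 0 : R) \in L2 by exact: Lfun_cst.
apply: ae_imp2 (op_linear hA22 a f2 z2) op_zero => x.
rewrite (_ : (fun x => a * f x + 0) = fun x => a * f x); last by apply/funext => y; rewrite addr0.
by move=> -> ->; rewrite addr0.
Qed.

(** Finite because [A] is bounded on [L^2]; nonnegative because the constant [1] has norm one and
    [A 1 >= 0]. *)
Lemma numerical_radius_fin : 0 <= n /\ numerical_radius mu A = n%:E.
Proof.
have [C C0 hC] := op_bound hA22.
have up : (numerical_radius mu A <= ((C + 1) / 2)%:E)%E.
  apply: ge_ereal_sup => _ [f [f2 n1] <-]; rewrite lee_fin (le_trans (ler_norm _))//.
  apply: (le_trans (L2_mul_le ltr01 (op_L2 hA22 f2) f2)).
  have Sf : S f = 1.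
    move: n1; rewrite L2_norm// => -[] /(congr1 (fun x => x ^+ 2)).
    by rewrite sqr_sqrtr ?S_ge0// expr1n.
  by have := hC f f2; rewrite Sf invr1 !mul1r mulr1; lra.
have low : (0 <= numerical_radius mu A)%E.
  have o2 := L2_bounded one_Loo.
  apply: (@le_trans _ _ (\int[mu]_x (A (fun=> 1) x * 1))%:E); last first.
    apply: ereal_sup_ubound; exists (fun=> 1) => //; split => //.
    rewrite L2_norm//; congr (_%:E); rewrite expr1n /Rintegral.
    by rewrite (prob_integral_cst mu) sqrtr1.
  under eq_Rintegral do rewrite mulr1.
  rewrite lee_fin /Rintegral fine_ge0//.
  rewrite (@integral_ae_eq _ _ _ mu _ (fun x => `|A (fun=> 1) x|%:E)).
  - by apply: integral_ge0 => x _; rewrite lee_fin.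
  - by apply/measurable_EFinP; exact: L2_measurable (op_L2 hA22 o2).
  - by apply/measurable_EFinP/measurableT_comp => //; exact: L2_measurable (op_L2 hA22 o2).
  - by apply: ae_imp (op_ge0 hA22 hA one_Loo (fun=> ler01)) => x x0; rewrite ger0_norm.
have fin : numerical_radius mu A \is a fin_num.
  by rewrite ge0_fin_numE// (le_lt_trans up)// ltry.
by split; [exact: fine_ge0|rewrite fineK].
Qed.

Lemma numerical_radius_le v : v \in L2 -> \int[mu]_x (A v x * v x) <= n * S v.
Proof.
move=> v2; have [n0 nE] := numerical_radius_fin; have [C C0 hC] := op_bound hA22.
have := S_ge0 v; rewrite le_eqVlt => /predU1P[/esym Sv|Sv].
  rewrite Sv mulr0; have := L2_mul_le ltr01 (op_L2 hA22 v2) v2.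
  have := hC v v2; rewrite Sv !mulr0 addr0 mul1r => h1 h2.
  by rewrite (le_trans (ler_norm _))// (le_trans h2)//; lra.
pose s := Num.sqrt (S v); have s0 : 0 < s by rewrite sqrtr_gt0.
have s2 : s ^+ 2 = S v by rewrite sqr_sqrtr// ltW.
have sn : s != 0 by rewrite gt_eqF.
pose f x := s^-1 * v x.
have f2 : f \in L2.
  rewrite (_ : f = fun x => s^-1 * v x + 0); last by apply/funext => x; rewrite addr0.
  by apply: L2_comb => //; exact: Lfun_cst.
have Sf : S f = 1.
  rewrite /f; under eq_Rintegral do rewrite exprMn.
  by rewrite RintegralZl ?Lfun2_integrable_sqr// -s2 -exprMn mulVf// expr1n.
have : ((\int[mu]_x (A f x * f x))%:E <= numerical_radius mu A)%E.
  by apply: ereal_sup_ubound; exists f => //; split => //; rewrite L2_norm// Sf sqrtr1.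
rewrite nE lee_fin.
have -> : \int[mu]_x (A f x * f x) = (s ^+ 2)^-1 * \int[mu]_x (A v x * v x).
  have i := L2_mul (op_L2 hA22 v2) v2.
  rewrite -RintegralZl// /Rintegral; congr fine; apply: integral_ae_eq.
  - exact: measurable_int (L2_mul (op_L2 hA22 f2) f2).
  - by apply/measurable_EFinP/measurable_funM => //; apply/measurable_EFinP; exact: measurable_int i.
  apply: ae_imp (op_scale s^-1 v2) => x; rewrite -/f => ->; congr (_%:E).
  by rewrite /f; field.
by rewrite s2 ler_pdivrMl// mulrC.
Qed.

End numerical_radius_bound.

Section kernel_estimates.
Set Implicit Arguments.
Unset Strict Implicit.
Context {R : realType} {T : ptopologicalType}.
Variable mu : probability (borel T) R.
Variable A : (borel T -> R) -> (borel T -> R).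
Hypotheses (hA22 : in_B22 mu A) (hA : graphop mu A).
Context d (Y : measurableType d) (m : {sigma_finite_measure set Y -> \bar R}).
Variables H K : borel T * Y -> R.
Hypotheses (mH : measurable_fun setT H) (mK : measurable_fun setT K).
Hypothesis HK : {ae m, forall z, (fun x => H (x, z)) \in Lfun mu 2%:E /\
  {ae mu, forall x, K (x, z) = A (fun x => H (x, z)) x}}.
Implicit Types (f g h zeta : borel T -> R).
Local Notation Loo := (Lfun mu +oo%E).
Local Notation fH := (fun x => \int[m]_z `|H (x, z)|%:E)%E.
Local Notation FK := (fun x => \int[m]_z `|K (x, z)|%:E)%E.
Local Notation n := (fine (numerical_radius mu A)).

Lemma kernel_measurable (J : borel T * Y -> R) : measurable_fun setT J ->
  measurable_fun setT (fun x => \int[m]_z `|J (x, z)|%:E)%E.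
Proof.
move=> mJ; apply: (measurable_fun_fubini_tonelli_F (fun z => `|J z|%:E)).
  by apply/measurable_EFinP; exact: measurableT_comp.
by move=> z; rewrite lee_fin.
Qed.

Lemma kernel_swap (J : borel T * Y -> R) h : measurable_fun setT J -> measurable_fun setT h ->
  (forall x, 0 <= h x) ->
  (\int[mu]_x ((h x)%:E * \int[m]_z `|J (x, z)|%:E) =
   \int[m]_z \int[mu]_x (h x * `|J (x, z)|)%:E)%E.
Proof.
move=> mJ mh h0; pose f (z : borel T * Y) := ((h z.1) * `|J z|)%:E.
have mf : measurable_fun setT f.
  apply/measurable_EFinP/measurable_funM; last exact: measurableT_comp.
  exact: measurableT_comp.
have f0 z : (0 <= f z)%E by rewrite lee_fin mulr_ge0.
have := @fubini_tonelli _ _ _ _ R mu m f mf f0; rewrite /fubini_F /fubini_G => <-.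
apply: eq_integral => x _; rewrite -ge0_integralZl ?lee_fin//.
by apply/measurable_EFinP/measurableT_comp => //; exact: measurable_fun_pair2.
Qed.

(** [op_abs_dual] for almost every [z], then integrated in [z]. All integrands are nonnegative, so
    Tonelli exchanges the integrals even when they are infinite. *)
Lemma kernel_dual zeta : zeta \in Loo -> (forall x, 0 <= zeta x) ->
  (\int[mu]_x ((zeta x)%:E * FK x) <= \int[mu]_x (`|A zeta x|%:E * fH x))%E.
Proof.
move=> z8 z0; have mz := Lfun_measurable z8; have z2 := L2_bounded z8.
have mAz : measurable_fun setT (fun x => `|A zeta x|).
  by apply: measurableT_comp => //; exact: L2_measurable (op_L2 hA22 z2).
rewrite (kernel_swap mK mz z0) (kernel_swap mH mAz (fun x => normr_ge0 _)).
have mG (J : borel T * Y -> R) h : measurable_fun setT J -> measurable_fun setT h ->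
   (forall x, 0 <= h x) -> measurable_fun setT (fun z => \int[mu]_x (h x * `|J (x, z)|)%:E)%E.
  move=> mJ mh h0; apply: (measurable_fun_fubini_tonelli_G (fun z => (h z.1 * `|J z|)%:E)).
    apply/measurable_EFinP/measurable_funM; last exact: measurableT_comp.
    exact: measurableT_comp.
  by move=> z; rewrite lee_fin mulr_ge0.
apply: ae_ge0_le_integral => //.
- by move=> z _; apply: integral_ge0 => x _; rewrite lee_fin mulr_ge0.
- exact: mG.
- by move=> z _; apply: integral_ge0 => x _; rewrite lee_fin mulr_ge0.
- exact: mG.
apply: ae_imp HK => z [h2 hK] _.
have Ah2 := op_L2 hA22 h2.
have i1 := L2_mul z2 (L2_abs Ah2); have i2 := L2_mul (L2_abs (op_L2 hA22 z2)) (L2_abs h2).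
have -> : (\int[mu]_x (zeta x * `|K (x, z)|)%:E =
           \int[mu]_x (zeta x * `|A (fun x => H (x, z)) x|)%:E)%E.
  apply: integral_ae_eq.
  - apply/measurable_EFinP/measurable_funM => //; apply: measurableT_comp => //.
    exact: measurable_fun_pair1.
  - exact: measurable_int i1.
  - by apply: ae_imp hK => x ->.
rewrite -(fineK (integrable_fin_num measurableT i1)) -(fineK (integrable_fin_num measurableT i2)).
rewrite lee_fin; apply: (le_trans (op_abs_dual hA22 hA z8 z0 h2)).
by rewrite le_eqVlt; apply/orP; left; apply/eqP/eq_Rintegral => x _; rewrite mulrC.
Qed.

(** Provides a bound that depends on [A] alone. On the set [B] where it fails, [kernel_dual] is
    tested with the indicator of [B]: its image under [A] is nonnegative, and self-adjointness moves
    [A] to the constant [1]. So the excess over the bound integrates to zero on [B]. *)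
Lemma kernel_le_degree : {ae mu, forall x, (fH x <= 2%:E)%E} ->
  {ae mu, forall x, (FK x <= (2 * `|A (fun=> 1) x|)%:E)%E}.
Proof.
move=> f2; have o8 := one_Loo mu; have o2 := L2_bounded o8.
set a := A (fun=> 1); have a2 : a \in Lfun mu 2%:E := op_L2 hA22 o2.
have ma : measurable_fun setT (fun x => 2 * `|a x|).
  by apply: measurable_funM => //; apply: measurableT_comp => //; exact: L2_measurable a2.
have mF := kernel_measurable mK; have mf := kernel_measurable mH.
pose B := [set x | ((2 * `|a x|)%:E < FK x)%E].
have mB : measurable B.
  rewrite -[B]setTI; apply: emeasurable_fun_lt => //; exact/measurable_EFinP.
pose zeta x := (\1_B x : R).
have z0 x : 0 <= zeta x by rewrite /zeta indicE.
have z1 x : zeta x = 0 \/ zeta x = 1 by rewrite /zeta indicE; case: (_ \in _); [right|left].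
have mz : measurable_fun setT zeta by exact: measurable_indic.
have z8 : zeta \in Loo.
  by apply: (@bounded_Loo _ _ _ mu _ 1) => // x; have [->|->] := z1 x; rewrite ?normr0 ?normr1.
have z2 := L2_bounded z8; have Az2 := op_L2 hA22 z2.
have mAz : measurable_fun setT (fun x => `|A zeta x|).
  by apply: measurableT_comp => //; exact: L2_measurable Az2.
have iz := L2_mul z2 (L2_abs a2).
have iAz := L2_mul o2 (L2_abs Az2).
have le1 : (\int[mu]_x ((zeta x)%:E * FK x) <= (2 * \int[mu]_x (zeta x * `|a x|))%:E)%E.
  apply: (le_trans (kernel_dual z8 z0)).
  apply: (@le_trans _ _ (\int[mu]_x (2 * (1 * `|A zeta x|))%:E)%E).
    apply: ae_ge0_le_integral => //.
    - by move=> x _; rewrite mule_ge0// integral_ge0.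
    - by apply: emeasurable_funM => //; exact/measurable_EFinP.
    - apply/measurable_EFinP; apply: measurable_funM => //; exact: measurable_funM.
    - by apply: ae_imp f2 => x fx _; rewrite mul1r mulrC EFinM lee_wpmul2l.
  under eq_integral do rewrite EFinM.
  rewrite ge0_integralZl//; last by apply/measurable_EFinP; exact: measurable_funM.
  rewrite EFinM lee_pmul2l// -(fineK (integrable_fin_num measurableT iAz)) lee_fin.
  change (\int[mu]_x (1 * `|A zeta x|) <= \int[mu]_x (zeta x * `|a x|)).
  have -> : \int[mu]_x (1 * `|A zeta x|) = \int[mu]_x (1 * A zeta x).
    rewrite /Rintegral; congr fine; apply: integral_ae_eq.
    - exact: measurable_int iAz.
    - exact: measurable_int (L2_mul o2 Az2).
    - by apply: ae_imp (op_ge0 hA22 hA z8 z0) => x x0 /=; rewrite ger0_norm.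
  have [_ sa _] := hA; rewrite sa//; apply: le_Rintegral => //.
  - exact: L2_mul.
  - by move=> x _; apply: ler_wpM2l => //; exact: ler_norm.
(* [FK] may be infinite on [B]; the part [g] with finite integral is split off so that it can be
   cancelled in the extended reals. *)
pose g x := (zeta x * (2 * `|a x|))%:E.
pose h x := ((zeta x)%:E * (FK x - (2 * `|a x|)%:E))%E.
have mg : measurable_fun setT g by apply/measurable_EFinP/measurable_funM.
have mh : measurable_fun setT h.
  apply: emeasurable_funM; first exact/measurable_EFinP.
  by apply: emeasurable_funB => //; exact/measurable_EFinP.
have g0 x : (0 <= g x)%E by rewrite lee_fin mulr_ge0// mulr_ge0.
have h0 x : (0 <= h x)%E.
  rewrite /h /zeta indicE; have [|_] := boolP (x \in B); last by rewrite mul0e.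
  by rewrite inE /B/= mul1e => /ltW; rewrite -sube_ge0.
have ghE x : ((zeta x)%:E * FK x = g x + h x)%E.
  rewrite /g /h; have [->|->] := z1 x; first by rewrite mul0r !mul0e adde0.
  by rewrite mul1r !mul1e [RHS]addeC subeK.
have gE : (\int[mu]_x g x = (2 * \int[mu]_x (zeta x * `|a x|))%:E)%E.
  rewrite EFinM /Rintegral fineK; last exact: integrable_fin_num iz.
  rewrite -ge0_integralZl//; first by apply: eq_integral => x _; rewrite /g -EFinM; congr (_%:E); ring.
    exact: measurable_int iz.
  by move=> x _; rewrite lee_fin mulr_ge0.
have h00 : (\int[mu]_x h x = 0)%E.
  apply/eqP; rewrite eq_le integral_ge0// andbT.
  move: le1; under eq_integral do rewrite ghE.
  by rewrite ge0_integralD// gE -[leRHS]adde0 leeD2lE.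
have : ae_eq mu setT h (cst 0%E).
  apply/(ae_eq_integral_abs mu measurableT mh).
  by rewrite -h00; apply: eq_integral => x _; rewrite gee0_abs.
apply: ae_imp => x /(_ I); rewrite /h /zeta indicE.
have [xB|] := boolP (x \in B); last by rewrite notin_setE /B/= => /negP; rewrite -leNgt.
rewrite mul1e /= => e.
move: xB; rewrite inE /B/= -sube_gt0.
by rewrite e ltxx.
Qed.

(** [kernel_dual] with [zeta = f]: as [A f >= 0], its right-hand side is the quadratic form of [A]
    at [f]. *)
Lemma kernel_quadratic f : f \in Loo -> (forall x, 0 <= f x) -> {ae mu, forall x, fH x = (f x)%:E} ->
  (\int[mu]_x ((f x)%:E * FK x) <= (n * \int[mu]_x (f x ^+ 2))%:E)%E.
Proof.
move=> f8 f0 fE; have f2 := L2_bounded f8; have Af2 := op_L2 hA22 f2.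
apply: (le_trans (kernel_dual f8 f0)).
have i := L2_mul Af2 f2.
rewrite (@integral_ae_eq _ _ _ mu _ (EFin \o (fun x => A f x * f x))).
- by rewrite -(fineK (integrable_fin_num measurableT i)) lee_fin; exact: numerical_radius_le.
- apply: emeasurable_funM; last exact: kernel_measurable.
  by apply/measurable_EFinP/measurableT_comp => //; exact: L2_measurable Af2.
- exact: measurable_int i.
- by apply: ae_imp2 (op_ge0 hA22 hA f8 f0) fE => x x0 ->; rewrite ger0_norm.
Qed.

End kernel_estimates.

(** * Entropy of a density and of its mixture with the uniform one *)

Section density_entropy.
Set Implicit Arguments.
Unset Strict Implicit.
Context {R : realType}.
Variable L : R.
Hypothesis L0 : 0 < L.
Notation leb := (@lebesgue_measure R).
Implicit Types (p q : R -> R) (x y e eps : R).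
Local Notation I f := (\int[leb]_(x in torus_itv L) f x).

Definition density p := [/\ continuous p, forall x, 0 <= p x & I p = 1].

Lemma density_meas p : density p -> measurable_fun (setT : set (measurableTypeR R)) p.
Proof. by case=> cp _ _; exact: continuous_meas. Qed.

Lemma measurable_Phi (d : measure_display) (Z : measurableType d) (f : Z -> R) : measurable_fun setT f ->
  measurable_fun setT (fun z => Phi L (f z)).
Proof.
move=> mf; apply: measurable_funD; last exact: measurable_cst.
apply: measurable_funB => //; apply: measurable_funM => //.
by apply: (measurableT_comp (@measurable_ln R)); apply: measurable_funM => //; exact: measurable_cst.
Qed.

Lemma Phi_le r : 0 <= r -> Phi L r <= L * r ^+ 2 + L^-1.
Proof.
move=> r0; rewrite PhiE; have [->|rn] := eqVneq r 0.
  by rewrite mul0r expr0n/= mulr0 subr0.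
have {}r0 : 0 < r by rewrite lt_neqAle eq_sym rn.
have := ln_le_sub1 (mulr_gt0 L0 r0) => h.
have : r * ln (L * r) <= r * (L * r - 1) by rewrite ler_wpM2l// ltW.
rewrite expr2; lra.
Qed.

Lemma density_Phi_integrable p : density p -> leb.-integrable (torus_itv L) (EFin \o (fun x => Phi L (p x))).
Proof.
move=> dp; have [cp p0 _] := dp.
have c : continuous (fun x => L * p x ^+ 2 + L^-1) by cts.
apply: le_integrable (cint_integrable L c) => //.
  by apply/measurable_EFinP/measurable_funTS; exact: measurable_Phi (density_meas dp).
move=> x _ /=; rewrite lee_fin !ger0_norm ?Phi_ge0//; first exact: Phi_le.
exact: le_trans (Phi_ge0 L0 _) (Phi_le _).
Qed.

Lemma density_entropyE p : density p ->
  (\int[torus L]_x (p x * ln (p x / L^-1))%:E = (I (fun x => Phi L (p x)))%:E)%E.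
Proof.
move=> dp; have [cp p0 p1] := dp; have mp := density_meas dp.
have iP := density_Phi_integrable dp.
have c : continuous (fun x => L^-1 - p x) by cts.
have i : leb.-integrable (torus_itv L) (EFin \o (fun x => Phi L (p x) - (L^-1 - p x))).
  by have := integrableB (measurable_torus_itv L) iP (cint_integrable L c).
have e x : p x * ln (p x / L^-1) = Phi L (p x) - (L^-1 - p x) by rewrite /Phi; ring.
rewrite torus_integralE; last first.
  under eq_fun do rewrite e; apply/measurable_EFinP/measurable_funB; first exact: measurable_Phi.
  exact: continuous_meas.
under eq_integral do rewrite e.
rewrite -[LHS]fineK; last exact: integrable_fin_num i.
congr (_%:E); change (I (fun x => Phi L (p x) - (L^-1 - p x)) = I (fun x => Phi L (p x))).
rewrite RintegralB//; last exact: cint_integrable.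
rewrite cintB//; last exact: cst_continuous.
by rewrite p1 (cint_cst L0) mulVf ?gt_eqF// !subrr subr0.
Qed.

Lemma density_dist_le2 p : density p -> I (fun x => `|p x - L^-1|) <= 2.
Proof.
move=> [cp p0 p1]; have c : continuous (fun x => `|p x - L^-1|) by cts.
have c2 : continuous (fun x => p x + L^-1) by cts.
apply: (@le_trans _ _ (I (fun x => p x + L^-1))); last first.
  rewrite cintD//; last exact: cst_continuous.
  by rewrite p1 (cint_cst L0) mulVf ?gt_eqF.
apply: cint_le => // x; apply: (le_trans (ler_normB _ _)).
by rewrite !ger0_norm// invr_ge0 ltW.
Qed.

Section mixture.
Variables (p : R -> R) (eps : R).
Hypotheses (dp : density p) (eps01 : 0 < eps < 1).
Let q x := (1 - eps) * p x + eps / L.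

Lemma density_mix : density q.
Proof.
have [cp p0 p1] := dp; have /andP[e0 e1] := eps01; split.
- by rewrite /q; cts.
- by move=> x; rewrite addr_ge0 ?divr_ge0 ?(ltW L0) ?(ltW e0)// mulr_ge0// subr_ge0 ltW.
- have c1 : continuous (fun x => (1 - eps) * p x) by cts.
  rewrite /q cintD//; last exact: cst_continuous.
  by rewrite (cintZ L (1 - eps) cp) p1 (cint_cst L0) mulr1 divfK ?gt_eqF// subrK.
Qed.

Let q_gt0 x : 0 < q x.
Proof.
have [cp p0 p1] := dp; have /andP[e0 e1] := eps01.
by rewrite ltr_wpDl ?divr_gt0// mulr_ge0// subr_ge0 ltW.
Qed.

Lemma mix_distE : I (fun x => `|q x - L^-1|) = (1 - eps) * I (fun x => `|p x - L^-1|).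
Proof.
have [cp p0 p1] := dp; have /andP[e0 e1] := eps01.
have c : continuous (fun x => `|p x - L^-1|) by cts.
rewrite -cintZ//; apply: eq_Rintegral => x _.
rewrite (_ : q x - L^-1 = (1 - eps) * (p x - L^-1)); last by rewrite /q; ring.
by rewrite normrM ger0_norm// subr_ge0 ltW.
Qed.

(** Convexity, through the tangent at [q x] evaluated at [p x] and at [L^-1]: with weights [1 - eps]
    and [eps] the linear terms cancel. *)
Lemma mix_Phi_le : I (fun x => Phi L (q x)) <= I (fun x => Phi L (p x)).
Proof.
have [cp p0 p1] := dp; have /andP[e0 e1] := eps01.
apply: le_Rintegral => //; [exact: density_Phi_integrable density_mix|exact: density_Phi_integrable|].
move=> x _; have Li0 : 0 <= L^-1 by rewrite invr_ge0 ltW.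
have h1 := Phi_tangent L0 (p0 x) (q_gt0 x); have h2 := Phi_tangent L0 Li0 (q_gt0 x).
have PL : Phi L L^-1 = 0 by rewrite PhiE divff ?gt_eqF// ln1 mulr0 sub0r addNr.
have g1 : (1 - eps) * (Phi L (q x) - Phi L (p x)) <= (1 - eps) * (ln (L * q x) * (q x - p x)).
  by rewrite ler_wpM2l// subr_ge0 ltW.
have g2 : eps * (Phi L (q x) - Phi L L^-1) <= eps * (ln (L * q x) * (q x - L^-1)).
  by rewrite ler_wpM2l// ltW.
have g3 : (1 - eps) * (ln (L * q x) * (q x - p x)) + eps * (ln (L * q x) * (q x - L^-1)) = 0.
  by rewrite /q; ring.
have g4 := Phi_ge0 L0 (p x); rewrite PL in g2.
have g5 : 0 <= eps * Phi L (p x) by rewrite mulr_ge0// ltW.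
move: g1 g2 g3 g5; rewrite !mulrBl !mul1r !mulrBr; lra.
Qed.

(** The logarithm is monotone: [q >= (1 - eps) * p] and [q >= eps / L] are used in the two parts of
    [q * ln (L * q)]. The additive defect vanishes as [eps] tends to zero. *)
Lemma mix_Phi_ge : (1 - eps) * I (fun x => Phi L (p x)) + ((1 - eps) * ln (1 - eps) + eps * ln eps) <=
  I (fun x => Phi L (q x)).
Proof.
have [cp p0 p1] := dp; have /andP[e0 e1] := eps01.
have iP := density_Phi_integrable dp; have iQ := density_Phi_integrable density_mix.
have c : continuous (fun x => (1 - eps) * ln (1 - eps) * p x + eps / L * ln eps) by cts.
have -> : (1 - eps) * ln (1 - eps) + eps * ln eps =
    I (fun x => (1 - eps) * ln (1 - eps) * p x + eps / L * ln eps).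
  have c1 : continuous (fun x => (1 - eps) * ln (1 - eps) * p x) by cts.
  rewrite cintD//; last exact: cst_continuous.
  rewrite (cintZ L ((1 - eps) * ln (1 - eps)) cp) p1 (cint_cst L0) mulr1; congr (_ + _).
  have Ln0 : L != 0 by rewrite gt_eqF.
  by field.
have iP' : leb.-integrable (torus_itv L) (EFin \o (fun x => (1 - eps) * Phi L (p x))).
  rewrite (_ : _ \o _ = fun x => ((1 - eps)%:E * (Phi L (p x))%:E)%E)//.
  exact: integrableZl iP.
rewrite -RintegralZl// -RintegralD//; last exact: cint_integrable.
apply: le_Rintegral => //.
  by have := integrableD (measurable_torus_itv L) iP' (cint_integrable L c).
move=> x _; rewrite !PhiE.
have h1 : (1 - eps) * p x * (ln (1 - eps) + ln (L * p x)) <= (1 - eps) * p x * ln (L * q x).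
  have [->|pn] := eqVneq (p x) 0; first by rewrite !mulr0 !mul0r.
  have px : 0 < p x by rewrite lt_neqAle eq_sym pn p0.
  have e1' : 0 < 1 - eps by rewrite subr_gt0.
  rewrite -lnM ?posrE ?mulr_gt0//; apply: ler_wpM2l; first by rewrite ltW// mulr_gt0.
  rewrite ler_ln ?posrE ?mulr_gt0//.
  rewrite mulrCA ler_wpM2l ?(ltW L0)// /q lerDl divr_ge0// ltW//.
have h2 : eps / L * ln eps <= eps / L * ln (L * q x).
  rewrite ler_wpM2l ?divr_ge0 ?(ltW e0) ?(ltW L0)//.
  rewrite ler_ln ?posrE ?mulr_gt0// /q mulrDr [X in _ + X]mulrCA divff ?gt_eqF// mulr1 lerDr.
  by rewrite mulr_ge0 ?(ltW L0)// mulr_ge0// subr_ge0 ltW.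
have e3 : q x * ln (L * q x) = (1 - eps) * p x * ln (L * q x) + eps / L * ln (L * q x).
  by rewrite {1}/q mulrDl.
have e4 : q x = (1 - eps) * p x + eps * L^-1 by [].
rewrite e3 {2}e4.
have e5 : (1 - eps) * (p x * ln (L * p x) - p x + L^-1) + ((1 - eps) * ln (1 - eps) * p x + eps / L * ln eps)
   = (1 - eps) * p x * (ln (1 - eps) + ln (L * p x)) + eps / L * ln eps - (1 - eps) * p x + (1 - eps) * L^-1.
  by ring.
rewrite e5; lra.
Qed.

End mixture.

End density_entropy.

(** * Sections and partial integrals for product measures *)

Section product_fubini.
Set Implicit Arguments.
Unset Strict Implicit.
Context d1 d2 (T1 : measurableType d1) (T2 : measurableType d2) (R : realType).
Variables (m1 : {sigma_finite_measure set T1 -> \bar R}) (m2 : {sigma_finite_measure set T2 -> \bar R}).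
Implicit Types (P : T1 * T2 -> Prop) (f : T1 * T2 -> \bar R).

Lemma ae_sections2 P : {ae (m1 \x m2)%E, forall z, P z} ->
  {ae m2, forall y, {ae m1, forall x, P (x, y)}}.
Proof.
move=> [N [mN N0 h]].
have m1N : measurable_fun setT (EFin \o (\1_N : T1 * T2 -> R)) by exact/measurable_EFinP.
have p0 z : (0 <= (EFin \o (\1_N : T1 * T2 -> R)) z)%E by rewrite lee_fin.
have i0 : (\int[m2]_y fubini_G m1 (EFin \o \1_N) y = 0)%E.
  rewrite -(@fubini_tonelli2 _ _ _ _ R m1 m2 _ m1N p0) /= integral_indic// setIT; exact: N0.
have mG := @measurable_fun_fubini_tonelli_G _ _ _ _ R m1 _ m1N p0.
have : ae_eq m2 setT (fubini_G m1 (EFin \o \1_N)) (cst 0%E).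
  apply/(ae_eq_integral_abs m2 measurableT) => //; rewrite -[RHS]i0.
  by apply: eq_integral => y _; rewrite gee0_abs// integral_ge0.
apply: ae_imp => y /(_ Logic.I) /= h0; exists (ysection N y); split.
- exact: measurable_ysection.
- rewrite -h0 /fubini_G -(setIT (ysection N y)) -integral_indic//; last exact: measurable_ysection.
  by apply: eq_integral => x _ /=; rewrite !indicE mem_ysection.
- by move=> x /= nP; rewrite ysectionE/=; exact: h.
Qed.

Lemma ae_sections1 P : {ae (m1 \x m2)%E, forall z, P z} ->
  {ae m1, forall x, {ae m2, forall y, P (x, y)}}.
Proof.
move=> [N [mN N0 h]].
have m1N : measurable_fun setT (EFin \o (\1_N : T1 * T2 -> R)) by exact/measurable_EFinP.
have p0 z : (0 <= (EFin \o (\1_N : T1 * T2 -> R)) z)%E by rewrite lee_fin.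
have i0 : (\int[m1]_x fubini_F m2 (EFin \o \1_N) x = 0)%E.
  rewrite -(@fubini_tonelli1 _ _ _ _ R m1 m2 _ m1N p0) /= integral_indic// setIT; exact: N0.
have mG := @measurable_fun_fubini_tonelli_F _ _ _ _ R m2 _ m1N p0.
have : ae_eq m1 setT (fubini_F m2 (EFin \o \1_N)) (cst 0%E).
  apply/(ae_eq_integral_abs m1 measurableT) => //; rewrite -[RHS]i0.
  by apply: eq_integral => y _; rewrite gee0_abs// integral_ge0.
apply: ae_imp => x /(_ Logic.I) /= h0; exists (xsection N x); split.
- exact: measurable_xsection.
- rewrite -h0 /fubini_F -(setIT (xsection N x)) -integral_indic//; last exact: measurable_xsection.
  by apply: eq_integral => y _ /=; rewrite !indicE mem_xsection.
- by move=> y /= nP; rewrite xsectionE/=; exact: h.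
Qed.

(** The entropy integrand changes sign, so Tonelli measurability is applied to its positive and
    negative parts. *)
Lemma measurable_partial_integral2 f : measurable_fun setT f ->
  measurable_fun setT (fun y => \int[m1]_x f (x, y))%E.
Proof.
move=> mf; under eq_fun do rewrite integralE.
apply: emeasurable_funB.
- rewrite (_ : (fun x => _) = fubini_G m1 f^\+%E).
    apply: measurable_fun_fubini_tonelli_G; first exact: measurable_funepos.
    by move=> z; exact: funepos_ge0.
  by apply/funext => x; apply: eq_integral => y _; rewrite !funeposE.
- rewrite (_ : (fun x => _) = fubini_G m1 f^\-%E).
    apply: measurable_fun_fubini_tonelli_G; first exact: measurable_funeneg.
    by move=> z; exact: funeneg_ge0.
  by apply/funext => x; apply: eq_integral => y _; rewrite !funenegE.
Qed.

End product_fubini.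

Section product_finite.
Context d1 d2 (T1 : measurableType d1) (T2 : measurableType d2) (R : realType).
Variables (m1 : {finite_measure set T1 -> \bar R}) (m2 : {finite_measure set T2 -> \bar R}).

(* The library already attaches to the product a structure that applies to
   subprobabilities only; the new name carries the one for finite measures. *)
Definition finite_product : set (T1 * T2) -> \bar R := (m1 \x m2)%E.

HB.instance Definition _ := Measure.on finite_product.

Let product_finite : fin_num_fun finite_product.
Proof.
have h : finite_product setT = (m1 setT * m2 setT)%E.
  by rewrite /finite_product -product_measure1E// setXTT.
apply: lty_fin_num_fun; apply: (@le_lt_trans _ _ (m1 setT * m2 setT)%E); first by rewrite -h.
by rewrite -ge0_fin_numE ?mule_ge0// fin_numM// fin_num_measure.
Qed.

HB.instance Definition _ := Measure_isFinite.Build _ _ _ finite_product product_finite.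

End product_finite.

(** * The coupling at a fixed time *)

Section fixed_time.
Set Implicit Arguments.
Unset Strict Implicit.
Context {R : realType} {T : ptopologicalType}.
Variables (L : R) (mu : probability (borel T) R) (nu : probability (measurableTypeR R) R).
Variable A : (borel T -> R) -> (borel T -> R).
Hypotheses (L0 : 0 < L) (hA22 : in_B22 mu A) (hA : graphop mu A).
Variables r Ar : R -> borel T -> R -> R.
Hypotheses (mr : jointly_measurable r) (act : acts_on_xi L mu nu A r Ar).
Hypothesis dr : {ae (mu \x nu)%E, forall z, density L (fun x => r x z.1 z.2)}.
Notation leb := (@lebesgue_measure R).
Local Notation I f := (\int[leb]_(x in torus_itv L) f x).
Local Notation n := (fine (numerical_radius mu A)).
Local Notation m := (torus L \x nu)%E.
Local Notation P := (mu \x nu)%E.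

Let sm : {sigma_finite_measure set _ -> \bar R} := @finite_product _ _ _ _ _ (torus L) nu.

(** By linearity [Ar - A 1 / L] is a version of [A (r - 1 / L)]. At fixed [x] the subtracted term is
    a constant, the one left free in [interaction_derive]. *)
Definition coupling_dist x : R := \int[m]_z `|Ar z.1 x z.2 - A (fun=> 1) x / L|.
Definition unif_dist (z : borel T * measurableTypeR R) : R := I (fun y => `|r y z.1 z.2 - L^-1|).

Local Notation F := coupling_dist.
Local Notation G := unif_dist.

Let H (z : borel T * (measurableTypeR R * measurableTypeR R)) := r z.2.1 z.1 z.2.2 - L^-1.
Let K (z : borel T * (measurableTypeR R * measurableTypeR R)) :=
  Ar z.2.1 z.1 z.2.2 - A (fun=> 1) z.1 / L.

Let rearrange (J : R -> borel T -> R -> R) : jointly_measurable J ->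
  measurable_fun setT (fun z : borel T * (measurableTypeR R * measurableTypeR R) => J z.2.1 z.1 z.2.2).
Proof.
move=> mJ; have mp : measurable_fun setT
    (fun z : borel T * (measurableTypeR R * measurableTypeR R) => (z.2.1, (z.1, z.2.2))).
  apply: measurable_fun_pair; first exact: measurableT_comp.
  by apply: measurable_fun_pair => //; exact: measurableT_comp.
by have := measurableT_comp mJ mp.
Qed.

Let mA1 : measurable_fun setT (A (fun=> 1)).
Proof. exact: L2_measurable (op_L2 hA22 (L2_bounded (one_Loo mu))). Qed.

Let mH : measurable_fun setT H.
Proof. by apply: measurable_funB; [exact: rearrange|exact: measurable_cst]. Qed.

Let mK : measurable_fun setT K.
Proof.
apply: measurable_funB; first by apply: rearrange; case: act.
by apply: measurable_funM => //; exact: measurableT_comp.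
Qed.

Let HK : {ae m, forall z, (fun x => H (x, z)) \in Lfun mu 2%:E /\
  {ae mu, forall x, K (x, z) = A (fun x => H (x, z)) x}}.
Proof.
have o2 := L2_bounded (one_Loo mu); have [_ +] := act.
apply: ae_imp => z [r2 hAr].
have HE : (fun x => H (x, z)) = (fun x => - L^-1 * 1 + r z.1 x z.2).
  by apply/funext => x; rewrite /H/=; ring.
split; first by rewrite HE; exact: L2_comb.
apply: ae_imp2 hAr (op_linear hA22 (- L^-1) o2 r2) => x /(_ Logic.I) /= e1 e2.
by rewrite HE e2 /K /= e1; ring.
Qed.

Let fH x := (\int[m]_z `|H (x, z)|%:E)%E.
Let FK x := (\int[m]_z `|K (x, z)|%:E)%E.
Let ge (z : borel T * measurableTypeR R) := (\int[torus L]_y `|r y z.1 z.2 - L^-1|%:E)%E.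

Let mge : measurable_fun setT ge.
Proof.
apply: (@measurable_partial_integral2 _ _ (measurableTypeR R) _ R (torus L)
  (fun z : measurableTypeR R * (borel T * measurableTypeR R) => `|r z.1 z.2.1 z.2.2 - L^-1|%:E)).
apply/measurable_EFinP/measurableT_comp => //; apply: measurable_funB; first exact: mr.
exact: measurable_cst.
Qed.

Let msec x w : measurable_fun (setT : set (measurableTypeR R)) (fun y => r y x w).
Proof. exact: (measurable_fun_pair1 (x, w) mr). Qed.

Lemma unif_distE z : G z = fine (ge z).
Proof.
rewrite /unif_dist /ge -torus_RintegralE//; apply: measurableT_comp => //.
by apply: measurable_funB => //; exact: measurable_cst.
Qed.

Lemma measurable_unif_dist : measurable_fun setT G.
Proof.
rewrite (_ : unif_dist = fine \o ge); first exact: (measurableT_comp (fine_measurable measurableT)).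
by apply/funext => z; exact: unif_distE.
Qed.

Lemma unif_dist_ge0 z : 0 <= G z.
Proof. exact: Rintegral_ge0. Qed.

Let good : {ae P, forall z, ge z = (G z)%:E /\ G z <= 2}.
Proof.
apply: ae_imp dr => z dz; split; last exact: density_dist_le2.
rewrite unif_distE fineK//; have [c _ _] := dz.
have c1 : continuous (fun y => `|r y z.1 z.2 - L^-1|) by cts.
rewrite /ge torus_integralE; first exact: integrable_fin_num (cint_integrable L c1).
apply/measurable_EFinP/measurableT_comp => //.
by apply: measurable_funB => //; exact: measurable_cst.
Qed.

Lemma unif_dist_le2 : {ae P, forall z, G z <= 2}.
Proof. by apply: ae_imp good => z []. Qed.

Let fHE x : fH x = (\int[nu]_w ge (x, w))%E.
Proof.
rewrite /fH (@fubini_tonelli2 _ _ _ _ R (torus L) nu)//.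
apply/measurable_EFinP/measurableT_comp => //; exact: (measurable_fun_pair2 x mH).
Qed.

Let mfH : measurable_fun setT fH.
Proof. exact: (@kernel_measurable _ _ _ _ sm _ mH). Qed.

Let mFK : measurable_fun setT FK.
Proof. exact: (@kernel_measurable _ _ _ _ sm _ mK). Qed.

Lemma measurable_coupling_dist : measurable_fun setT F.
Proof. exact: (measurableT_comp (fine_measurable measurableT) mFK). Qed.

Lemma coupling_dist_ge0 x : 0 <= F x.
Proof. exact: Rintegral_ge0. Qed.

Let good1 : {ae mu, forall x, {ae nu, forall w, ge (x, w) = (G (x, w))%:E /\ G (x, w) <= 2}}.
Proof. exact: ae_sections1 good. Qed.

Let mG1 x : measurable_fun setT (fun w => G (x, w)).
Proof. exact: (measurable_fun_pair2 x measurable_unif_dist). Qed.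

Let kernel_le : {ae mu, forall x, (fH x <= 2%:E)%E} ->
  {ae mu, forall x, (FK x <= (2 * `|A (fun=> 1) x|)%:E)%E}.
Proof. exact: (@kernel_le_degree _ _ _ _ hA22 hA _ _ sm _ _ mH mK HK). Qed.

Let fH_le2 : {ae mu, forall x, (fH x <= 2%:E)%E}.
Proof.
apply: ae_imp good1 => x gx; rewrite fHE -[leRHS](prob_integral_cst nu).
apply: ae_ge0_le_integral => //.
- by move=> w _; apply: integral_ge0 => y _; rewrite lee_fin.
- exact: (measurable_fun_pair2 x mge).
- by apply: ae_imp gx => w [-> h] _; rewrite lee_fin.
Qed.

Lemma coupling_dist_le : {ae mu, forall x, F x <= 2 * `|A (fun=> 1) x|}.
Proof.
apply: ae_imp (kernel_le fH_le2) => x h.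
rewrite -lee_fin /coupling_dist /Rintegral fineK// ge0_fin_numE; last exact: integral_ge0.
exact: le_lt_trans h (ltry _).
Qed.

(** A version of [fH] with real values in [[0, 2]] everywhere, fit to be the test function in
    [kernel_quadratic]. *)
Let f1 x := if (fH x <= 2%:E)%E then fine (fH x) else 0.

Let f1_le x : 0 <= f1 x <= 2.
Proof.
rewrite /f1; case: ifP => h; last by rewrite lexx/=.
have h0 : (0 <= fH x)%E by apply: integral_ge0.
rewrite fine_ge0//= -lee_fin fineK// ge0_fin_numE//.
exact: le_lt_trans h (ltry _).
Qed.

Let mf1 : measurable_fun setT f1.
Proof.
apply: measurable_fun_ifT; [by apply: measurable_fun_lee| |exact: measurable_cst].
exact: (measurableT_comp (fine_measurable measurableT) mfH).
Qed.

Let f1_Loo : f1 \in Lfun mu +oo%E.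
Proof.
apply: (@bounded_Loo _ _ _ mu _ 2); [exact: mf1|move=> x]; have /andP[h1 h2] := f1_le x; by rewrite ger0_norm.
Qed.

Let f1E : {ae mu, forall x, fH x = (f1 x)%:E}.
Proof.
apply: ae_imp fH_le2 => x h; rewrite /f1 h fineK// ge0_fin_numE; last exact: integral_ge0.
exact: le_lt_trans h (ltry _).
Qed.

Lemma unif_dist_Loo : G \in Lfun P +oo%E.
Proof.
apply: (Linfty_intro (prob_gt0 P) measurable_unif_dist (C := 2)).
by apply: ae_imp unif_dist_le2 => z h; rewrite ger0_norm// unif_dist_ge0.
Qed.

Let int_G : {ae mu, forall x, (\int[nu]_w (G (x, w))%:E)%E = (f1 x)%:E}.
Proof.
apply: ae_imp2 good1 f1E => x gx <-; rewrite fHE; apply: integral_ae_eq.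
- exact/measurable_EFinP.
- exact: (measurable_fun_pair2 x mge).
- by apply: ae_imp gx => w [].
Qed.

(** Jensen's inequality for the probability [nu], from the square of [G - f1 x], where [f1 x] is the
    mean of [G]. *)
Let sqr_f1 : {ae mu, forall x, ((f1 x ^+ 2)%:E <= \int[nu]_w (G (x, w) ^+ 2)%:E)%E}.
Proof.
apply: ae_imp2 int_G good1 => x ix gx.
have G8 : (fun w => G (x, w)) \in Lfun nu +oo%E.
  apply: (Linfty_intro (prob_gt0 nu) _ (C := 2)) => //.
  by apply: ae_imp gx => w [_ h]; rewrite ger0_norm// unif_dist_ge0.
have o8 : (fun=> 1 : R) \in Lfun nu 2%:E by exact: Lfun_cst.
have G2 := L2_bounded G8; have iG2 := Lfun2_integrable_sqr G2.
have iG : nu.-integrable setT (EFin \o (fun w => G (x, w))).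
  by have := L2_mul o8 G2; congr (_.-integrable _ _); apply/funext => w /=; rewrite mul1r.
have e : \int[nu]_w G (x, w) = f1 x by rewrite /Rintegral ix.
rewrite -(fineK (integrable_fin_num measurableT iG2)) lee_fin.
change (f1 x ^+ 2 <= \int[nu]_w (G (x, w) ^+ 2)).
have i1 : nu.-integrable setT (EFin \o (fun w => 2 * f1 x * G (x, w))).
  by rewrite (_ : _ \o _ = fun w => ((2 * f1 x)%:E * (G (x, w))%:E)%E)//; exact: integrableZl.
have i2 : nu.-integrable setT (EFin \o (fun=> f1 x ^+ 2)) by exact: finite_measure_integrable_cst.
have i3 : nu.-integrable setT (EFin \o (fun w => 2 * f1 x * G (x, w) - f1 x ^+ 2)).
  by have := integrableB measurableT i1 i2.
have -> : f1 x ^+ 2 = \int[nu]_w (2 * f1 x * G (x, w) - f1 x ^+ 2).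
  have e2 : \int[nu]_w (f1 x ^+ 2) = f1 x ^+ 2 by rewrite /Rintegral (prob_integral_cst nu).
  rewrite RintegralB// RintegralZl// e e2; ring.
apply: le_Rintegral => // w _.
rewrite -subr_ge0 (_ : _ - _ = (G (x, w) - f1 x) ^+ 2) ?sqr_ge0//; ring.
Qed.

Let FGE : (\int[P]_z (F z.1 * G z)%:E = \int[mu]_x ((f1 x)%:E * FK x))%E.
Proof.
have mFG : measurable_fun setT (fun z : borel T * measurableTypeR R => (F z.1 * G z)%:E).
  apply/measurable_EFinP/measurable_funM; last exact: measurable_unif_dist.
  exact: (measurableT_comp measurable_coupling_dist).
rewrite (@fubini_tonelli1 _ _ _ _ R mu nu _ mFG); last first.
  by move=> z; rewrite lee_fin mulr_ge0 ?coupling_dist_ge0 ?unif_dist_ge0.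
apply: integral_ae_eq.
- apply: measurable_fun_fubini_tonelli_F => // z.
  by rewrite lee_fin mulr_ge0 ?coupling_dist_ge0 ?unif_dist_ge0.
- by apply: emeasurable_funM; [apply/measurable_EFinP; exact: mf1|exact: mFK].
apply: ae_imp2 int_G (kernel_le fH_le2) => x ix Fx.
rewrite /fubini_F /=; under eq_integral do rewrite EFinM.
rewrite ge0_integralZl ?lee_fin ?coupling_dist_ge0//.
- rewrite ix muleC /coupling_dist /Rintegral fineK// ge0_fin_numE; last exact: integral_ge0.
  exact: le_lt_trans Fx (ltry _).
- exact/measurable_EFinP.
- by move=> w _; rewrite lee_fin unif_dist_ge0.
Qed.

(** [coupling_dist] does not depend on the frequency, so integrating [G] over it leaves [f1]. Then
    [kernel_quadratic] applies, and Jensen's inequality returns from [f1] to [G]. *)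
Lemma coupling_unif_le : P.-integrable setT (EFin \o (fun z => F z.1 * G z)) /\
  \int[P]_z (F z.1 * G z) <= n * \int[P]_z (G z ^+ 2).
Proof.
have mFG : measurable_fun setT (fun z : borel T * measurableTypeR R => F z.1 * G z).
  apply: measurable_funM; last exact: measurable_unif_dist.
  exact: (measurableT_comp measurable_coupling_dist).
have FG0 z : 0 <= F z.1 * G z by rewrite mulr_ge0 ?coupling_dist_ge0 ?unif_dist_ge0.
have iG2 := Lfun2_integrable_sqr (L2_bounded unif_dist_Loo).
have if2 := Lfun2_integrable_sqr (L2_bounded f1_Loo).
have f10 x : 0 <= f1 x by have /andP[] := f1_le x.
have n0 : 0 <= n by have [] := numerical_radius_fin hA22 hA.
have S_le : \int[mu]_x (f1 x ^+ 2) <= \int[P]_z (G z ^+ 2).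
  have mG2 : measurable_fun setT (fun z => (G z ^+ 2)%:E).
    by apply/measurable_EFinP/measurable_funX; exact: measurable_unif_dist.
  rewrite /Rintegral; apply: fine_le.
  - exact: (integrable_fin_num measurableT if2).
  - exact: (integrable_fin_num measurableT iG2).
  rewrite (@fubini_tonelli1 _ _ _ _ R mu nu _ mG2); last by move=> z; rewrite lee_fin sqr_ge0.
  apply: ae_ge0_le_integral => //.
  - by move=> x _; rewrite lee_fin sqr_ge0.
  - exact/measurable_EFinP/measurable_funX.
  - by move=> x _; apply: integral_ge0 => w _; rewrite lee_fin sqr_ge0.
  - by apply: measurable_fun_fubini_tonelli_F => // z; rewrite lee_fin sqr_ge0.
  - by apply: ae_imp sqr_f1.
have le1 : (\int[P]_z (F z.1 * G z)%:E <= (n * \int[P]_z (G z ^+ 2))%:E)%E.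
  rewrite FGE; apply: (le_trans (@kernel_quadratic _ _ _ _ hA22 hA _ _ sm _ _ mH mK HK _ f1_Loo f10 f1E)).
  by rewrite lee_fin ler_wpM2l.
have iFG : P.-integrable setT (EFin \o (fun z => F z.1 * G z)).
  apply/integrableP; split; first exact/measurable_EFinP.
  under eq_integral do rewrite gee0_abs ?lee_fin//.
  exact: le_lt_trans le1 (ltry _).
split => //; rewrite -lee_fin; apply: le_trans le1.
by rewrite /Rintegral fineK//; exact: integrable_fin_num iFG.
Qed.

End fixed_time.

(** * The mean entropy *)

Section integrated_dini.
Set Implicit Arguments.
Unset Strict Implicit.
Context d (X : measurableType d) (R : realType) (P : probability X R).
Implicit Types (e k t : R).

Lemma le_Rintegral_ae (f g : X -> R) : P.-integrable setT (EFin \o f) ->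
  P.-integrable setT (EFin \o g) -> {ae P, forall z, f z <= g z} ->
  \int[P]_z f z <= \int[P]_z g z.
Proof.
move=> fi gi fg; rewrite -subr_ge0 -RintegralB//.
have i : P.-integrable setT (EFin \o (fun z => g z - f z)) by have := integrableB measurableT gi fi.
rewrite /Rintegral (@integral_ae_eq _ _ _ P _ (fun z => `|g z - f z|%:E)).
- by rewrite fine_ge0// integral_ge0.
- exact: measurable_int i.
- apply/measurable_EFinP/measurableT_comp => //; apply/measurable_EFinP; exact: measurable_int i.
- by apply: ae_imp fg => z h; rewrite ger0_norm// subr_ge0.
Qed.

(* Reverse Fatou: the one-sided bound [B] passes the upper limit through the integral. *)
Lemma integral_limsup_le (q : R -> X -> R) (phi B : X -> R) t : 0 < t ->
  (forall k, 0 < k -> k < t -> P.-integrable setT (EFin \o q k)) ->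
  P.-integrable setT (EFin \o phi) -> P.-integrable setT (EFin \o B) ->
  {ae P, forall z, forall k, 0 < k -> k < t -> q k z <= B z} ->
  {ae P, forall z, forall e, 0 < e -> exists2 dl, 0 < dl &
    forall k, 0 < k < dl -> k < t -> q k z <= phi z + e} ->
  forall e, 0 < e -> exists2 dl, 0 < dl &
    forall k, 0 < k < dl -> k < t -> \int[P]_z q k z <= \int[P]_z phi z + e.
Proof.
move=> t0 iq iphi iB qB qphi e e0; apply: contrapT => H.
have /choice[k hk] (j : nat) : exists k, [/\ 0 < k, k < t, k < j.+1%:R^-1 &
    \int[P]_z phi z + e < \int[P]_z q k z].
  apply: contrapT => nk; apply: H; exists j.+1%:R^-1; first by rewrite invr_gt0.
  move=> k /andP[k0 kj] kt; rewrite leNgt; apply/negP => lt; apply: nk.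
  by exists k.
(* The positive part of the excess is dominated by [|B| + |phi|], although [q] has no common lower
   bound. *)
pose r j z := Num.max (q (k j) z - phi z) 0.
have iqk j : P.-integrable setT (EFin \o q (k j)) by have [h1 h2 _ _] := hk j; exact: iq.
have mq j : measurable_fun setT (q (k j)) by apply/measurable_EFinP; exact: measurable_int (iqk j).
have mphi : measurable_fun setT phi by apply/measurable_EFinP; exact: measurable_int iphi.
have mr j : measurable_fun setT (r j).
  by apply: measurable_maxr => //; apply: measurable_funB.
have ig : P.-integrable setT (EFin \o (fun z => `|B z| + `|phi z|)).
  by have := integrableD measurableT (integrable_abse iB) (integrable_abse iphi).
have rdom : {ae P, forall z j, setT z -> `|r j z| <= `|B z| + `|phi z|}.
  apply: ae_imp qB => z h j _; have [k0 kt _ _] := hk j; have hB := h _ k0 kt.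
  have h1 := ler_norm (B z); have h2 := ler_norm (- phi z); rewrite normrN in h2.
  have r0 : 0 <= r j z by rewrite le_max lexx orbT.
  rewrite ger0_norm// /r ge_max; apply/andP; split; [lra|exact: addr_ge0].
have rcvg : {ae P, forall z, setT z -> r j z @[j --> \oo] --> (fun=> 0 : R) z}.
  apply: ae_imp qphi => z h _; apply/cvgrPdist_le => e1 e10.
  have [dl dl0 hd] := h _ e10.
  exists (Num.truncn dl^-1).+1 => // j /= hj.
  have [k0 kt kj _] := hk j.
  have jd : j.+1%:R^-1 <= dl.
    have := truncn_itv (ltW (_ : 0 < dl^-1)); rewrite invr_gt0 => /(_ dl0) /andP[_ h1].
    rewrite invf_ple ?posrE//; apply: (le_trans (ltW h1)); rewrite ler_nat.
    exact: leqW.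
  have kdl : 0 < k j < dl by rewrite k0 (lt_le_trans kj).
  have := hd _ kdl kt => h2.
  rewrite sub0r normrN ger0_norm /r; last by rewrite le_max lexx orbT.
  by rewrite ge_max (ltW e10) andbT; lra.
have m0 : measurable_fun setT (fun _ : X => 0 : R) by exact: measurable_cst.
have := @Rintegral_dominated_convergence _ _ _ P _ measurableT r _ _ mr m0 rcvg ig rdom.
rewrite [X in _ --> X](_ : _ = 0); last by rewrite Rintegral_cst// mul0r.
move=> /cvgrPdist_lt/(_ _ e0)[N _ /(_ N (leqnn N))] /=.
rewrite sub0r normrN => /(le_lt_trans (ler_norm _)); have [_ _ _ h] := hk N.
apply/negP; rewrite -leNgt.
have ir : P.-integrable setT (EFin \o r N).
  apply: (@le_integrable _ _ _ P _ measurableT _ (EFin \o (fun z => `|q (k N) z| + `|phi z|))).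
  - exact/measurable_EFinP.
  - move=> z _ /=; rewrite lee_fin ger0_norm; last by rewrite le_max lexx orbT.
    rewrite ger0_norm ?addr_ge0// ge_max addr_ge0// andbT.
    have h1 := ler_norm (q (k N) z); have h2 := ler_norm (- phi z); rewrite normrN in h2; lra.
  - by have := integrableD measurableT (integrable_abse (iqk N)) (integrable_abse iphi).
apply: (@le_trans _ _ (\int[P]_z (q (k N) z - phi z))).
  by rewrite RintegralB//; lra.
apply: le_Rintegral => //.
  by have := integrableB measurableT (iqk N) iphi.
by move=> z _; rewrite /r le_max lexx.
Qed.

End integrated_dini.

Section torus_integral_measurable.
Set Implicit Arguments.
Unset Strict Implicit.
Context {R : realType} {T : ptopologicalType}.
Variables (L : R) (mu : probability (borel T) R) (nu : probability (measurableTypeR R) R).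
Hypothesis L0 : 0 < L.
Notation leb := (@lebesgue_measure R).
Local Notation I f := (\int[leb]_(x in torus_itv L) f x).
Local Notation P := (mu \x nu)%E.
Implicit Type r : R -> borel T -> R -> R.

Lemma measurable_torus_integral r : jointly_measurable r ->
  measurable_fun setT (fun z : borel T * measurableTypeR R => I (fun x => r x z.1 z.2)).
Proof.
move=> mr.
rewrite (_ : (fun z => _) = fine \o (fun z : borel T * measurableTypeR R =>
    \int[torus L]_x (r x z.1 z.2)%:E)%E).
  apply: (measurableT_comp (fine_measurable measurableT)).
  apply: (@measurable_partial_integral2 _ _ (measurableTypeR R) _ R (torus L)
    (fun z : measurableTypeR R * (borel T * measurableTypeR R) => (r z.1 z.2.1 z.2.2)%:E)).
  exact/measurable_EFinP.
apply/funext => z; rewrite -torus_RintegralE//.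
exact: (measurable_fun_pair1 z mr).
Qed.

Lemma jointly_measurable_Phi r : jointly_measurable r ->
  jointly_measurable (fun x xi w => Phi L (r x xi w)).
Proof. by move=> mr; apply: measurable_Phi. Qed.

(** The iterated integral of [entropy] has a signed integrand. For densities the inner integral
    equals that of the nonnegative [Phi], and Tonelli applies to the outer ones. *)
Lemma entropyE r : jointly_measurable r ->
  {ae P, forall z, density L (fun x => r x z.1 z.2)} ->
  entropy L mu nu r = (\int[P]_z (I (fun x => Phi L (r x z.1 z.2)))%:E)%E.
Proof.
move=> mr dr; pose E (z : borel T * measurableTypeR R) := I (fun x => Phi L (r x z.1 z.2)).
have mE : measurable_fun setT (EFin \o E).
  apply/measurable_EFinP; exact: measurable_torus_integral (jointly_measurable_Phi mr).
have E0 z : (0 <= (EFin \o E) z)%E.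
  by rewrite lee_fin; apply: Rintegral_ge0 => x _; exact: Phi_ge0.
pose e (z : borel T * measurableTypeR R) :=
  (\int[torus L]_x (r x z.1 z.2 * ln (r x z.1 z.2 / L^-1))%:E)%E.
have me : measurable_fun setT e.
  apply: (@measurable_partial_integral2 _ _ (measurableTypeR R) _ R (torus L)
    (fun z : measurableTypeR R * (borel T * measurableTypeR R) =>
       (r z.1 z.2.1 z.2.2 * ln (r z.1 z.2.1 z.2.2 / L^-1))%:E)).
  apply/measurable_EFinP/measurable_funM => //.
  by apply: (measurableT_comp (@measurable_ln R)); apply: measurable_funM.
have eE : {ae P, forall z, e z = (E z)%:E}.
  by apply: ae_imp dr => z dz; rewrite /e density_entropyE.
rewrite [RHS](@fubini_tonelli2 _ _ _ _ R mu nu (EFin \o E) mE E0).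
rewrite /entropy; apply: integral_ae_eq.
- exact: (measurable_partial_integral2 mu me).
- exact: (measurable_partial_integral2 mu mE).
apply: ae_imp (ae_sections2 eE) => w h; apply: integral_ae_eq.
- exact: (measurable_fun_pair1 w me).
- exact: (measurable_fun_pair1 w mE).
- by apply: ae_imp h.
Qed.

End torus_integral_measurable.

Section mean_entropy.
Set Implicit Arguments.
Unset Strict Implicit.
Context {R : realType} {T : ptopologicalType}.
Variables (L beta kappa M : R) (mu : probability (borel T) R) (nu : probability (measurableTypeR R) R).
Variable A : (borel T -> R) -> (borel T -> R).
Variables rho Arho : R -> R -> borel T -> R -> R.
Hypotheses (L0 : 0 < L) (beta0 : 0 < beta) (kappa0 : 0 < kappa) (M0 : 0 <= M).
Hypotheses (hA22 : in_B22 mu A) (hA : graphop mu A).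
Notation leb := (@lebesgue_measure R).
Local Notation I f := (\int[leb]_(x in torus_itv L) f x).
Local Notation P := (mu \x nu)%E.
Local Notation n := (fine (numerical_radius mu A)).
Local Notation u z := (fun t x => rho t x z.1 z.2).
Local Notation F t := (coupling_dist L nu A (Arho t)).
Implicit Types (t s e k eps : R) (z : borel T * measurableTypeR R).
Hypothesis mrho : forall t, 0 <= t -> jointly_measurable (rho t).
Hypothesis act : forall t, 0 < t -> acts_on_xi L mu nu A (rho t) (Arho t).
Hypothesis Hflow : {ae P, forall z, exists du ux uxx V V',
  flow L beta kappa z.2 (u z) du ux uxx V V' (fun t => M * F t z.1)}.
Hypothesis iE0 : P.-integrable setT (fun z => (I (fun x => Phi L (rho 0 x z.1 z.2)))%:E).

Local Notation a := (4 * pi ^+ 2 / (L ^+ 2 * beta)).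

Lemma ae_density : {ae P, forall z, forall t, 0 <= t -> density L (u z t)}.
Proof.
apply: ae_imp Hflow => z [du [ux [uxx [V [V' fl]]]]] t t0; split.
- exact: flow_cu fl _ t0.
- exact: (flow_ge0 L0 beta0 kappa0 fl t0).
- exact: (flow_mass L0 fl t0).
Qed.

Lemma a_ge0 : 0 <= a.
Proof.
by apply: divr_ge0; [rewrite mulr_ge0 ?sqr_ge0|rewrite mulr_ge0 ?sqr_ge0// ltW].
Qed.

Let denst t : 0 <= t -> {ae P, forall z, density L (fun x => rho t x z.1 z.2)}.
Proof. by move=> t0; apply: ae_imp ae_density => z; apply. Qed.

(** A bound for the entropy production independent of time. The factor [4] is [2] from
    [coupling_dist_le] times the largest [L^1] distance [2] between densities. *)
Definition degree_bound z : R := 4 * kappa * M * `|A (fun=> 1) z.1|.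
Local Notation Bd := degree_bound.

Lemma degree_bound_integrable : P.-integrable setT (EFin \o Bd).
Proof.
have A12 := op_L2 hA22 (L2_bounded (one_Loo mu)); have o2 := L2_bounded (one_Loo mu).
have i1 : mu.-integrable setT (EFin \o (fun x => `|A (fun=> 1) x|)).
  by have := L2_mul o2 (L2_abs A12); congr (_.-integrable _ _); apply/funext => x /=; rewrite mul1r.
have mA : measurable_fun setT (fun z : borel T * measurableTypeR R => `|A (fun=> 1) z.1|%:E).
  apply/measurable_EFinP.
  apply: (@measurableT_comp _ _ _ _ _ _ (fun x => `|A (fun=> 1) x|) _ fst) => //.
  by apply: measurableT_comp => //; exact: L2_measurable A12.
have iA : P.-integrable setT (fun z => `|A (fun=> 1) z.1|%:E).
  apply/integrableP; split => //.
  rewrite (@fubini_tonelli1 _ _ _ _ R mu nu) //; last exact: measurableT_comp.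
  rewrite (_ : (\int[mu]_x _)%E = (\int[mu]_x `|(EFin \o (fun x => `|A (fun=> 1) x|)%R) x|)%E).
    by have /integrableP[] := i1.
  by apply: eq_integral => x _; rewrite /fubini_F/= (prob_integral_cst nu).
rewrite (_ : _ \o _ = fun z => ((4 * kappa * M)%:E * `|A (fun=> 1) z.1|%:E)%E)//.
exact: integrableZl.
Qed.

Let rat_time (i j : nat) : R := i.+1%:R / j.+1%:R.

Let rat_time_dense t dl : 0 < t -> 0 < dl -> exists i j, `|rat_time i j - t| < dl.
Proof.
move=> t0 dl0; pose j := (Num.truncn dl^-1).+1.
have jd : j.+1%:R^-1 < dl.
  have := truncn_itv (ltW (_ : 0 < dl^-1)); rewrite invr_gt0 => /(_ dl0) /andP[_ h1].
  by rewrite invf_plt ?posrE//; apply: (lt_trans h1); rewrite ltr_nat.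
have j0 : 0 < j.+1%:R :> R by [].
have tj : 0 <= t * j.+1%:R by rewrite mulr_ge0// ltW.
have /andP[h1 h2] := truncn_itv tj.
exists (Num.truncn (t * j.+1%:R)), j; rewrite /rat_time.
set i := Num.truncn _ in h1 h2 *.
have e : t < i.+1%:R / j.+1%:R by rewrite ltr_pdivlMr.
rewrite ger0_norm ?subr_ge0 1?ltW//; apply: le_lt_trans jd.
rewrite lerBlDr -natr1 mulrDl mul1r addrC lerD2l ler_pdivrMr//.
Qed.

Let ae_coupling : {ae P, forall z, forall i j, F (rat_time i j) z.1 <= 2 * `|A (fun=> 1) z.1|}.
Proof.
apply/ae_foralln => i; apply/ae_foralln => j.
have t0 : 0 < rat_time i j by rewrite divr_gt0.
apply: (@ae_fst _ _ _ _ _ mu nu (fun x => F (rat_time i j) x <= 2 * `|A (fun=> 1) x|)).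
exact: (coupling_dist_le L0 hA22 hA (mrho (ltW t0)) (act t0) (denst (ltW t0))).
Qed.

Section mixture.
Variable eps : R.
Hypothesis eps01 : 0 < eps < 1.

Local Notation h t := (fun z => mix_entropy L (u z) eps t).
Local Notation alpha := (a - 2 * kappa * M * n / (1 - eps)).

Let e1 : 0 < 1 - eps. Proof. by have /andP[_] := eps01; rewrite subr_gt0. Qed.

Lemma measurable_mix_entropy t : 0 <= t -> measurable_fun setT (h t).
Proof.
move=> t0.
apply: (@measurable_torus_integral _ _ L ( fun x xi w => Phi L ((1 - eps) * rho t x xi w + eps / L))).
apply: jointly_measurable_Phi; apply: measurable_funD; last exact: measurable_cst.
by apply: measurable_funM; [exact: measurable_cst|exact: mrho].
Qed.

(* The bound on F(t) holds for a.e. xi with t fixed: use it at rational times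
   and the continuity in t of the entropy production. *)
Lemma ae_mix_entropy_lipschitz : {ae P, forall z, forall s t, 0 <= s -> s <= t ->
  h t z - h s z <= Bd z * (t - s)}.
Proof.
apply: (@ae_imp2 _ _ _ P _ _ _ _ Hflow ae_coupling) => z [du [ux [uxx [V [V' fl]]]]] cz s t s0 st.
apply: (mix_entropy_lipschitz L0 beta0 kappa0 fl eps01) => // tau tau0.
apply: (@le_addgt0 _ _ _ 1) => e e0; rewrite mulr1.
have [dl dl0 hd] := mix_rate_cont L0 beta0 kappa0 fl eps01 tau0 e0.
have [i [j ij]] := rat_time_dense tau0 dl0.
have t0 : 0 < rat_time i j by rewrite divr_gt0.
have := hd _ t0 ij; rewrite ler_norml => /andP[r1 r2].
have := mix_rate_le L0 beta0 kappa0 fl eps01 t0 => r3.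
have du' : density L (u z (rat_time i j)).
  split; [exact: flow_cu fl _ (ltW t0)|exact: (flow_ge0 L0 beta0 kappa0 fl (ltW t0))|].
  exact: (flow_mass L0 fl (ltW t0)).
have d2 : mix_dist L (u z) eps (rat_time i j) <= 2 := density_dist_le2 L0 (density_mix L0 du' eps01).
have d0 : 0 <= mix_dist L (u z) eps (rat_time i j) by exact: Rintegral_ge0.
have h0 := mix_entropy_ge0 L0 (u z) eps (rat_time i j).
have ah0 := mulr_ge0 a_ge0 h0.
have r4 : kappa * (M * F (rat_time i j) z.1) * mix_dist L (u z) eps (rat_time i j) <= Bd z.
  rewrite (_ : Bd z = kappa * (M * (2 * `|A (fun=> 1) z.1|)) * 2); last by rewrite /degree_bound; ring.
  apply: ler_pM => //.
    by rewrite mulr_ge0 ?(ltW kappa0)// mulr_ge0// coupling_dist_ge0.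
  by rewrite ler_wpM2l ?(ltW kappa0)// ler_wpM2l.
rewrite mulNr in r3; lra.
Qed.

(** Dominated by the initial entropy, which mixing does not increase, plus [t] times
    [degree_bound]. *)
Lemma mix_entropy_integrable t : 0 <= t -> P.-integrable setT (EFin \o h t).
Proof.
move=> t0.
have ib : P.-integrable setT (EFin \o (fun z => I (fun x => Phi L (rho 0 x z.1 z.2)) + t * Bd z)).
  have i2 : P.-integrable setT (EFin \o (fun z => t * Bd z)).
    rewrite (_ : _ \o _ = fun z => (t%:E * (Bd z)%:E)%E)//.
    by apply: integrableZl => //; exact: degree_bound_integrable.
  by have := integrableD measurableT iE0 i2.
have mh : measurable_fun setT (EFin \o h t) by apply/measurable_EFinP; exact: measurable_mix_entropy.
apply/integrableP; split => //; have /integrableP[mb fb] := ib; apply: le_lt_trans fb.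
apply: ae_ge0_le_integral => //; [exact: measurableT_comp|exact: measurableT_comp|].
apply: (@ae_imp2 _ _ _ P _ _ _ _ ae_density ae_mix_entropy_lipschitz) => z dz lz _ /=.
have h0 := mix_entropy_ge0 L0 (u z) eps t.
rewrite lee_fin ger0_norm// (le_trans _ (ler_norm _))//.
have := lz 0 t (lexx _) t0; rewrite subr0 mulrC => l1.
have : mix_entropy L (u z) eps 0 <= I (fun x => Phi L (rho 0 x z.1 z.2)).
  exact: (mix_Phi_le L0 (dz 0 (lexx _)) eps01).
lra.
Qed.

Definition mean_mix_entropy t : R := \int[P]_z h t z.
Local Notation y := mean_mix_entropy.

Lemma mean_mix_entropy_ge0 t : 0 <= y t.
Proof. by apply: Rintegral_ge0 => z _; exact: mix_entropy_ge0. Qed.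

Lemma mean_mix_entropy_lipschitz s t : 0 <= s -> s <= t ->
  y t - y s <= (\int[P]_z Bd z) * (t - s).
Proof.
move=> s0 st; have t0 := le_trans s0 st.
have it := mix_entropy_integrable t0; have i0 := mix_entropy_integrable s0.
have iB := degree_bound_integrable.
rewrite /mean_mix_entropy -RintegralB// -RintegralZr//.
apply: le_Rintegral_ae.
- exact: (integrableB measurableT it i0).
- exact: (integrableZr measurableT (t - s) iB).
- by apply: ae_imp ae_mix_entropy_lipschitz => z hz; exact: hz.
Qed.

(** [integral_limsup_le], dominated by [degree_bound], integrates the pointwise rate [phi]; the
    coupling term can be closed by [coupling_unif_le] only after this integration. *)
Lemma mean_mix_entropy_dini t : 0 < t -> forall e, 0 < e -> exists2 dl, 0 < dl &
  forall k, 0 < k < dl -> k < t -> y t - y (t - k) <= (- alpha * y t + e) * k.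
Proof.
move=> t0 e e0; have t0' := ltW t0.
have ih := mix_entropy_integrable t0'.
have dt := denst t0'.
pose G := unif_dist L (rho t).
have [iFG FG] := coupling_unif_le L0 hA22 hA (mrho t0') (act t0) dt.
have G8 := unif_dist_Loo L0 (mrho t0') dt.
have iG2 := Lfun2_integrable_sqr (L2_bounded G8).
pose phi z := - a * h t z + kappa * M * (1 - eps) * (F t z.1 * G z).
pose q k z := k^-1 * (h t z - h (t - k) z).
have i1 : P.-integrable setT (EFin \o (fun z => - a * h t z)).
  by rewrite (_ : _ \o _ = fun z => ((- a)%:E * (h t z)%:E)%E)//; exact: integrableZl.
have i2 : P.-integrable setT (EFin \o (fun z => kappa * M * (1 - eps) * (F t z.1 * G z))).
  rewrite (_ : _ \o _ = fun z => ((kappa * M * (1 - eps))%:E * (F t z.1 * G z)%:E)%E)//.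
  exact: integrableZl.
have iphi : P.-integrable setT (EFin \o phi) by have := integrableD measurableT i1 i2.
have itk k : 0 < k -> k < t -> P.-integrable setT (EFin \o h (t - k)).
  by move=> k0 kt; apply: mix_entropy_integrable; rewrite subr_ge0 ltW.
have iq k : 0 < k -> k < t -> P.-integrable setT (EFin \o q k).
  move=> k0 kt; rewrite (_ : _ \o _ = fun z => ((k^-1)%:E * ((h t z)%:E - (h (t - k) z)%:E))%E)//.
  by apply: integrableZl => //; exact: integrableB (itk k k0 kt).
have qB : {ae P, forall z, forall k, 0 < k -> k < t -> q k z <= Bd z}.
  apply: ae_imp ae_mix_entropy_lipschitz => z hz k k0 kt.
  rewrite /q ler_pdivrMl// mulrC; have tk0 : 0 <= t - k by rewrite subr_ge0 ltW.
  have tkt : t - k <= t by rewrite gerBl ltW.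
  by have := hz _ _ tk0 tkt; rewrite (subKr t k).
have qphi : {ae P, forall z, forall e, 0 < e -> exists2 dl, 0 < dl &
    forall k, 0 < k < dl -> k < t -> q k z <= phi z + e}.
  apply: (@ae_imp2 _ _ _ P _ _ _ _ Hflow dt) => z [du [ux [uxx [V [V' fl]]]]] dz e' e'0.
  have [dl dl0 hd] := mix_entropy_dini L0 beta0 kappa0 fl eps01 t0 e'0.
  exists dl => // k kd kt; have /andP[k0 _] := kd.
  rewrite /q ler_pdivrMl// mulrC; apply: (le_trans (hd k kd kt)).
  apply: ler_wpM2r; first exact: ltW.
  rewrite lerD2r; apply: (le_trans (mix_rate_le L0 beta0 kappa0 fl eps01 t0)).
  rewrite /phi lerD2l.
  have -> : mix_dist L (u z) eps t = (1 - eps) * G z := mix_distE dz eps01.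
  by rewrite le_eqVlt; apply/orP; left; apply/eqP; ring.
have [dl dl0 hd] := integral_limsup_le t0 iq iphi degree_bound_integrable qB qphi e0.
exists dl => // k kd kt; have /andP[k0 _] := kd.
have := hd k kd kt.
have -> : \int[P]_z q k z = k^-1 * (y t - y (t - k)).
  rewrite /q RintegralZl//; last by have := integrableB measurableT ih (itk k k0 kt).
  by rewrite RintegralB//; exact: itk.
rewrite ler_pdivrMl// mulrC => /le_trans; apply.
apply: ler_wpM2r; first exact: ltW.
rewrite lerD2r.
have -> : \int[P]_z phi z = - a * y t + kappa * M * (1 - eps) * \int[P]_z (F t z.1 * G z).
  by rewrite /phi RintegralD// RintegralZl// RintegralZl.
have n0 : 0 <= n by have [] := numerical_radius_fin hA22 hA.
have g2 : (1 - eps) ^+ 2 * \int[P]_z (G z ^+ 2) <= 2 * y t.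
  have j1 : P.-integrable setT (EFin \o (fun z => (1 - eps) ^+ 2 * G z ^+ 2)).
    rewrite (_ : _ \o _ = fun z => (((1 - eps) ^+ 2)%:E * (G z ^+ 2)%:E)%E)//.
    exact: integrableZl.
  have j2 : P.-integrable setT (EFin \o (fun z => 2 * h t z)).
    by rewrite (_ : _ \o _ = fun z => (2%:E * (h t z)%:E)%E)//; exact: integrableZl.
  rewrite -RintegralZl// -RintegralZl//; apply: le_Rintegral_ae => //.
  apply: (@ae_imp2 _ _ _ P _ _ _ _ Hflow dt) => z [du [ux [uxx [V [V' fl]]]]] dz.
  rewrite -exprMn; have := mix_pinsker L0 beta0 kappa0 fl eps01 t0'.
  by have -> : mix_dist L (u z) eps t = (1 - eps) * G z := mix_distE dz eps01.
have -> : - alpha * y t = - a * y t + 2 * kappa * M * n / (1 - eps) * y t by ring.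
rewrite lerD2l.
apply: (@le_trans _ _ (kappa * M * (1 - eps) * (n * \int[P]_z (G z ^+ 2)))).
  by rewrite ler_wpM2l// !mulr_ge0// ltW.
have e1n : 1 - eps != 0 by rewrite gt_eqF.
(* Only one of the two factors of the coupling term carries [1 - eps], while Pinsker's inequality
   bounds the square of the mixed distance: this is where [1 / (1 - eps)] enters. *)
rewrite (_ : kappa * M * (1 - eps) * _ =
  kappa * M * n / (1 - eps) * ((1 - eps) ^+ 2 * \int[P]_z (G z ^+ 2))); last by field.
rewrite (_ : 2 * kappa * M * n / (1 - eps) * y t = kappa * M * n / (1 - eps) * (2 * y t)); last by field.
by apply: ler_wpM2l => //; rewrite divr_ge0 ?(ltW e1)// !mulr_ge0// ltW.
Qed.

End mixture.
End mean_entropy.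

(** * Gronwall's inequality and removal of the mixture *)

Section exponential_decay.
Set Implicit Arguments.
Unset Strict Implicit.
Context {R : realType}.
Implicit Types (t s e k r al C T : R).

(** The Dini criterion for [expR (al * t) * y t]; the one-sided Lipschitz bound excludes upward
    jumps. *)
Lemma gronwall_dini (y : R -> R) al C : 0 <= al -> (forall t, 0 <= y t) ->
  (forall s t, 0 <= s -> s <= t -> y t - y s <= C * (t - s)) ->
  (forall t, 0 < t -> forall e, 0 < e -> exists2 dl, 0 < dl &
     forall k, 0 < k < dl -> k < t -> y t - y (t - k) <= (- al * y t + e) * k) ->
  forall T, 0 <= T -> y T <= expR (- al * T) * y 0.
Proof.
move=> al0 y0 yC dini T T0.
suff : expR (al * T) * y T <= expR (al * 0) * y 0.
  rewrite mulr0 expR0 mul1r mulNr expRN => h.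
  by rewrite mulrC ler_pdivlMr ?expR_gt0// mulrC.
apply: (@left_dini_le0 _ (fun t => expR (al * t) * y t)) => //.
(* A continuous function that dominates the product to the right of [s] and agrees with it at
   [s]. *)
- move=> s s0 e e0; pose psi r := expR (al * r) * (y s + C * (r - s)).
  have cpsi : continuous psi.
    have cid : continuous (fun r : R => r) by move=> ?; exact: cvg_id.
    by rewrite /psi; cts.
  have /cvgrPdist_le/(_ _ e0) := cpsi s.
  move=> H0; have H : nbhs s (fun r => `|psi s - psi r| <= e) by exact: H0.
  move: H => /nbhs_ballP[d /= d0 hd]; exists d => // r /andP[sr rd].
  have := hd r; rewrite /ball/= distrC => h.
  have {}h : `|psi r - psi s| <= e by rewrite distrC; apply: h; rewrite ger0_norm; lra.
  have h1 : expR (al * r) * y r <= psi r.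
    by rewrite /psi ler_pM2l ?expR_gt0//; have := yC s r s0 (ltW sr); lra.
  have h2 : psi s = expR (al * s) * y s by rewrite /psi subrr mulr0 addr0.
  by rewrite -h2; have := ler_norm (psi r - psi s); lra.
- move=> t t0 e e0; pose E := expR (al * t); have E0 : 0 < E by exact: expR_gt0.
  have e2 : 0 < e / (2 * E) by rewrite divr_gt0// mulr_gt0.
  have [dl dl0 hd] := dini t t0 _ e2.
  pose W := al ^+ 2 * y t * E + 1.
  have W0 : 0 < W by rewrite ltr_wpDl// !mulr_ge0 ?sqr_ge0// ltW.
  exists (Num.min dl (e / (2 * W))); first by rewrite lt_min dl0 divr_gt0// mulr_gt0.
  move=> k /andP[k0]; rewrite lt_min => /andP[kdl kW] kt.
  have kk : 0 < k < dl by rewrite k0 kdl.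
  have := hd k kk kt => h.
  pose G := expR (al * (t - k)).
  have G0 : 0 < G by exact: expR_gt0.
  have GE : G = E * expR (- (al * k)) by rewrite /G /E mulrBr expRD.
  have q1 : 1 - al * k <= expR (- (al * k)) by have := expR_ge1Dx (- (al * k)); lra.
  have ak0 : 0 <= al * k by rewrite mulr_ge0// ltW.
  have q2 : expR (- (al * k)) <= 1 by rewrite -[leRHS]expR0 ler_expR oppr_le0.
  have GleE : G <= E by rewrite GE -[leRHS]mulr1 ler_pM2l.
  have EG : E - G <= E * (al * k).
    rewrite GE -[X in X - _]mulr1 -mulrBr ler_pM2l//; lra.
  have r1 : G * (y t - y (t - k)) <= G * ((- al * y t + e / (2 * E)) * k) by rewrite ler_pM2l.
  have r2 : G * (e / (2 * E)) <= e / 2.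
    have En : E != 0 by rewrite gt_eqF.
    rewrite (_ : e / 2 = E * (e / (2 * E))); last by field.
    by rewrite ler_wpM2r// ltW.
  have r3 : al * y t * (E - G) <= al ^+ 2 * y t * E * k.
    rewrite (_ : al ^+ 2 * y t * E * k = al * y t * (E * (al * k))); last by ring.
    by rewrite ler_wpM2l// mulr_ge0.
  have r4 : al ^+ 2 * y t * E * k <= e / 2.
    apply: (@le_trans _ _ (W * k)); first by rewrite ler_wpM2r ?(ltW k0)// /W; lra.
    have Wn : W != 0 by rewrite gt_eqF.
    rewrite (_ : e / 2 = W * (e / (2 * W))); last by field.
    by rewrite ler_wpM2l// ltW.
  rewrite -/E -/G.
  have -> : E * y t - G * y (t - k) = G * (y t - y (t - k)) + y t * (E - G) by ring.
  have r5 : y t * (E - G) <= y t * (al * k * E).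
    by rewrite ler_wpM2l// (le_trans EG)// mulrC.
  have r6 : (G * (e / (2 * E)) + al * y t * (E - G)) * k <= e * k.
    by rewrite ler_wpM2r ?(ltW k0)//; lra.
  apply: (le_trans (lerD r1 r5)); apply: le_trans r6.
  by rewrite le_eqVlt; apply/orP; left; apply/eqP; ring.
Qed.

(** [ln y <= y - 1] at [y = 1 / (1 - s ^+ 2)] and at [y = 1 / s]. Taking [eps = s ^+ 2] bounds the
    defect of [mix_Phi_ge] by a polynomial in [s], so that the limit needs only continuity. *)
Lemma mix_defect_ge s : 0 < s -> s < 1 ->
  - (s ^+ 2 + 2 * s) <= (1 - s ^+ 2) * ln (1 - s ^+ 2) + s ^+ 2 * ln (s ^+ 2).
Proof.
move=> s0 s1; have s2 : 0 < s ^+ 2 by rewrite exprn_gt0.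
have s21 : s ^+ 2 < 1 by rewrite exprn_ilt1// ltW.
have e0 : 0 < 1 - s ^+ 2 by rewrite subr_gt0.
have en : 1 - s ^+ 2 != 0 by rewrite gt_eqF.
have sn : s != 0 by rewrite gt_eqF.
have h1 : - s ^+ 2 <= (1 - s ^+ 2) * ln (1 - s ^+ 2).
  have ei : 0 < (1 - s ^+ 2)^-1 by rewrite invr_gt0.
  have := ln_le_sub1 ei; rewrite lnV ?posrE// => h.
  have := ler_wpM2l (ltW e0) h.
  rewrite mulrN mulrBr mulfV// mulr1; lra.
have h2 : - (2 * s) <= s ^+ 2 * ln (s ^+ 2).
  have si : 0 < s^-1 by rewrite invr_gt0.
  have := ln_le_sub1 si; rewrite lnV ?posrE// => h.
  have := ler_wpM2l (ltW s2) h.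
  rewrite mulrN (_ : s ^+ 2 * (s^-1 - 1) = s - s ^+ 2) => [h3|]; last by field.
  rewrite {2}expr2 lnM ?posrE// mulrDr; lra.
lra.
Qed.

(* Let [s] tend to [0+]. *)
Lemma decay_limit (a b T E0 ET : R) : 0 < a - b -> 0 <= b -> 0 <= T -> 0 <= E0 ->
  (forall s, 0 < s -> s < 1 -> 0 <= a - b / (1 - s ^+ 2) ->
     (1 - s ^+ 2) * ET - (s ^+ 2 + 2 * s) <= expR (- (a - b / (1 - s ^+ 2)) * T) * E0) ->
  ET <= expR (- (a - b) * T) * E0.
Proof.
move=> ab b0 T0 E00 H; rewrite leNgt; apply/negP => lt.
have cid : continuous (fun r : R => r) by move=> ?; exact: cvg_id.
(* A polynomial lower bound for [a - b / (1 - s ^+ 2)], valid for small [s] and exact at [0]; it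
   keeps [Psi] free of quotients. *)
pose al s := a - b * (1 + 2 * s ^+ 2).
pose Psi s := (1 - s ^+ 2) * ET - (s ^+ 2 + 2 * s) - expR (- al s * T) * E0.
have cal : continuous al by rewrite /al; cts.
have cPsi : continuous Psi by rewrite /Psi; cts.
have al0 : 0 < al 0 by rewrite /al expr0n/= mulr0 addr0 mulr1.
have Psi0 : 0 < Psi 0.
  rewrite /Psi (_ : al 0 = a - b); last by rewrite /al expr0n/= mulr0 addr0 mulr1.
  by rewrite expr0n/= mulr0 subr0 addr0 subr0 mul1r subr_gt0.
have H1 : nbhs (0 : R) (fun r => 0 < al r) by exact: (cvgr_gt _ (cal 0) _ al0).
have H2 : nbhs (0 : R) (fun r => 0 < Psi r) by exact: (cvgr_gt _ (cPsi 0) _ Psi0).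
have : nbhs (0 : R) (fun r => 0 < al r /\ 0 < Psi r) by exact: filterI.
move=> /nbhs_ballP[d /= d0 hd].
pose s := Num.min (d / 2) (1 / 2).
have s0 : 0 < s by rewrite lt_min !divr_gt0.
have sd2 : s <= d / 2 by rewrite ge_min lexx.
have sd : s < d by lra.
have sh : s <= 1 / 2 by rewrite ge_min lexx orbT.
have [als Psis] : 0 < al s /\ 0 < Psi s.
  by apply: hd; rewrite /ball/= sub0r normrN ger0_norm// ltW.
have s2 : s ^+ 2 <= 1 / 4.
  have ss : s * s <= (1 / 2) * (1 / 2) by apply: ler_pM => //; exact: ltW.
  by rewrite expr2; lra.
have s20 : 0 <= s ^+ 2 by exact: sqr_ge0.
have e0 : 0 < 1 - s ^+ 2 by lra.
have inv : (1 - s ^+ 2)^-1 <= 1 + 2 * s ^+ 2.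
  rewrite -[leLHS]mul1r ler_pdivrMr//.
  have : 0 <= s ^+ 2 * (1 / 4 - s ^+ 2) by rewrite mulr_ge0//; lra.
  lra.
have alle : al s <= a - b / (1 - s ^+ 2).
  by rewrite /al lerD2l lerN2 ler_wpM2l.
have s1 : s < 1 by lra.
have := H s s0 s1 (le_trans (ltW als) alle).
have : expR (- (a - b / (1 - s ^+ 2)) * T) * E0 <= expR (- al s * T) * E0.
  by rewrite ler_wpM2r// ler_expR ler_wpM2r// lerN2.
move: Psis; rewrite /Psi; lra.
Qed.

End exponential_decay.

Lemma prob_integrable_cst d (X : measurableType d) (R : realType) (P : probability X R) (c : R) :
  P.-integrable setT (EFin \o (fun=> c)).
Proof. exact: finite_measure_integrable_cst. Qed.

Section mean_entropy_decay.
Set Implicit Arguments.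
Unset Strict Implicit.
Context {R : realType} {T : ptopologicalType}.
Variables (L beta kappa M : R) (mu : probability (borel T) R) (nu : probability (measurableTypeR R) R).
Variable A : (borel T -> R) -> (borel T -> R).
Variables rho Arho : R -> R -> borel T -> R -> R.
Hypotheses (L0 : 0 < L) (beta0 : 0 < beta) (kappa0 : 0 < kappa) (M0 : 0 <= M).
Hypotheses (hA22 : in_B22 mu A) (hA : graphop mu A).
Notation leb := (@lebesgue_measure R).
Local Notation I f := (\int[leb]_(x in torus_itv L) f x).
Local Notation P := (mu \x nu)%E.
Local Notation n := (fine (numerical_radius mu A)).
Local Notation u z := (fun t x => rho t x z.1 z.2).
Local Notation F t := (coupling_dist L nu A (Arho t)).
Local Notation a := (4 * pi ^+ 2 / (L ^+ 2 * beta)).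
Implicit Types (t s : R) (z : borel T * measurableTypeR R).
Hypothesis mrho : forall t, 0 <= t -> jointly_measurable (rho t).
Hypothesis act : forall t, 0 < t -> acts_on_xi L mu nu A (rho t) (Arho t).
Hypothesis Hflow : {ae P, forall z, exists du ux uxx V V',
  flow L beta kappa z.2 (u z) du ux uxx V V' (fun t => M * F t z.1)}.
Hypothesis alpha_gt0 : 0 < a - 2 * kappa * M * n.

Let E t z : R := I (fun x => Phi L (rho t x z.1 z.2)).

Lemma mean_entropyE t : 0 <= t -> entropy L mu nu (rho t) = (\int[P]_z (E t z)%:E)%E.
Proof.
move=> t0; apply: entropyE => //; first exact: mrho.
by apply: ae_imp (ae_density L0 beta0 kappa0 Hflow) => z; apply.
Qed.

Let mE t : 0 <= t -> measurable_fun setT (E t).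
Proof.
move=> t0; apply: (@measurable_torus_integral _ _ L (fun x xi w => Phi L (rho t x xi w))).
exact: (jointly_measurable_Phi L (mrho t0)).
Qed.

Let E_ge0 t z : 0 <= E t z.
Proof. by apply: Rintegral_ge0 => x _; exact: Phi_ge0. Qed.

Hypothesis fin0 : (entropy L mu nu (rho 0) < +oo)%E.

Let iE0 : P.-integrable setT (fun z => (E 0 z)%:E).
Proof.
apply/integrableP; split; first by apply/measurable_EFinP; exact: mE.
move: fin0; rewrite mean_entropyE//; congr (_ < _)%E.
by apply: eq_integral => z _; rewrite gee0_abs ?lee_fin.
Qed.

Let mix_lower eps : 0 < eps < 1 -> forall t, 0 <= t -> {ae P, forall z,
  (1 - eps) * E t z + ((1 - eps) * ln (1 - eps) + eps * ln eps) <= mix_entropy L (u z) eps t}.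
Proof.
move=> eps01 t t0; apply: ae_imp (ae_density L0 beta0 kappa0 Hflow) => z dz.
exact: (mix_Phi_ge L0 (dz t t0) eps01).
Qed.

(** Only the initial entropy is known to be finite. At later times [mix_lower] with [eps = 1 / 2]
    bounds the entropy by twice the mixed one up to a constant. *)
Let iE t : 0 <= t -> P.-integrable setT (fun z => (E t z)%:E).
Proof.
move=> t0; have e01 : 0 < (1 / 2 : R) < 1 by apply/andP; split; lra.
pose c : R := (1 - 1 / 2) * ln (1 - 1 / 2) + (1 / 2) * ln (1 / 2).
have ih := mix_entropy_integrable L0 beta0 kappa0 M0 hA22 hA mrho act Hflow iE0 e01 t0.
have ic : P.-integrable setT (EFin \o (fun=> c)) by exact: prob_integrable_cst.
have ib : P.-integrable setT (fun z => (2%:E * ((mix_entropy L (u z) (1 / 2) t)%:E - c%:E))%E).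
  by apply: integrableZl => //; exact: integrableB ih ic.
have mEt : measurable_fun setT (EFin \o E t) by apply/measurable_EFinP; exact: mE.
apply/integrableP; split => //; have /integrableP[mb fb] := ib; apply: le_lt_trans fb.
apply: ae_ge0_le_integral => //; [exact: measurableT_comp|exact: measurableT_comp|].
apply: ae_imp (mix_lower e01 t0) => z; rewrite -/c => hz _ /=.
by rewrite lee_fin ger0_norm// (le_trans _ (ler_norm _))//; lra.
Qed.

(** Mixing with [eps = s ^+ 2] lowers the initial entropy and costs a vanishing defect at time [t],
    so the decay of the mixed entropy passes to the limit. *)
Lemma mean_entropy_decay t : 0 <= t ->
  (entropy L mu nu (rho t) <=
   (expR (- (a - 2 * kappa * M * n) * t))%:E * entropy L mu nu (rho 0))%E.
Proof.
move=> t0; rewrite !mean_entropyE//.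
rewrite -(fineK (integrable_fin_num measurableT (iE t0))).
rewrite -(fineK (integrable_fin_num measurableT iE0)) -EFinM lee_fin.
change (\int[P]_z E t z <= expR (- (a - 2 * kappa * M * n) * t) * \int[P]_z E 0 z).
have [n0 _] := numerical_radius_fin hA22 hA.
apply: decay_limit => //.
- by rewrite !mulr_ge0// ltW.
- by apply: Rintegral_ge0 => z _.
move=> s s0 s1 al0; set c := s ^+ 2 + 2 * s.
have e01 : 0 < s ^+ 2 < 1 by rewrite exprn_gt0//= exprn_ilt1// ltW.
pose y := mean_mix_entropy L mu nu rho (s ^+ 2).
have ih r (r0 : 0 <= r) := mix_entropy_integrable L0 beta0 kappa0 M0 hA22 hA mrho act Hflow iE0 e01 r0.
have low : (1 - s ^+ 2) * \int[P]_z E t z - c <= y t.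
  have i1 : P.-integrable setT (EFin \o (fun z => (1 - s ^+ 2) * E t z)).
    rewrite (_ : _ \o _ = fun z => ((1 - s ^+ 2)%:E * (E t z)%:E)%E)//.
    by apply: integrableZl => //; exact: iE.
  have ic : P.-integrable setT (EFin \o (fun=> c)) by exact: prob_integrable_cst.
  have eC : \int[P]_z c = c by rewrite /Rintegral (prob_integral_cst P).
  rewrite -[in leLHS]eC -RintegralZl//; last exact: iE.
  rewrite -RintegralB//; apply: le_Rintegral_ae; [exact: integrableB i1 ic|exact: ih|].
  by apply: ae_imp (mix_lower e01 t0) => z; have := mix_defect_ge s0 s1; rewrite /c; lra.
have up : y 0 <= \int[P]_z E 0 z.
  apply: le_Rintegral_ae => //; first exact: ih.
  apply: ae_imp (ae_density L0 beta0 kappa0 Hflow) => z dz.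
  exact: (mix_Phi_le L0 (dz 0 (lexx _)) e01).
apply: (le_trans low); apply: (@le_trans _ _ (expR (- (a - 2 * kappa * M * n / (1 - s ^+ 2)) * t) * y 0)).
  apply: (@gronwall_dini _ y _ (\int[P]_z degree_bound kappa M A z) al0 _ _ _ t t0).
  - by move=> r; exact: mean_mix_entropy_ge0.
  - move=> r q r0 rq.
    exact: (mean_mix_entropy_lipschitz L0 beta0 kappa0 M0 hA22 hA mrho act Hflow iE0 e01).
  - move=> r r0 e e0.
    exact: (mean_mix_entropy_dini L0 beta0 kappa0 M0 hA22 hA mrho act Hflow iE0 e01).
by rewrite ler_wpM2l// expR_ge0.
Qed.

End mean_entropy_decay.

(** [rho 0] attains the datum only for almost every pair [(xi, w)]; the iterated integrals require
    passing to sections. *)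
Lemma entropy_eq (R : realType) (T : ptopologicalType) (L : R) (mu : probability (borel T) R)
    (nu : probability (measurableTypeR R) R) (r r' : R -> borel T -> R -> R) :
  jointly_measurable r -> jointly_measurable r' ->
  {ae (mu \x nu)%E, forall z, forall x, r x z.1 z.2 = r' x z.1 z.2} ->
  entropy L mu nu r = entropy L mu nu r'.
Proof.
move=> mr mr' rr'.
have me q : jointly_measurable q -> measurable_fun setT (fun z : borel T * measurableTypeR R =>
    \int[torus L]_x (q x z.1 z.2 * ln (q x z.1 z.2 / L^-1))%:E)%E.
  move=> mq; apply: (@measurable_partial_integral2 _ _ (measurableTypeR R) _ R (torus L)
    (fun z : measurableTypeR R * (borel T * measurableTypeR R) =>
       (q z.1 z.2.1 z.2.2 * ln (q z.1 z.2.1 z.2.2 / L^-1))%:E)).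
  apply/measurable_EFinP/measurable_funM => //.
  by apply: (measurableT_comp (@measurable_ln R)); apply: measurable_funM.
rewrite /entropy; apply: integral_ae_eq.
- exact: (measurable_partial_integral2 mu (me r mr)).
- exact: (measurable_partial_integral2 mu (me r' mr')).
apply: ae_imp (ae_sections2 rr') => w h; apply: integral_ae_eq.
- exact: (measurable_fun_pair1 w (me r mr)).
- exact: (measurable_fun_pair1 w (me r' mr')).
- by apply: ae_imp h => xi hx; apply: eq_integral => x _; rewrite hx.
Qed.

Theorem proposition24 (R : realType) (L : R) (hL : 0 < L)
    (D : R -> R) (dD : nat -> R -> R) (hD : sobolev_derivs L 2 +oo%E D dD)
    (beta kappa : R) (hbeta : 0 < beta) (hkappa : 0 < kappa)
    (Omega : ptopologicalType) (mu : probability (borel Omega) R)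
    (hmu : full_support mu)
    (A : (borel Omega -> R) -> (borel Omega -> R))
    (hA22 : in_B22 mu A) (hA : graphop mu A)
    (g : R -> R) (hgm : measurable_fun [set: measurableTypeR R] g)
    (hg0 : forall w, 0 <= g w)
    (hg1 : ('N[lebesgue_measure]_1 [EFin \o g] = 1)%E)
    (rho0 : R -> borel Omega -> R -> R) (rho : R -> R -> borel Omega -> R -> R) :
  let gdw := freq_law hgm hg0 hg1 in
  let normD2 := fine ('N[torus L]_+oo [EFin \o dD 2%N])%E in
  let nA := fine (numerical_radius mu A) in
  let alpha := 4 * pi ^+ 2 / (L ^+ 2 * beta) - 2 * kappa * normD2 * nA in
  admissible_datum L mu gdw rho0 ->
  (entropy L mu gdw rho0 < +oo)%E ->
  classical_solution L mu gdw kappa beta (dD 1%N) A rho0 rho ->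
  (kappa%:E < kappa_bound L beta normD2 nA)%E ->
  0 < alpha /\
  forall t, 0 <= t ->
    (entropy L mu gdw (rho t) <= (expR (- alpha * t))%:E * entropy L mu gdw rho0)%E.
Proof.
pose nu : probability (measurableTypeR R) R := freq_law hgm hg0 hg1.
move=> gdw M nA alpha [mrho0 dens0 _] fin0 [mrho [Arho [act sol]]] small.
have [K [k [M0 [pK KL bk dK [IK eK]]]]] := sobolev_kernel hL hD.
rewrite -/M in M0 KL bk.
have [n0 _] := numerical_radius_fin hA22 hA; rewrite -/nA in n0.
have LB : 0 < L ^+ 2 * beta by rewrite mulr_gt0// exprn_gt0.
have alpha0 : 0 < alpha.
  have pi2 : 0 < pi ^+ 2 :> R by rewrite exprn_gt0// pi_gt0.
  have LBn : L ^+ 2 * beta != 0 by rewrite gt_eqF.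
  move: small; rewrite /kappa_bound /alpha -mulrA; case: ifPn => [/eqP h _|h].
    (* With a zero denominator [kappa] is unrestricted, but then the loss term in [alpha]
       vanishes. *)
    have Mn : M * nA = 0 by apply/eqP; move/eqP: h; rewrite mulf_eq0 (negbTE LBn).
    by rewrite -(mulrA (2 * kappa)) Mn mulr0 subr0 divr_gt0// mulr_gt0.
  rewrite lte_fin; have Mn0 : 0 < L ^+ 2 * beta * (M * nA).
    by rewrite lt_neqAle eq_sym h/= mulr_ge0 ?mulr_ge0// ltW.
  rewrite ltr_pdivlMr// => lt.
  rewrite subr_gt0 ltr_pdivlMr//; lra.
have Hflow : {ae (mu \x nu)%E, forall z, exists du ux uxx V V',
    flow L beta kappa z.2 (fun t x => rho t x z.1 z.2) du ux uxx V V'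
      (fun t => M * coupling_dist L nu A (Arho t) z.1)}.
  apply: (@ae_imp2 _ _ _ (mu \x nu)%E _ _ _ _ sol dens0) => z [c12 e0 c0 eq] [_ d0].
  pose V t x := interaction L nu (dD 1%N) (Arho t) x z.1.
  (* The free constant is taken to be [A 1 / L], so that the bound on [V'] is [M] times
     [coupling_dist]. *)
  have hV t (t0 : 0 < t) := interaction_derive hL (A (fun=> 1) z.1 / L) M0 pK KL bk dK IK eK
    (proj1 (act t t0)) (proj1 (eq t t0)).
  have [|||du fl] := @solution_flow R L beta kappa z.2 (fun t x => rho t x z.1 z.2) V
      (fun x => rho0 x z.1 z.2) (fun t => M * coupling_dist L nu A (Arho t) z.1) hL c12 e0 d0 c0.
  - by move=> t t0; have [] := hV t t0.
  - by move=> t t0; have [] := hV t t0.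
  - by move=> t t0 x; have [_] := eq t t0; apply.
  by exists du; do 4 eexists; exact: fl.
have e0 : entropy L mu nu (rho 0%R) = entropy L mu nu rho0.
  apply: entropy_eq => //; first exact: mrho.
  by apply: ae_imp sol => z [].
split; first exact: alpha0.
move=> t t0; have fin0' : (entropy L mu nu (rho 0%R) < +oo)%E by rewrite e0.
have h := mean_entropy_decay hL hbeta hkappa M0 hA22 hA mrho act Hflow alpha0 fin0' t0.
rewrite e0 in h; exact: h.
Qed.
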